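(* Let $(M,\Gamma)$ be a Hopf--von Neumann algebra such that the von Neumann algebra $M$ is injective. Then the set $\mathcal{CAP}(M_\ast)$ of completely almost periodic functionals on the completely contractive Banach algebra $M_\ast$ is a $C^\ast$-subalgebra of $M$, where $M$ is identified with $(M_\ast)^\ast$.
   Context: Operator spaces: for operator spaces $E$ and $F$, $\mathcal{CB}(E,F)$ denotes the space of completely bounded linear maps from $E$ to $F$ with the norm $\|\cdot\|_{\mathrm{cb}}$. The dual $E^\ast$ has its standard operator space structure, given by $M_n(E^\ast) = \mathcal{CB}(E,M_n)$. Quotients $F/Y$ by closed subspaces carry the quotient operator space structure. Complete compactness: a map $T \in \mathcal{CB}(E,F)$ is called completely compact if, for each $\epsilon > 0$, there is a finite-dimensional subspace $Y_\epsilon$ of $F$ such that $\|Q_{Y_\epsilon} T\|_{\mathrm{cb}} < \epsilon$, where $Q_{Y_\epsilon} : F \to F/Y_\epsilon$ is the quotient map. The set of completely compact maps is denoted by $\mathcal{CK}(E,F)$. Completely contractive Banach algebra: an operator space $\mathfrak{A}$ that is also an (associative) algebra such that multiplication is (jointly) completely contractive, i.e., it induces a complete contraction from the operator space projective tensor product $\mathfrak{A} \hat{\otimes} \mathfrak{A}$ to $\mathfrak{A}$. Its dual is a Banach $\mathfrak{A}$-bimodule via $\langle x, a\cdot\phi\rangle := \langle xa,\phi\rangle$ and $\langle x,\phi\cdot a\rangle := \langle ax,\phi\rangle$ for $a,x\in\mathfrak{A}$, $\phi\in\mathfrak{A}^\ast$. For $\phi\in\mathfrak{A}^\ast$, define $L_\phi,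 R_\phi : \mathfrak{A}\to\mathfrak{A}^\ast$ by $L_\phi a := \phi\cdot a$ and $R_\phi a := a\cdot\phi$; these maps are completely bounded. The functional $\phi$ is called completely almost periodic if both $L_\phi$ and $R_\phi$ belong to $\mathcal{CK}(\mathfrak{A},\mathfrak{A}^\ast)$. The collection of all completely almost periodic functionals in $\mathfrak{A}^\ast$ is denoted by $\mathcal{CAP}(\mathfrak{A})$. Hopf--von Neumann algebra: a pair $(M,\Gamma)$ where $M$ is a von Neumann algebra and $\Gamma : M \to M\bar{\otimes}M$ (von Neumann algebra tensor product) is a co-multiplication, i.e., a normal, unital $^\ast$-homomorphism satisfying $(\mathrm{id}\otimes\Gamma)\circ\Gamma = (\Gamma\otimes\mathrm{id})\circ\Gamma$. The predual $M_\ast$, with its canonical operator space structure as a subspace of $M^\ast$ (so that $(M_\ast)^\ast = M$ completely isometrically), becomes a completely contractive Banach algebra with the product $\ast$ given by $\langle f\ast g, x\rangle := \langle f\otimes g,\Gamma x\rangle$ for $f,g\in M_\ast$, $x\in M$. Here a $C^\ast$-subalgebra means a norm-closed $^\ast$-subalgebra. *)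

(* Defs.v *)
From HB Require Import structures.
From mathcomp Require Import all_boot all_order all_algebra.
From mathcomp Require Import complex.
From mathcomp Require Import all_classical all_reals all_analysis.
From mathcomp Require Import ring lra.

Set Implicit Arguments.
Unset Strict Implicit.
Unset Printing Implicit Defensive.

Import Order.TTheory GRing.Theory Num.Theory numFieldNormedType.Exports.

Local Open Scope classical_set_scope.
Local Open Scope ring_scope.
Local Open Scope complex_scope.

Section RealNorm.
Context {R : realType} {V : normedZmodType R[i]}.
Implicit Types u v : V.

Definition rnorm u : R := complex.Re `|u|.

Lemma rnormE u : `|u| = (rnorm u)%:C.
Proof.
have := normr_ge0 u; rewrite /rnorm; case: `|u| => a b /=.
by rewrite lecE /= => /andP[/eqP -> _].
Qed.

Lemma rnorm_ge0 u : 0 <= rnorm u.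
Proof. by have := normr_ge0 u; rewrite rnormE lecR. Qed.

Lemma rnormD u v : rnorm (u + v) <= rnorm u + rnorm v.
Proof. by rewrite -lecR rmorphD /= -!rnormE ler_normD. Qed.

Lemma rnormN u : rnorm (- u) = rnorm u.
Proof. by rewrite /rnorm normrN. Qed.

Lemma rnorm0 : rnorm 0 = 0. Proof. by rewrite /rnorm normr0. Qed.

Lemma rnorm0_eq0 u : rnorm u = 0 -> u = 0.
Proof. by move=> h; apply/eqP; rewrite -normr_eq0 rnormE h. Qed.
End RealNorm.

Lemma rnormM {R : realType} (a b : R[i]) : rnorm (a * b) = rnorm a * rnorm b.
Proof. by apply: complexI; rewrite rmorphM /= -!rnormE normrM. Qed.

Lemma rnormZ {R : realType} {V : normedModType R[i]} (a : R[i]) (v : V) :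
  rnorm (a *: v) = rnorm a * rnorm v.
Proof. by apply: complexI; rewrite rmorphM /= -!rnormE normrZ. Qed.

Lemma rnorm_real {R : realType} (t : R) : rnorm (t%:C) = `|t|.
Proof. by rewrite /rnorm normc_def /= expr0n addr0 sqrtr_sqr. Qed.

Lemma Re_le_rnorm {R : realType} (z : R[i]) : `|complex.Re z| <= rnorm z.
Proof. by rewrite -lecR -rnormE normc_ge_Re. Qed.

HB.mixin Record CompleteNormedModule_isHilbert (R : realType) H
    of CompleteNormedModule R[i] H := {
  inner : {dot H for Num.conj_op};
  normr_inner : forall u : H, `|u| ^+ 2 = inner u u
}.
#[short(type="hilbertType")]
HB.structure Definition Hilbert (R : realType) :=
  {H of CompleteNormedModule_isHilbert R H & CompleteNormedModule R[i] H}.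

Section Inner.
Context {R : realType} {H : hilbertType R}.
Implicit Types u v w : H.

Lemma innerC u v : inner u v = (inner v u)^*.
Proof. by rewrite hermC /= expr0 mul1r. Qed.
Lemma innerDl u v w : inner (u + v) w = inner u w + inner v w.
Proof. by rewrite linearDl. Qed.
Lemma innerDr u v w : inner u (v + w) = inner u v + inner u w.
Proof. by rewrite linearDr. Qed.
Lemma innerZl a u v : inner (a *: u) v = a * inner u v.
Proof. by rewrite linearZl_LR. Qed.
Lemma innerZr a u v : inner u (a *: v) = a^* * inner u v.
Proof. by rewrite linearZr_LR. Qed.
Lemma innerNl u v : inner (- u) v = - inner u v.
Proof. by rewrite -scaleN1r innerZl mulN1r. Qed.
Lemma inner0l v : inner 0 v = 0.
Proof. by rewrite linear0l. Qed.
Lemma inner0r u : inner u 0 = 0.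
Proof. by rewrite linear0r. Qed.
Lemma innerNr u v : inner u (- v) = - inner u v.
Proof. by rewrite linearNr. Qed.

Lemma inner_eq0 u : inner u u = 0 -> u = 0.
Proof.
rewrite -normr_inner => /eqP; rewrite expf_eq0 /= normr_eq0 => /eqP. exact.
Qed.

Lemma inner_ext u v : (forall w, inner w u = inner w v) -> u = v.
Proof.
move=> h; apply/eqP; rewrite -subr_eq0; apply/eqP/inner_eq0.
by rewrite innerDr innerNr h subrr.
Qed.

Lemma rnorm_sq u : rnorm u ^+ 2 = complex.Re (inner u u).
Proof. by rewrite -normr_inner rnormE -rmorphXn. Qed.

Lemma rnorm_sqD u v :
  rnorm (u + v) ^+ 2 = rnorm u ^+ 2 + rnorm v ^+ 2 + 2 * complex.Re (inner u v).
Proof.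
rewrite !rnorm_sq innerDl !innerDr (innerC v u).
by case: (inner u u) => a b; case: (inner u v) => c d; case: (inner v v) => e f /=; ring.
Qed.

Lemma Cauchy_Schwarz u v : rnorm (inner u v) <= rnorm u * rnorm v.
Proof.
have [->|v0] := eqVneq v 0.
  by rewrite inner0r !rnorm0 mulr0.
have vpos : 0 < rnorm v.
  rewrite lt_neqAle rnorm_ge0 andbT eq_sym; apply: contra v0 => /eqP h.
  by apply/eqP/rnorm0_eq0.
have [a ort] : exists a, inner (u + a *: v) v = 0.
  exists (- (inner u v / inner v v)); rewrite innerDl innerZl mulNr mulfVK ?subrr //.
  by apply: contra v0 => /eqP /inner_eq0 ->.
have e1 : u = (u + a *: v) + (- a) *: v by rewrite scaleNr addrK.
have : rnorm (a *: v) ^+ 2 <= rnorm u ^+ 2.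
  rewrite [X in _ <= rnorm X ^+ 2]e1 rnorm_sqD innerZr ort mulr0 mulr0 addr0.
  by rewrite scaleNr rnormN lerDr sqr_ge0.
rewrite ler_pXn2r ?nnegrE ?rnorm_ge0 // rnormZ => le1.
have <- : rnorm a * rnorm v * rnorm v = rnorm (inner u v); last first.
  by rewrite ler_wpM2r // rnorm_ge0.
have -> : inner u v = - a * inner v v.
  by rewrite {1}e1 innerDl ort add0r innerZl.
by rewrite -normr_inner rnormE -rmorphXn /= rnormM rnormN rnorm_real
  ger0_norm ?sqr_ge0 // expr2 mulrA.
Qed.

(* Riesz representation, by minimizing |u|^2 - 2 Re (f u). *)
Lemma Riesz (f : H -> R[i]) (k : R) : 0 <= k ->
  (forall a u v, f (a *: u + v) = a * f u + f v) ->
  (forall u, rnorm (f u) <= k * rnorm u) ->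
  exists2 z, (forall u, f u = inner u z) & rnorm z <= k.
Proof.
move=> k0 flin fk.
have fD u v : f (u + v) = f u + f v by rewrite -[u]scale1r flin mul1r scale1r.
have f0 : f 0 = 0 by apply: (addrI (f 0)); rewrite -fD !addr0.
have fZ a u : f (a *: u) = a * f u by rewrite -[a *: u]addr0 flin f0 !addr0.
have fN u : f (- u) = - f u by rewrite -scaleN1r fZ mulN1r.
have Rfk u : complex.Re (f u) <= k * rnorm u.
  by apply: le_trans (fk u); apply: le_trans (Re_le_rnorm _); rewrite ler_norm.
pose J u := rnorm u ^+ 2 - 2 * complex.Re (f u).
have Jlb u : - k ^+ 2 <= J u.
  by have := Rfk u; have := sqr_ge0 (rnorm u - k); rewrite /J; nra.
have Jinf : has_inf (range J).
  by split; [exists (J 0), 0 | exists (- k ^+ 2) => _ [u _ <-]].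
pose d := inf (range J).
have dJ u : d <= J u by apply: ge_inf; [case: Jinf|exists u].
have half (x : H) : 2^-1 *: (x + x) = x.
  by rewrite scalerDr -scalerDl -[2^-1]mul1r -splitr scale1r.
have parJ u v : rnorm (u - v) ^+ 2 <= 2 * (J u - d) + 2 * (J v - d).
  pose m := 2^-1 *: (u + v); pose h := 2^-1 *: (u - v).
  have eu : u = m + h.
    by rewrite /m /h -scalerDr addrACA subrr addr0 half.
  have ev : v = m - h.
    by rewrite /m /h -scalerBr opprB [v - u]addrC addrACA subrr add0r half.
  have -> : u - v = h + h by rewrite {1}eu {1}ev opprB addrC addrA subrK.
  have := dJ m; rewrite {1}eu {1}ev /J !rnorm_sqD !fD !fN !innerNr rnormN.
  rewrite -rnorm_sq; case: (f m) => a b; case: (f h) => a' b'.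
  by case: (inner m h) => p q /=; nra.
have /choice[us usP] n : exists u, J u < d + n.+1%:R^-1.
  have n0 : 0 < n.+1%:R^-1 :> R by rewrite invr_gt0.
  by have [_ [u _ <-] lt] := inf_adherent n0 Jinf; exists u.
have cvus : cvg (us @ \oo).
  apply: cauchy_cvg; apply: cauchy_exP => e e0.
  have [e' e'0 ->] : exists2 e' : R, 0 < e' & e = e'%:C.
    by move: e0; case: e => a b; rewrite ltcE /= => /andP[/eqP -> ?]; exists a.
  have e2 : 0 < e' ^+ 2 / 4 by rewrite divr_gt0 // exprn_gt0.
  have [N _ NP] := near_infty_natSinv_lt (PosNum e2).
  exists (us N); exists N => // n /= Nn.
  rewrite -ball_normE /ball_ /= rnormE ltcR -(@ltr_pXn2r _ 2) ?nnegrE ?rnorm_ge0 ?ltW //.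
  have aux (a b r p q x c : R) : p < x / 4 -> q < x / 4 -> a < c + p ->
      b < c + q -> r <= 2 * (b - c) + 2 * (a - c) -> r < x by lra.
  exact (aux _ _ _ _ _ _ _ (NP n Nn) (NP N (leqnn N)) (usP n) (usP N) (parJ (us N) (us n))).
have [z zP] : exists z, forall e : R, 0 < e ->
    exists2 n, rnorm (us n - z) < e & n.+1%:R^-1 < e.
  exists (lim (us @ \oo)) => e e0.
  have e0' : 0 < e%:C by rewrite ltcR.
  have /cvgrPdist_lt/(_ _ e0')[N _ NP] : us @ \oo --> lim (us @ \oo) by [].
  have [N' _ NP'] := near_infty_natSinv_lt (PosNum e0).
  exists (maxn N N'); last exact: (NP' _ (leq_maxr _ _)).
  by rewrite -ltcR -rnormE distrC; apply: (NP _ (leq_maxl _ _)).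
have Jz : J z <= d.
  apply/ler_addgt0Pr => e e0; set c := rnorm z + k + 1.
  have c0 : 0 < c by rewrite /c addrC; have := rnorm_ge0 z; lra.
  have e1 : 0 < Num.min 1 (e / (4 * c)) by rewrite lt_min ltr01 divr_gt0 // mulr_gt0.
  have [n lt1 lt2] := zP _ e1; pose h := z - us n.
  have hE : rnorm h < Num.min 1 (e / (4 * c)) by rewrite -rnormN opprB.
  have : rnorm h * (4 * c) < e.
    rewrite -ltr_pdivlMr ?mulr_gt0 //; apply: lt_le_trans hE _; by rewrite ge_min lexx orbT.
  have : n.+1%:R^-1 * (4 * c) < e.
    rewrite -ltr_pdivlMr ?mulr_gt0 //; apply: lt_le_trans lt2 _; by rewrite ge_min lexx orbT.
  have : rnorm h < 1 by apply: lt_le_trans hE _; by rewrite ge_min lexx.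
  have usE : us n = z + - h by rewrite opprB addrC subrK.
  have zE : z = us n + h by rewrite usE subrK.
  have le1 : rnorm (us n) <= rnorm z + rnorm h.
    by rewrite usE -[rnorm h]rnormN rnormD.
  have le2 : rnorm z ^+ 2 <= (rnorm (us n) + rnorm h) ^+ 2.
    by rewrite ler_pXn2r ?nnegrE ?addr_ge0 ?rnorm_ge0 // zE rnormD.
  have eJ : J z = J (us n) + (rnorm z ^+ 2 - rnorm (us n) ^+ 2)
                  + 2 * complex.Re (f (- h)).
    rewrite /J [in f z]zE fD fN.
    by case: (f (us n)) => ? ?; case: (f h) => ? ? /=; ring.
  have := usP n; have := Rfk (- h); rewrite rnormN eJ.
  have := rnorm_ge0 h; have := rnorm_ge0 z; have := rnorm_ge0 (us n).
  have aux (a b y w dd j q r m : R) : 0 <= a -> 0 <= b -> 0 <= y -> a <= y + b ->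
      m <= (a + b) ^+ 2 -> b < 1 -> w * (4 * (y + k + 1)) < r ->
      b * (4 * (y + k + 1)) < r -> q <= k * b -> j < dd + w -> 0 < w ->
      j + (m - a ^+ 2) + 2 * q <= dd + r.
    move=> a0 b0 y0 ab mab b1 wr br qk jw w0.
    have w4 : w * 4 < r by apply: le_lt_trans wr; rewrite ler_wpM2l ?(ltW w0) //; lra.
    have abb : a * b <= (y + b) * b by rewrite ler_wpM2r.
    have bb : b * b <= b by rewrite ler_piMr // ltW.
    nra.
  have w0 : 0 < n.+1%:R^-1 :> R by rewrite invr_gt0.
  move=> a0 y0 b0 qk jw b1 wr br.
  exact (aux _ _ _ _ _ _ _ _ _ a0 b0 y0 le1 le2 b1 wr br qk jw w0).
have stat w : complex.Re (f w) = complex.Re (inner w z).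
  pose A := rnorm w ^+ 2; pose B := 2 * (complex.Re (inner w z) - complex.Re (f w)).
  have A0 : 0 <= A by rewrite sqr_ge0.
  have tP t : 0 <= t ^+ 2 * A + t * B.
    have := le_trans Jz (dJ (t%:C *: w + z)).
    rewrite /J rnorm_sqD rnormZ rnorm_real fD fZ innerZl exprMn -normrX.
    rewrite ger0_norm ?sqr_ge0 // /A /B.
    by case: (f w) => ? ?; case: (inner w z) => ? ?; case: (f z) => ? ? /=; lra.
  have : 0 <= - (B / (A + 1)) ^+ 2.
    have -> : - (B / (A + 1)) ^+ 2
        = (- (B / (A + 1))) ^+ 2 * A + (- (B / (A + 1))) * B.
      by field; rewrite gt_eqF // ltr_wpDl.
    exact: tP.
  rewrite oppr_ge0 => le0.
  have : (B / (A + 1)) ^+ 2 == 0 by rewrite eq_le le0 sqr_ge0.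
  rewrite expf_eq0 /= mulf_eq0 invr_eq0 [A + 1 == 0]gt_eqF ?ltr_wpDl // orbF.
  by rewrite /B mulf_eq0 pnatr_eq0 /= subr_eq0 => /eqP.
have fE w : f w = inner w z.
  apply/eqP; rewrite eq_complex stat eqxx /=.
  have := stat ('i *: w); rewrite fZ innerZl.
  by case: (f w) => a b; case: (inner w z) => c e /=; rewrite !mul0r !mul1r
    !sub0r => /oppr_inj ->.
exists z => //.
have [->|z0] := eqVneq (rnorm z) 0; first by [].
have zp : 0 < rnorm z by rewrite lt_neqAle eq_sym z0 rnorm_ge0.
by rewrite -(ler_pM2r zp) -expr2 rnorm_sq -fE Rfk.
Qed.
End Inner.

Section BoundedOperators.
Context {R : realType} {H : hilbertType R}.

Definition bounded_operator : {pred H -> H} :=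
  [pred f : H -> H | `[< linear f /\
    exists k : R, forall u, rnorm (f u) <= k * rnorm u >]].

Lemma bounded_operatorP (f : H -> H) : reflect
  (linear f /\ exists2 k : R, 0 <= k & forall u, rnorm (f u) <= k * rnorm u)
  (f \in bounded_operator).
Proof.
apply: (iffP (asboolP _)) => [] [lf [k]] => [fk|k0 fk]; split=> //; last by exists k.
exists `|k| => // u; apply: le_trans (fk u) _.
by rewrite ler_wpM2r ?rnorm_ge0 ?ler_norm.
Qed.

Lemma bounded_operator_submod : submod_closed bounded_operator.
Proof.
split=> [|a f g /bounded_operatorP[lf [k k0 fk]] /bounded_operatorP[lg [l l0 gl]]].
  apply/bounded_operatorP; split=> [b u v|]; first by rewrite /= scaler0 addr0.
  by exists 0 => // u; rewrite rnorm0 mul0r.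
apply/bounded_operatorP; split=> [b u v|].
  rewrite !fctE /= lf lg !scalerDr !scalerA [a * b]mulrC addrACA.
  by congr (_ + _ + _); rewrite scalerA.
exists (rnorm a * k + l); first by rewrite addr_ge0 // mulr_ge0 // rnorm_ge0.
move=> u; rewrite !fctE /=; apply: le_trans (rnormD _ _) _.
by rewrite rnormZ mulrDl -mulrA lerD // ler_wpM2l // rnorm_ge0.
Qed.

HB.instance Definition _ := GRing.isSubmodClosed.Build R[i] (H -> H)
  bounded_operator bounded_operator_submod.
End BoundedOperators.

Record bop (R : realType) (H : hilbertType R) := Bop {
  bop_fun :> H -> H;
  bop_prop : bop_fun \in bounded_operator
}.

Section BopStructure.
Context {R : realType} {H : hilbertType R}.
HB.instance Definition _ := [isSub for @bop_fun R H].
HB.instance Definition _ := [Choice of bop H by <:].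
HB.instance Definition _ := [SubChoice_isSubLmodule of bop H by <:].
Implicit Types a b : bop H.

Lemma bop_linear a : linear a.
Proof. by case/bounded_operatorP: (bop_prop a). Qed.

Lemma bop0 a : a 0 = 0.
Proof. by have := bop_linear a (-1) 0 0; rewrite scaler0 addr0 scaleN1r addNr. Qed.

Lemma bop_bounded a : exists2 k : R, 0 <= k & forall u, rnorm (a u) <= k * rnorm u.
Proof. by case/bounded_operatorP: (bop_prop a). Qed.

Lemma bopP a b : (forall u, a u = b u) <-> a = b.
Proof. by split=> [h|-> //]; apply: val_inj; apply/funext. Qed.

Lemma bop1_subproof : @idfun H \in bounded_operator.
Proof. by apply/bounded_operatorP; split=> //; exists 1 => // u; rewrite mul1r. Qed.
Definition bop1 : bop H := Bop bop1_subproof.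

Lemma bop_mul_subproof a b : a \o b \in bounded_operator.
Proof.
apply/bounded_operatorP; split=> [c u v|]; first by rewrite /= !bop_linear.
have [k k0 ak] := bop_bounded a; have [l l0 bl] := bop_bounded b.
exists (k * l); first exact: mulr_ge0.
by move=> u; apply: le_trans (ak _) _; rewrite -mulrA ler_wpM2l.
Qed.
Definition bop_mul a b : bop H := Bop (bop_mul_subproof a b).

Lemma adj_exists a : exists b, forall u v, inner (a u) v = inner u (b v).
Proof.
have [k k0 ak] := bop_bounded a.
have lip v c u u' : inner (a (c *: u + u')) v = c * inner (a u) v + inner (a u') v.
  by rewrite bop_linear innerDl innerZl.
have /choice[b bP] v : exists z, (forall u, inner (a u) v = inner u z) /\
    rnorm z <= k * rnorm v.
  have [|||z zP zk] := @Riesz _ _ (fun u => inner (a u) v) (k * rnorm v).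
  - by rewrite mulr_ge0 ?rnorm_ge0.
  - exact: lip.
  - move=> u; apply: le_trans (Cauchy_Schwarz _ _) _.
    by rewrite mulrAC ler_wpM2r ?rnorm_ge0.
  - by exists z.
have bb : b \in bounded_operator.
  apply/bounded_operatorP; split; last by exists k => // u; case: (bP u).
  move=> c u v; apply: inner_ext => w.
  by rewrite innerDr innerZr -!(bP _).1 innerDr innerZr.
by exists (Bop bb) => u v; case: (bP v).
Qed.

Definition adj a : bop H := projT1 (cid (adj_exists a)).

Lemma adjP a u v : inner (a u) v = inner u (adj a v).
Proof. exact: (projT2 (cid (adj_exists a))). Qed.

Lemma adj_uniq a b : (forall u v, inner (a u) v = inner u (b v)) -> b = adj a.
Proof. by move=> h; apply/bopP => v; apply: inner_ext => w; rewrite -h adjP. Qed.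

Lemma adjK a : adj (adj a) = a.
Proof. by apply/esym/adj_uniq => u v; rewrite innerC -adjP -innerC. Qed.

Lemma adj_mul a b : adj (bop_mul a b) = bop_mul (adj b) (adj a).
Proof. by apply/esym/adj_uniq => u v; rewrite /= !adjP. Qed.

Definition commutant (S : set (bop H)) : set (bop H) :=
  [set b | forall a, S a -> bop_mul a b = bop_mul b a].

Lemma commutant_adj S : (forall a, S a -> S (adj a)) ->
  forall b, commutant S b -> commutant S (adj b).
Proof.
by move=> Sadj b Sb a Sa; rewrite -[a]adjK -!adj_mul Sb //; exact: Sadj.
Qed.

Lemma commutant3 S : commutant (commutant (commutant S)) = commutant S.
Proof.
apply/seteqP; split=> [b h a Sa|b h a]; last by move/(_ b h).
by apply: h => c; move/(_ a Sa).
Qed.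

Lemma commutant_submod S (k : R[i]) b c : commutant S b -> commutant S c ->
  commutant S (k *: b + c).
Proof.
move=> hb hc d Sd; apply/bopP => u.
have /bopP/(_ u) := hb d Sd; have /bopP/(_ u) := hc d Sd => /= e1 e2.
change (d (k *: b u + c u) = k *: b (d u) + c (d u)).
by rewrite bop_linear e1 e2.
Qed.

Lemma commutant0 S : commutant S 0.
Proof.
move=> d Sd; apply/bopP => u /=.
exact: bop0.
Qed.

Lemma commutant1 S : commutant S bop1.
Proof. by move=> d Sd; apply/bopP. Qed.

Lemma commutant_mul S b c : commutant S b -> commutant S c ->
  commutant S (bop_mul b c).
Proof.
move=> hb hc d Sd; apply/bopP => u /=.
have /bopP/(_ (c u)) /= := hb d Sd; have /bopP/(_ u) /= := hc d Sd.
by move=> e1 ->; rewrite e1.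
Qed.

End BopStructure.

Record vnAlgebra (R : realType) (H : hilbertType R) := VNAlgebra {
  vn_set : set (bop H);
  vn_adj_closed : forall a, vn_set a -> vn_set (adj a);
  vn_bicommutant : commutant (commutant vn_set) = vn_set
}.

Section VNStructure.
Context {R : realType} {H : hilbertType R} (M : vnAlgebra H).

Definition vn_pred : {pred bop H} := [pred a | `[< vn_set M a >]].

Lemma vn_submod : submod_closed vn_pred.
Proof.
split=> [|a b c]; first by apply/asboolP; rewrite -vn_bicommutant; exact: commutant0.
move=> /asboolP hb /asboolP hc; apply/asboolP.
by rewrite -vn_bicommutant; apply: commutant_submod; rewrite vn_bicommutant.
Qed.
HB.instance Definition _ := GRing.isSubmodClosed.Build R[i] (bop H) vn_pred vn_submod.

Record vn_elt := VNElt { vn_val :> bop H; vn_prop : vn_val \in vn_pred }.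

HB.instance Definition _ := [isSub for vn_val].
HB.instance Definition _ := [Choice of vn_elt by <:].
HB.instance Definition _ := [SubChoice_isSubLmodule of vn_elt by <:].
End VNStructure.

Coercion vn_elt : vnAlgebra >-> Sortclass.

Section VNOperations.
Context {R : realType} {H : hilbertType R} {M : vnAlgebra H}.
Implicit Types x y : M.

Lemma vn_one_subproof : bop1 \in vn_pred M.
Proof. by apply/asboolP; rewrite -vn_bicommutant; exact: commutant1. Qed.
Definition vn_one : M := VNElt vn_one_subproof.

Lemma vn_mul_subproof x y : bop_mul x y \in vn_pred M.
Proof.
apply/asboolP; rewrite -vn_bicommutant.
by apply: commutant_mul; rewrite vn_bicommutant; apply/asboolP/vn_prop.
Qed.
Definition vn_mul x y : M := VNElt (vn_mul_subproof x y).

Lemma vn_star_subproof x : adj x \in vn_pred M.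
Proof. by apply/asboolP/vn_adj_closed/asboolP/vn_prop. Qed.
Definition vn_star x : M := VNElt (vn_star_subproof x).
End VNOperations.

Section Interleave.
Definition interleave (T : Type) (u v : nat -> T) n := if odd n then v n./2 else u n./2.

Lemma series_interleave (V : zmodType) (u v : nat -> V) n :
  series (interleave u v) n = series u (uphalf n) + series v n./2.
Proof.
elim: n => [|n IH]; first by rewrite !seriesEnat /= !big_geq // addr0.
rewrite seriesSr IH /interleave uphalfE /= uphalf_half.
case: (odd n) => /=; rewrite ?add1n ?add0n seriesSr.
  by rewrite seriesSr addrA.
by rewrite addrAC.
Qed.

Lemma cvg_half : half @ \oo --> \oo.
Proof.
apply/cvgnyPge => n; exists n.*2 => // m /= nm.
by apply: leq_trans (half_leq nm); rewrite doubleK.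
Qed.

Lemma cvg_uphalf : uphalf @ \oo --> \oo.
Proof.
apply/cvgnyPge => n; exists n.*2 => // m /= nm.
by apply: leq_trans (half_leq (leqW nm)); rewrite doubleK.
Qed.

Lemma cvg_interleave (K : numFieldType) (V : pseudoMetricNormedZmodType K)
    (u v : nat -> V) (a b : V) :
  series u @ \oo --> a -> series v @ \oo --> b ->
  series (interleave u v) @ \oo --> a + b.
Proof.
move=> ua vb.
rewrite (_ : series _ = (series u \o uphalf) \+ (series v \o half)); last first.
  by apply/funext => n /=; rewrite series_interleave.
by apply: cvgD; apply: cvg_comp; (exact: cvg_half || exact: cvg_uphalf || eassumption).
Qed.
End Interleave.

Section Normal.
Context {R : realType} {H : hilbertType R}.

Definition square_summable (xi : nat -> H) : Prop :=
  cvgn (series (fun n => rnorm (xi n) ^+ 2)).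

Variable M : vnAlgebra H.

(* sigma-weakly continuous functionals: x |-> sum_n <x xi_n, eta_n>. *)
Definition normal : {pred M -> R[i]} :=
  [pred f : M -> R[i] | `[< exists xi eta : nat -> H,
    [/\ square_summable xi, square_summable eta &
      forall x : M,
        series (fun n => inner (x (xi n)) (eta n) : R[i]^o) @ \oo --> (f x : R[i]^o)] >]].

Lemma normal_submod : submod_closed normal.
Proof.
split=> [|a f g /asboolP[xi [eta [xi2 eta2 fE]]] /asboolP[xi' [eta' [xi'2 eta'2 gE]]]];
  apply/asboolP.
  exists (fun=> 0), (fun=> 0).
  have h : square_summable (fun=> 0).
    rewrite /square_summable (_ : series _ = cst 0); first exact: is_cvg_cst.
    apply/funext => n; rewrite seriesEnat /= big1 // => m _.
    by rewrite rnorm0 expr0n.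
  split=> // x; rewrite (_ : series _ = cst 0); first exact: cvg_cst.
  by apply/funext => n; rewrite seriesEnat /= big1 // => m _; rewrite inner0r.
have sq (u v : nat -> H) : square_summable u -> square_summable v ->
    square_summable (interleave u v).
  move=> hu hv; rewrite /square_summable.
  rewrite (_ : (fun n => _) = interleave (fun n => rnorm (u n) ^+ 2)
                                         (fun n => rnorm (v n) ^+ 2)); last first.
    by apply/funext => n; rewrite /interleave; case: odd.
  by apply/cvg_ex; eexists; exact: cvg_interleave hu hv.
exists (interleave (fun n => a *: xi n) xi'), (interleave eta eta'); split.
- apply: sq => //; rewrite /square_summable.
  rewrite (_ : (fun n => _) = (rnorm a ^+ 2) *: (fun n => rnorm (xi n) ^+ 2)).
    by rewrite seriesZ; exact: is_cvgZr.
  by apply/funext => n; rewrite rnormZ exprMn.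
- exact: sq.
- move=> x.
  rewrite (_ : (fun n => _) = interleave (a *: (fun n => inner (x (xi n)) (eta n) : R[i]^o))
      (fun n => inner (x (xi' n)) (eta' n) : R[i]^o)); last first.
    apply/funext => n; rewrite /interleave; case: odd => //.
    by rewrite -[a *: _]addr0 bop_linear bop0 addr0 innerZl.
  by apply: cvg_interleave (gE x); rewrite seriesZ; apply: cvgZr; exact: fE.
Qed.
HB.instance Definition _ := GRing.isSubmodClosed.Build R[i] (M -> R[i]) normal normal_submod.

Record predual := Predual { predual_fun :> M -> R[i]; predual_normal : predual_fun \in normal }.
HB.instance Definition _ := [isSub for predual_fun].
HB.instance Definition _ := [Choice of predual by <:].
HB.instance Definition _ := [SubChoice_isSubLmodule of predual by <:].
End Normal.

Section OperatorNorm.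
Context {R : realType}.

Definition l2norm (I : finType) (V : normedZmodType R[i]) (v : I -> V) : R :=
  Num.sqrt (\sum_i rnorm (v i) ^+ 2).

Definition opnorm (I J : finType) (V W : normedZmodType R[i])
    (A : I -> J -> V -> W) : R :=
  sup [set l2norm (fun i => \sum_j A i j (v j)) | v in [set v : J -> V | l2norm v <= 1]].
End OperatorNorm.

(* Only the data of the matrix norms; Ruan's axioms are in [operator_space]. *)
HB.mixin Record Lmodule_isMatrixNormed (R : realType) V of GRing.Lmodule R[i] V := {
  mnorm : forall n, 'M[V]_n -> R
}.
#[short(type="matrixNormedType")]
HB.structure Definition MatrixNormed (R : realType) :=
  {V of Lmodule_isMatrixNormed R V & GRing.Lmodule R[i] V}.
Arguments mnorm {R s n}.

Section ScalarMatrices.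
Context {R : realType}.

(* M_k(M_n) = M_(kn), acting on C^k (x) C^n. *)
HB.instance Definition _ n := Lmodule_isMatrixNormed.Build R 'M[R[i]]_n
  (fun k (x : 'M['M[R[i]]_n]_k) =>
    opnorm (fun (p q : 'I_k * 'I_n) (z : R[i]) => x p.1 q.1 p.2 q.2 * z)).

Definition scalar_norm m n (a : 'M[R[i]]_(m, n)) : R :=
  opnorm (fun i j (z : R[i]) => a i j * z).
End ScalarMatrices.

Section CompleteBoundedness.
Context {R : realType}.
Implicit Types E F : matrixNormedType R.

Definition norm1 E (x : E) : R := mnorm (const_mx x : 'M[E]_1).

Definition cb_norm E F (T : E -> F) : \bar R :=
  ereal_sup [set r | exists n (x : 'M[E]_n),
    mnorm x <= 1 /\ r = (mnorm (map_mx T x))%:E].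

Definition completely_bounded E F (T : E -> F) : Prop :=
  linear T /\ (cb_norm T < +oo)%E.

Definition complete_contraction E F (T : E -> F) : Prop :=
  linear T /\ (cb_norm T <= 1%:E)%E.

Definition complete_isometry E F (T : E -> F) : Prop :=
  linear T /\ forall n (x : 'M[E]_n), mnorm (map_mx T x) = mnorm x.

(* the matrix product a x b *)
Definition bimod E m n (a : 'M[R[i]]_(m, n)) (x : 'M[E]_n) (b : 'M[R[i]]_(n, m)) : 'M[E]_m :=
  \matrix_(i, j) \sum_k \sum_l (a i k * b l j) *: x k l.

Record operator_space E : Prop := {
  mnorm_eq0 : forall n (x : 'M[E]_n), mnorm x = 0 -> x = 0;
  mnorm_triangle : forall n (x y : 'M[E]_n), mnorm (x + y) <= mnorm x + mnorm y;
  mnorm_bimod : forall m n (a : 'M[R[i]]_(m, n)) (x : 'M[E]_n) (b : 'M[R[i]]_(n, m)),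
    mnorm (bimod a x b) <= scalar_norm a * mnorm x * scalar_norm b;
  mnorm_dsum : forall m n (x : 'M[E]_m) (y : 'M[E]_n),
    mnorm (block_mx x 0 0 y) = Num.max (mnorm x) (mnorm y)
}.

(* Injectivity among operator spaces and complete contractions. *)
Definition injective_operator_space (V : matrixNormedType R) : Prop :=
  forall (E F : matrixNormedType R) (j : E -> F) (T : E -> V),
    operator_space E -> operator_space F ->
    complete_isometry j -> complete_contraction T ->
    exists2 S : F -> V, complete_contraction S & forall x, S (j x) = T x.
End CompleteBoundedness.

Section Dual.
Context {R : realType} (E : matrixNormedType R).

Definition bounded_functional : {pred E -> R[i]} :=
  [pred f : E -> R[i] | `[< (forall a x y, f (a *: x + y) = a * f x + f y) /\
    exists k : R, forall x, rnorm (f x) <= k * norm1 x >]].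

Lemma bounded_functional_submod : submod_closed bounded_functional.
Proof.
split=> [|a f g /asboolP[lf [k fk]] /asboolP[lg [l gl]]]; apply/asboolP.
  split=> [b u v|]; first by rewrite /= mulr0 addr0.
  by exists 0 => u; rewrite rnorm0 mul0r.
split=> [b u v|].
  change (a * f (b *: u + v) + g (b *: u + v)
    = b * (a * f u + g u) + (a * f v + g v)).
  by rewrite lf lg; ring.
exists (rnorm a * k + l) => u.
change (rnorm (a * f u + g u) <= (rnorm a * k + l) * norm1 u).
apply: le_trans (rnormD _ _) _.
by rewrite rnormM mulrDl -mulrA lerD // ler_wpM2l // rnorm_ge0.
Qed.
HB.instance Definition _ := GRing.isSubmodClosed.Build R[i] (E -> R[i])
  bounded_functional bounded_functional_submod.

Record dual := Dual {
  dual_fun :> E -> R[i];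
  dual_prop : dual_fun \in bounded_functional
}.
HB.instance Definition _ := [isSub for dual_fun].
HB.instance Definition _ := [Choice of dual by <:].
HB.instance Definition _ := [SubChoice_isSubLmodule of dual by <:].

(* M_n(E^* ) = CB(E, M_n). *)
HB.instance Definition _ := Lmodule_isMatrixNormed.Build R dual
  (fun n (f : 'M[dual]_n) => fine (cb_norm (fun x : E => \matrix_(i, j) f i j x))).
End Dual.

Section QuotientSpace.
Local Open Scope quotient_scope.
Context {R : realType} (F : matrixNormedType R) (Y : submodClosed F).

(* [submodClosed] does not provide closure under opposite, which [Quotient] needs. *)
Definition subspace : {pred F} := [pred x | x \in Y].
Lemma subspace_zmod : zmod_closed subspace.
Proof.
split=> [|x y]; rewrite !inE; first exact: rpred0.
by move=> Yx Yy; rewrite rpredD // -scaleN1r rpredZ.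
Qed.
HB.instance Definition _ := GRing.isZmodClosed.Build F subspace subspace_zmod.

Definition quotient_space := Quotient.quot subspace.
HB.instance Definition _ := GRing.Zmodule.on quotient_space.

Definition quotient_map (x : F) : quotient_space := \pi x.

Definition quotient_scale (a : R[i]) (q : quotient_space) : quotient_space :=
  quotient_map (a *: repr q).

Lemma quotient_mapP x y : reflect (quotient_map x = quotient_map y) (x - y \in Y).
Proof. by rewrite -[_ \in Y]/(x - y \in subspace) Quotient.idealrBE; exact: eqP. Qed.

Lemma quotient_mapD x y : quotient_map (x + y) = quotient_map x + quotient_map y.
Proof. by rewrite /quotient_map raddfD. Qed.

Lemma quotient_reprK q : quotient_map (repr q) = q.
Proof. exact: reprK. Qed.

Lemma quotient_scaleE a x : quotient_scale a (quotient_map x) = quotient_map (a *: x).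
Proof.
apply/quotient_mapP; rewrite -scalerBr rpredZ //.
by apply/quotient_mapP; exact: quotient_reprK.
Qed.

Lemma quotient_scaleA a b q :
  quotient_scale a (quotient_scale b q) = quotient_scale (a * b) q.
Proof. by rewrite -[q]quotient_reprK !quotient_scaleE scalerA. Qed.
Lemma quotient_scale1 : left_id 1 quotient_scale.
Proof. by move=> q; rewrite -[q]quotient_reprK quotient_scaleE scale1r. Qed.
Lemma quotient_scaleDr : right_distributive quotient_scale +%R.
Proof.
move=> a p q; rewrite -[p]quotient_reprK -[q]quotient_reprK.
by rewrite -quotient_mapD !quotient_scaleE scalerDr quotient_mapD.
Qed.
Lemma quotient_scaleDl q : {morph quotient_scale^~ q : a b / a + b}.
Proof.
by move=> a b; rewrite -[q]quotient_reprK !quotient_scaleE scalerDl quotient_mapD.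
Qed.
HB.instance Definition _ := GRing.Zmodule_isLmodule.Build R[i] quotient_space
  quotient_scaleA quotient_scale1 quotient_scaleDr quotient_scaleDl.

(* M_n(F / Y) = M_n(F) / M_n(Y). *)
HB.instance Definition _ := Lmodule_isMatrixNormed.Build R quotient_space
  (fun n (q : 'M[quotient_space]_n) =>
    inf [set mnorm x | x in [set x : 'M[F]_n | map_mx quotient_map x = q]]).
End QuotientSpace.

Section FiniteSpan.
Context {R : realType} {F : lmodType R[i]} {n : nat} (y : 'I_n -> F).
Definition finite_span : {pred F} :=
  [pred x | `[< exists c : 'I_n -> R[i], x = \sum_i c i *: y i >]].

Lemma finite_span_submod : submod_closed finite_span.
Proof.
split=> [|a u v /asboolP[c ->] /asboolP[d ->]]; apply/asboolP.
  by exists (fun=> 0); rewrite big1 // => i _; rewrite scale0r.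
exists (fun i => a * c i + d i); rewrite scaler_sumr -big_split /=.
by apply: eq_bigr => i _; rewrite scalerDl scalerA.
Qed.
HB.instance Definition _ := GRing.isSubmodClosed.Build R[i] F
  finite_span finite_span_submod.
End FiniteSpan.

Section CompleteCompactness.
Context {R : realType}.

Definition completely_compact (E F : matrixNormedType R) (T : E -> F) : Prop :=
  completely_bounded T /\
  forall e : R, 0 < e -> exists n (y : 'I_n -> F),
    (cb_norm (quotient_map (finite_span y) \o T) < e%:E)%E.

(* L a = phi . a and R' a = a . phi for the dual bimodule structure. *)
Definition CAP (A : matrixNormedType R) (mul : A -> A -> A) : set (dual A) :=
  [set phi |
    (exists2 L : A -> dual A, (forall a x, L a x = phi (mul a x)) & completely_compact L) /\
    (exists2 R' : A -> dual A, (forall a x, R' a x = phi (mul x a)) & completely_compact R')].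
End CompleteCompactness.

Section VNOperatorSpace.
Context {R : realType} {H : hilbertType R} (M : vnAlgebra H).

HB.instance Definition _ := Lmodule_isMatrixNormed.Build R M
  (fun n (x : 'M[M]_n) => opnorm (fun i j => x i j : H -> H)).

(* The norm on M_n(M_* ) is that of CB(M, M_n), i.e. M_* is a subspace of the
   operator space dual of M. *)
HB.instance Definition _ := Lmodule_isMatrixNormed.Build R (predual M)
  (fun n (f : 'M[predual M]_n) => fine (cb_norm (fun x : M => \matrix_(i, j) f i j x))).

Definition Cstar_subalgebra (B : set M) : Prop :=
  [/\ B 0 /\ (forall (a : R[i]) x y, B x -> B y -> B (a *: x + y)),
      forall x y, B x -> B y -> B (vn_mul x y),
      forall x, B x -> B (vn_star x) &
      forall x, (forall e : R, 0 < e -> exists2 y, B y & norm1 (x - y) < e) -> B x].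
End VNOperatorSpace.

(* A Hilbert space K together with a model of the completed tensor product
   H1 (x) H2 on it; any two such models are unitarily equivalent. *)
Record hilbertTensor (R : realType) (H1 H2 K : hilbertType R) := HilbertTensor {
  tens :> H1 -> H2 -> K;
  tens_linearl : forall v, linear (tens^~ v);
  tens_linearr : forall u, linear (tens u);
  inner_tens : forall u v u' v',
    inner (tens u v) (tens u' v') = inner u u' * inner v v';
  tens_dense : forall (w : K) (e : R), 0 < e ->
    exists n (u : 'I_n -> H1) (v : 'I_n -> H2),
      rnorm (w - \sum_i tens (u i) (v i)) < e
}.

Section TensorProduct.
Context {R : realType} {H1 H2 K : hilbertType R} (t : hilbertTensor H1 H2 K).

Lemma tens_total (w : K) : (forall u v, inner (t u v) w = 0) -> w = 0.
Proof.
move=> w0; apply: rnorm0_eq0; apply/eqP; rewrite eq_le rnorm_ge0 andbT.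
apply/ler_addgt0Pr => e e0; rewrite add0r.
have [n [u [v lt]]] := tens_dense t w e0; apply: le_trans (ltW lt).
rewrite -(@ler_pXn2r _ 2) ?nnegrE ?rnorm_ge0 // rnorm_sqD rnormN.
rewrite (_ : inner w _ = 0) ?mulr0 ?addr0 ?lerDl ?sqr_ge0 //.
rewrite innerC innerNl (big_morph (inner ^~ w) (fun x y => innerDl x y w) (inner0l w)).
by rewrite big1 ?oppr0 ?rmorph0 // => i _; exact: w0.
Qed.

(* c = a (x) b *)
Definition is_tensor_op (a : bop H1) (b : bop H2) (c : bop K) : Prop :=
  forall u v, c (t u v) = t (a u) (b v).

Lemma adj_tensor_op a b c : is_tensor_op a b c -> is_tensor_op (adj a) (adj b) (adj c).
Proof.
move=> abc u v; apply/eqP; rewrite -subr_eq0; apply/eqP/tens_total => u' v'.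
by rewrite innerDr innerNr -adjP abc !inner_tens !adjP subrr.
Qed.

Definition elementary_tensors (M : vnAlgebra H1) (N : vnAlgebra H2) : set (bop K) :=
  [set c | exists (a : M) (b : N), is_tensor_op a b c].

Lemma vn_tensor_adj M N c :
  commutant (commutant (elementary_tensors M N)) c ->
  commutant (commutant (elementary_tensors M N)) (adj c).
Proof.
apply: commutant_adj => d; apply: commutant_adj => {c d} c [a [b abc]].
by exists (vn_star a), (vn_star b); exact: adj_tensor_op.
Qed.

Definition vn_tensor (M : vnAlgebra H1) (N : vnAlgebra H2) : vnAlgebra K :=
  VNAlgebra (@vn_tensor_adj M N) (commutant3 (commutant (elementary_tensors M N))).

(* The unique normal functional on M (x) N with (f (x) g)(a (x) b) = f a * g b. *)
Definition predual_tensor (M : vnAlgebra H1) (N : vnAlgebra H2)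
    (f : predual M) (g : predual N) : predual (vn_tensor M N) :=
  xget (0 : predual (vn_tensor M N)) [set F : predual (vn_tensor M N) |
    forall (a : M) (b : N) (c : vn_tensor M N),
      is_tensor_op a b c -> F c = f a * g b].
End TensorProduct.

Record normal_unital_star_hom (R : realType) (H K : hilbertType R)
    (M : vnAlgebra H) (N : vnAlgebra K) (Phi : M -> N) : Prop := {
  hom_linear : linear Phi;
  hom_mul : forall x y, Phi (vn_mul x y) = vn_mul (Phi x) (Phi y);
  hom_star : forall x, Phi (vn_star x) = vn_star (Phi x);
  hom_one : Phi vn_one = vn_one;
  hom_normal : forall F : predual N, F \o Phi \in @normal R H M
}.

(* [hopf_tensA] identifies (H (x) H) (x) H with H (x) (H (x) H); the maps in
   [comul_coassoc] are the normal extensions Gamma (x) id and id (x) Gamma. *)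
Record hopfVNAlgebra (R : realType) := HopfVNAlgebra {
  hopf_space : hilbertType R;
  hopf_space2 : hilbertType R;
  hopf_space3 : hilbertType R;
  hopf_alg :> vnAlgebra hopf_space;
  hopf_tens : hilbertTensor hopf_space hopf_space hopf_space2;
  hopf_tensl : hilbertTensor hopf_space2 hopf_space hopf_space3;
  hopf_tensr : hilbertTensor hopf_space hopf_space2 hopf_space3;
  hopf_tensA : forall u v w,
    hopf_tensl (hopf_tens u v) w = hopf_tensr u (hopf_tens v w);
  comul : hopf_alg -> vn_tensor hopf_tens hopf_alg hopf_alg;
  comul_hom : normal_unital_star_hom comul;
  comul_coassoc :
    exists (comul_id : vn_tensor hopf_tens hopf_alg hopf_alg ->
              vn_tensor hopf_tensl (vn_tensor hopf_tens hopf_alg hopf_alg) hopf_alg)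
           (id_comul : vn_tensor hopf_tens hopf_alg hopf_alg ->
              vn_tensor hopf_tensr hopf_alg (vn_tensor hopf_tens hopf_alg hopf_alg)),
    [/\ normal_unital_star_hom comul_id, normal_unital_star_hom id_comul,
        forall (a b : hopf_alg) (c : vn_tensor hopf_tens hopf_alg hopf_alg),
          is_tensor_op hopf_tens a b c ->
          is_tensor_op hopf_tensl (comul a) b (comul_id c),
        forall (a b : hopf_alg) (c : vn_tensor hopf_tens hopf_alg hopf_alg),
          is_tensor_op hopf_tens a b c ->
          is_tensor_op hopf_tensr a (comul b) (id_comul c) &
        forall x, id_comul (comul x) = comul_id (comul x) :> bop hopf_space3]
}.

Section PredualProduct.
Context {R : realType} (M : hopfVNAlgebra R).

Definition predual_mul (f g : predual M) : predual M :=
  Predual (hom_normal (comul_hom M) (predual_tensor (hopf_tens M) f g)).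

Lemma predual_mulE f g x :
  predual_mul f g x = predual_tensor (hopf_tens M) f g (comul x).
Proof. by []. Qed.
End PredualProduct.

Arguments predual_mul {R} M f g.

(* Main.v *)
From HB Require Import structures.
Require Import Defs.
From mathcomp Require Import all_boot all_order all_algebra.
From mathcomp Require Import complex.
From mathcomp Require Import all_classical all_reals all_analysis.
From mathcomp Require Import ring lra.

(* Write (f (x) g)(W) for the product of normal functionals and T_W : M_* -> M for the
   map f |-> (g |-> (f (x) g)(W)), where W = Gamma x.  The point is that T_W is completely
   compact if and only if W lies in the norm closure of the algebraic tensor product of M
   with itself; as Gamma is a contractive *-homomorphism, such x form a C*-subalgebra.

   If W is close to sum_i a_i (x) b_i, then T_W is cb-close to a map with values in the
   span of the b_i.  Conversely, let T_W be of cb-norm less than e modulo the span Y of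
   b_1, ..., b_n.  The transpose g |-> (f |-> (f (x) g)(W)) is then a map into M of cb-norm
   at most e on the pre-annihilator of Y in M_*.  By injectivity of M this restriction
   extends to a map S of cb-norm at most e on M_*.  The difference of the transpose and S
   kills the pre-annihilator, so it factors through g |-> (g(b_1), ..., g(b_n)): it comes
   from a tensor sum C = sum_i c_i (x) b_i, and |W - C| <= |S|_cb <= e.

   The norms on M_n(M), M_n(M_* ) and M_n(M_*^* ) are compared by compressing operators to
   the span of finite orthonormal families. *)

Set Implicit Arguments.
Unset Strict Implicit.
Unset Printing Implicit Defensive.

Import Order.TTheory GRing.Theory Num.Theory numFieldNormedType.Exports.

Local Open Scope classical_set_scope.
Local Open Scope ring_scope.
Local Open Scope complex_scope.

(** * Matrix norms as bounds on sesquilinear forms *)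

(** A small lift of T_W modulo Y can be chosen matrix by matrix, but it need not depend linearly on
    f. Its pairing with the pre-annihilator of Y does not depend on the lift; this is why the
    extension takes place on the transposed side, on M_*, where injectivity of M applies. That
    property speaks of complete contractions between operator spaces, so Ruan's axioms have to be
    verified for M_* and for its subspaces.

    Two objects are given only implicitly. [predual_tensor] is picked by [xget] from its values on
    elementary tensors: existence comes from slicing W by one functional and evaluating the other,
    uniqueness from a density theorem for bicommutants. The latter needs projections onto closed
    subspaces of square-summable sequences, obtained from [Riesz] once orthogonal complements are
    made into Hilbert spaces. Likewise the elements of M_*^* are bare functionals, and each has to
    be recognised as the evaluation at an element of M before Y can be described by b_1, ...,
    b_n. *)

Section SquareNorm.
Context {R : realType} {V : normedZmodType R[i]} {I : finType}.
Implicit Types v w : I -> V.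

Lemma l2norm_ge0 v : 0 <= l2norm v.
Proof. exact: sqrtr_ge0. Qed.

Lemma l2norm_sq v : l2norm v ^+ 2 = \sum_i rnorm (v i) ^+ 2.
Proof. by rewrite sqr_sqrtr // sumr_ge0 // => i _; rewrite sqr_ge0. Qed.

Lemma rnorm_le_l2norm v i : rnorm (v i) <= l2norm v.
Proof.
rewrite -(@ler_pXn2r _ 2) ?nnegrE ?rnorm_ge0 ?l2norm_ge0 // l2norm_sq.
by rewrite (bigD1 i) //= lerDl sumr_ge0 // => j _; rewrite sqr_ge0.
Qed.

Lemma l2norm0 : l2norm (fun _ : I => 0 : V) = 0 :> R.
Proof.
by rewrite /l2norm big1 ?sqrtr0 // => i _; rewrite rnorm0 expr0n.
Qed.

Lemma l2norm_eq0 v : l2norm v = 0 -> forall i, v i = 0.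
Proof.
move=> v0 i; apply: rnorm0_eq0; apply/eqP; rewrite eq_le rnorm_ge0 andbT.
by rewrite -v0 rnorm_le_l2norm.
Qed.
End SquareNorm.

Lemma l2norm_scale {R : realType} {V W : normedZmodType R[i]} (I : finType) (r : R)
    (v : I -> V) (w : I -> W) : 0 <= r ->
  (forall i, rnorm (w i) = r * rnorm (v i)) -> l2norm w = r * l2norm v.
Proof.
move=> r0 h; apply/eqP.
rewrite -(@eqrXn2 _ 2) ?mulr_ge0 ?l2norm_ge0 // exprMn !l2norm_sq mulr_sumr.
by apply/eqP/eq_bigr => i _; rewrite h exprMn.
Qed.

Section RealSums.
Context {R : realType} {I : finType}.

Lemma sum_Cauchy_Schwarz (a b : I -> R) :
  (\sum_i a i * b i) ^+ 2 <= (\sum_i a i ^+ 2) * (\sum_i b i ^+ 2).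
Proof.
set A := \sum_i a i ^+ 2; set B := \sum_i b i ^+ 2; set C := \sum_i a i * b i.
have A0 : 0 <= A by apply: sumr_ge0 => i _; exact: sqr_ge0.
have P x y : 0 <= x ^+ 2 * A + 2 * (x * y) * C + y ^+ 2 * B.
  rewrite /A /B /C !mulr_sumr -!big_split /=; apply: sumr_ge0 => i _.
  by rewrite (_ : _ + _ = (x * a i + y * b i) ^+ 2) ?sqr_ge0 //; ring.
have [A00|An0] := eqVneq A 0; last first.
  have Ap : 0 < A by rewrite lt_neqAle eq_sym An0.
  (* At (C, -A) the quadratic form equals A (A B - C^2), with A > 0. *)
  by have := P C (- A); nra.
have a0 i : a i = 0.
  by apply/eqP; rewrite -sqrf_eq0; move/psumr_eq0P: A00 => -> // j _; exact: sqr_ge0.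
by rewrite A00 /C big1 ?mul0r ?expr0n // => i _; rewrite a0 mul0r.
Qed.

Lemma sum_l2norm {V W : normedZmodType R[i]} (v : I -> V) (w : I -> W) :
  \sum_i rnorm (v i) * rnorm (w i) <= l2norm v * l2norm w.
Proof.
rewrite -(@ler_pXn2r _ 2) ?nnegrE ?mulr_ge0 ?l2norm_ge0 //.
  by rewrite exprMn !l2norm_sq sum_Cauchy_Schwarz.
by apply: sumr_ge0 => i _; rewrite mulr_ge0 ?rnorm_ge0.
Qed.

Lemma rnorm_sum {V : normedZmodType R[i]} (v : I -> V) :
  rnorm (\sum_i v i) <= \sum_i rnorm (v i).
Proof.
elim/big_rec2: _ => [|i x y _ h]; first by rewrite rnorm0.
by apply: le_trans (rnormD _ _) _; rewrite lerD2l.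
Qed.
End RealSums.

Section FormNorm.
Context {R : realType} {V W : normedZmodType R[i]}.
Variables (scV : R[i] -> V -> V) (scW : R[i] -> W -> W) (ip : W -> W -> R[i]).
Hypothesis rnorm_scV : forall a v, rnorm (scV a v) = rnorm a * rnorm v.
Hypothesis rnorm_scW : forall a v, rnorm (scW a v) = rnorm a * rnorm v.
Hypothesis scWD : forall a v w, scW a (v + w) = scW a v + scW a w.
Hypothesis ip_le : forall v w, rnorm (ip v w) <= rnorm v * rnorm w.
Hypothesis ip_self : forall v, ip v v = (rnorm v ^+ 2)%:C.
Variables (I J : finType) (A : I -> J -> V -> W).
Hypothesis AZ : forall i j a v, A i j (scV a v) = scW a (A i j v).
Hypothesis A_bounded :
  exists kk : I -> J -> R, forall i j v, rnorm (A i j v) <= kk i j * rnorm v.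

Let form (v : J -> V) (w : I -> W) := \sum_i ip (\sum_j A i j (v j)) (w i).

Lemma form_le_l2norm v w :
  rnorm (form v w) <= l2norm (fun i => \sum_j A i j (v j)) * l2norm w.
Proof.
apply: le_trans (rnorm_sum _) _; apply: le_trans (sum_l2norm _ _).
by apply: ler_sum => i _; exact: ip_le.
Qed.

Lemma l2norm_le_form v (k : R) : 0 <= k ->
  (forall w, rnorm (form v w) <= k * l2norm w) ->
  l2norm (fun i => \sum_j A i j (v j)) <= k.
Proof.
move=> k0; set w := (fun i => \sum_j A i j (v j)) => /(_ w).
rewrite /form /w; under eq_bigr do rewrite ip_self.
rewrite -rmorph_sum rnorm_real -l2norm_sq -/w ger0_norm ?sqr_ge0 // expr2.
have [->|w0] := eqVneq (l2norm w) 0; first by [].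
by rewrite ler_pM2r // lt_neqAle eq_sym w0 l2norm_ge0.
Qed.

Lemma form_bounded : exists2 k : R, 0 <= k &
  forall v w, rnorm (form v w) <= k * l2norm v * l2norm w.
Proof.
have [kk kkP] := A_bounded; exists (\sum_i \sum_j `|kk i j|).
  by apply: sumr_ge0 => i _; apply: sumr_ge0.
move=> v w; apply: le_trans (rnorm_sum _) _; rewrite !mulr_suml.
apply: ler_sum => i _; apply: le_trans (ip_le _ _) _.
apply: ler_pM; rewrite ?rnorm_ge0 ?rnorm_le_l2norm //.
apply: le_trans (rnorm_sum _) _; rewrite mulr_suml; apply: ler_sum => j _.
apply: le_trans (kkP _ _ _) _; apply: le_trans (_ : _ <= `|kk i j| * rnorm (v j)) _.
  by rewrite ler_wpM2r ?rnorm_ge0 ?ler_norm.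
by rewrite ler_wpM2l ?rnorm_le_l2norm.
Qed.

(** [sup] of an unbounded set is a default value, hence [A_bounded]. Both sides are homogeneous, so
    bounds on the unit ball are bounds everywhere. Scalings and inner product stay abstract so that
    scalar matrices and matrices of operators share one proof. *)
Lemma opnormP (k : R) : 0 <= k ->
  opnorm A <= k <-> forall v w, rnorm (form v w) <= k * l2norm v * l2norm w.
Proof.
move=> k0; split=> [le_k v w|h]; last first.
  apply: ge_sup => [|_ [v /= v1 <-]]; first
    by exists (l2norm (fun i => \sum_j A i j 0)), (fun=> 0); rewrite //= l2norm0.
  apply: l2norm_le_form => // w; apply: le_trans (h v w) _.
  by rewrite ler_wpM2r ?l2norm_ge0 // ler_piMr.
have scWs a (u : J -> W) : scW a (\sum_j u j) = \sum_j scW a (u j).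
  elim/big_rec2: _ => [|j x y _ <-]; last by rewrite scWD.
  by apply: rnorm0_eq0; rewrite rnorm_scW rnorm0 mulr0.
apply: le_trans (form_le_l2norm v w) _; apply: ler_wpM2r; first exact: l2norm_ge0.
have [v0|vn0] := eqVneq (l2norm v) 0.
  rewrite v0 mulr0; have [kk kkP] := A_bounded.
  rewrite (_ : (fun i => _) = fun=> 0) ?l2norm0 //; apply/funext => i.
  rewrite big1 // => j _; apply: rnorm0_eq0; apply/eqP.
  by rewrite eq_le rnorm_ge0 andbT (le_trans (kkP _ _ _)) // (l2norm_eq0 v0) rnorm0 mulr0.
have vp : 0 < l2norm v by rewrite lt_neqAle eq_sym vn0 l2norm_ge0.
pose r := (l2norm v)^-1; have r0 : 0 <= r by rewrite invr_ge0 ltW.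
rewrite -ler_pdivrMr // mulrC -/r; apply: le_trans le_k.
rewrite -(@l2norm_scale _ _ _ _ _ _ (fun i => \sum_j A i j (scV r%:C (v j)))) //; last first.
  move=> i; rewrite -[r in RHS]ger0_norm // -rnorm_real -rnorm_scW scWs.
  by congr rnorm; apply: eq_bigr => j _; rewrite AZ.
apply: ub_le_sup; last first.
  exists (fun j => scV r%:C (v j)) => //=.
  rewrite (@l2norm_scale _ _ _ _ r v) // ?mulVf // => j.
  by rewrite rnorm_scV rnorm_real ger0_norm.
have [l l0 lP] := form_bounded; exists l => _ [u /= u1 <-].
apply: l2norm_le_form => // u'; apply: le_trans (lP _ _) _.
by rewrite ler_wpM2r ?l2norm_ge0 // ler_piMr.
Qed.

Lemma opnorm_ge0 : 0 <= opnorm A.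
Proof.
have z0 : (fun i => \sum_j A i j (0 : V)) = fun=> 0.
  have [kk kkP] := A_bounded; apply/funext => i.
  rewrite big1 // => j _; apply: rnorm0_eq0; apply/eqP.
  by rewrite eq_le rnorm_ge0 andbT (le_trans (kkP _ _ _)) // rnorm0 mulr0.
apply: ub_le_sup; last by exists (fun=> 0) => //=; rewrite ?z0 ?l2norm0.
have [l l0 lP] := form_bounded; exists l => _ [u /= u1 <-].
apply: l2norm_le_form => // u'; apply: le_trans (lP _ _) _.
by rewrite ler_wpM2r ?l2norm_ge0 // ler_piMr.
Qed.
End FormNorm.

Section ScalarForms.
Context {R : realType}.
Local Notation C := R[i].

Definition sform (I J : finType) (a : I -> J -> C) (b : J -> C) (c : I -> C) : C :=
  \sum_i (\sum_j a i j * b j) * Num.conj (c i).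

Lemma rnorm_conj (z : C) : rnorm (Num.conj z) = rnorm z.
Proof. by rewrite /rnorm norm_conjC. Qed.

Lemma sformE (I J : finType) (a : I -> J -> C) b c :
  sform a b c = \sum_i \sum_j a i j * b j * Num.conj (c i).
Proof. by apply: eq_bigr => i _; rewrite mulr_suml. Qed.

Lemma scalar_opnormP (I J : finType) (a : I -> J -> C) (k : R) : 0 <= k ->
  opnorm (fun i j (z : C) => a i j * z) <= k <->
  forall b c, rnorm (sform a b c) <= k * l2norm b * l2norm c.
Proof.
move=> k0; apply: (@opnormP R C C *%R *%R (fun u v => u * Num.conj v)) => //.
- exact: rnormM.
- exact: rnormM.
- by move=> z u v; rewrite mulrDr.
- by move=> u v; rewrite rnormM rnorm_conj.
- by move=> u; rewrite rmorphXn /= -rnormE normCK.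
- by move=> i j z u; rewrite mulrCA.
- by exists (fun i j => rnorm (a i j)) => i j z; rewrite rnormM.
Qed.

Lemma scalar_opnorm_ge0 (I J : finType) (a : I -> J -> C) :
  0 <= opnorm (fun i j (z : C) => a i j * z).
Proof.
apply: (@opnorm_ge0 R C C (fun u v => u * Num.conj v)) => //.
- by move=> u v; rewrite rnormM rnorm_conj.
- by move=> u; rewrite rmorphXn /= -rnormE normCK.
- by exists (fun i j => rnorm (a i j)) => i j z; rewrite rnormM.
Qed.

Lemma sform_reindex (I I' J J' : finType) (h : I' -> I) (h' : J' -> J)
    (a : I -> J -> C) b c : bijective h -> bijective h' ->
  sform a b c = sform (fun i j => a (h i) (h' j)) (b \o h') (c \o h).
Proof.
move=> hb hb'; rewrite /sform (reindex h) /=; last exact: onW_bij.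
by apply: eq_bigr => i _; rewrite (reindex h') //=; exact: onW_bij.
Qed.

Lemma l2norm_reindex {V : normedZmodType C} (I I' : finType) (h : I' -> I) (b : I -> V) :
  bijective h -> l2norm (b \o h) = l2norm b.
Proof.
by move=> hb; rewrite /l2norm [in RHS](reindex h) //=; exact: onW_bij.
Qed.
End ScalarForms.

Section HilbertForms.
Context {R : realType} {H : hilbertType R}.
Implicit Types u v w : H.

Lemma inner_suml (I : finType) (F : I -> H) v :
  inner (\sum_i F i) v = \sum_i inner (F i) v.
Proof. exact: (big_morph (inner ^~ v) (fun x y => innerDl x y v) (inner0l v)). Qed.

Lemma inner_sumr (I : finType) (F : I -> H) v :
  inner v (\sum_i F i) = \sum_i inner v (F i).
Proof. exact: (big_morph (inner v) (fun x y => innerDr v x y) (inner0r v)). Qed.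

Lemma inner_self u : inner u u = (rnorm u ^+ 2)%:C.
Proof. by rewrite -normr_inner rnormE rmorphXn. Qed.

Lemma bopD (a : bop H) u v : a (u + v) = a u + a v.
Proof. by rewrite -[u]scale1r bop_linear !scale1r. Qed.

Lemma bopZ (a : bop H) z u : a (z *: u) = z *: a u.
Proof. by rewrite -[z *: u]addr0 bop_linear bop0 addr0. Qed.

Lemma bopN (a : bop H) u : a (- u) = - a u.
Proof. by rewrite -scaleN1r bopZ scaleN1r. Qed.

Lemma bop_sum (I : finType) (a : bop H) (F : I -> H) : a (\sum_i F i) = \sum_i a (F i).
Proof. exact: (big_morph a (bopD a) (bop0 a)). Qed.

Definition hform (I J : finType) (X : I -> J -> bop H) (v : J -> H) (w : I -> H) : R[i] :=
  \sum_i inner (\sum_j X i j (v j)) (w i).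

Lemma hformE (I J : finType) (X : I -> J -> bop H) (v : J -> H) (w : I -> H) :
  hform X v w = \sum_i \sum_j inner (X i j (v j)) (w i).
Proof. by apply: eq_bigr => i _; rewrite inner_suml. Qed.

Lemma hilbert_opnormP (I J : finType) (X : I -> J -> bop H) (k : R) : 0 <= k ->
  opnorm (fun i j => X i j : H -> H) <= k <->
  forall (v : J -> H) (w : I -> H), rnorm (hform X v w) <= k * l2norm v * l2norm w.
Proof.
move=> k0; apply: (@opnormP R H H *:%R *:%R inner) => //.
- exact: rnormZ.
- exact: rnormZ.
- by move=> z u v; rewrite scalerDr.
- exact: Cauchy_Schwarz.
- exact: inner_self.
- by move=> i j z u; rewrite bopZ.
- have /choice[kk kkP] (p : I * J) : exists c : R, forall v, rnorm (X p.1 p.2 v) <= c * rnorm v.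
    by have [c _ cP] := bop_bounded (X p.1 p.2); exists c.
  by exists (fun i j => kk (i, j)) => i j v; exact: (kkP (i, j)).
Qed.

Lemma hilbert_opnorm_ge0 (I J : finType) (X : I -> J -> bop H) :
  0 <= opnorm (fun i j => X i j : H -> H).
Proof.
apply: (@opnorm_ge0 R H H inner) => //.
- exact: Cauchy_Schwarz.
- exact: inner_self.
- have /choice[kk kkP] (p : I * J) : exists c : R, forall v, rnorm (X p.1 p.2 v) <= c * rnorm v.
    by have [c _ cP] := bop_bounded (X p.1 p.2); exists c.
  by exists (fun i j => kk (i, j)) => i j v; exact: (kkP (i, j)).
Qed.
End HilbertForms.

Section VnValues.
Context {R : realType} {H : hilbertType R} {M : vnAlgebra H}.
Implicit Types x y : M.

Lemma vn_ext x y : (forall u, x u = y u) -> x = y.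
Proof. by move=> h; apply: val_inj; apply/bopP. Qed.

Lemma vn_addE x y u : (x + y : M) u = x u + y u. Proof. by []. Qed.
Lemma vn_scaleE z x u : (z *: x : M) u = z *: x u. Proof. by []. Qed.
Lemma vn_sumE (I : finType) (F : I -> M) u : (\sum_i F i : M) u = \sum_i F i u.
Proof. exact: (big_morph (fun a : M => a u) (fun a b => vn_addE a b u)). Qed.

Lemma mnorm_vnP n (X : 'M[M]_n) (k : R) : 0 <= k ->
  mnorm X <= k <->
  forall v w, rnorm (hform (fun i j => X i j : bop H) v w) <= k * l2norm v * l2norm w.
Proof. exact: (@hilbert_opnormP R H _ _ (fun i j => X i j)). Qed.

Lemma mnorm_vn_ge0 n (X : 'M[M]_n) : 0 <= mnorm X.
Proof. exact: (@hilbert_opnorm_ge0 R H _ _ (fun i j => X i j)). Qed.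

Lemma hform_le_mnorm n (X : 'M[M]_n) v w :
  rnorm (hform (fun i j => X i j : bop H) v w) <= mnorm X * l2norm v * l2norm w.
Proof. exact: (mnorm_vnP X (mnorm_vn_ge0 X)).1 _ v w. Qed.
End VnValues.

(** * Sequence limits and normal functionals as series of vector functionals *)

Section Limits.
Context {R : realType}.

(** Tolerances are real here, whereas balls in a module over [R[i]] have complex radii. *)
Definition tends {V : normedZmodType R[i]} (u : nat -> V) (l : V) : Prop :=
  forall e : R, 0 < e -> exists N, forall n, (N <= n)%N -> rnorm (u n - l) < e.

Lemma tendsP {V : normedModType R[i]} (u : nat -> V) (l : V) :
  u @ \oo --> l <-> tends u l.
Proof.
split=> [ul e e0|h].
  have e0' : 0 < e%:C by rewrite ltcR.
  have /cvgrPdist_lt/(_ _ e0')[N _ NP] := ul.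
  by exists N => n Nn; rewrite -ltcR -rnormE distrC; exact: NP.
apply/cvgrPdist_lt => e e0.
have [e' e'0 ->] : exists2 e' : R, 0 < e' & e = e'%:C.
  by move: e0; case: e => a b; rewrite ltcE /= => /andP[/eqP -> ?]; exists a.
have [N NP] := h _ e'0; exists N => // n /= Nn.
by rewrite distrC rnormE ltcR NP.
Qed.

Lemma ball_rnorm {V : normedModType R[i]} (x y : V) (e : R) :
  ball x e%:C y -> rnorm (x - y) < e.
Proof. by rewrite -ball_normE /ball_ /= rnormE ltcR. Qed.

Lemma tends_const {V : normedZmodType R[i]} (l : V) : tends (fun=> l) l.
Proof. by move=> e e0; exists 0%N => n _; rewrite subrr rnorm0. Qed.

Lemma tendsD {V : normedZmodType R[i]} (u v : nat -> V) (l l' : V) :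
  tends u l -> tends v l' -> tends (fun n => u n + v n) (l + l').
Proof.
move=> ul vl e e0; have e2 : 0 < e / 2 by rewrite divr_gt0.
have [N NP] := ul _ e2; have [N' NP'] := vl _ e2.
exists (maxn N N') => n; rewrite geq_max => /andP[/NP h1 /NP' h2].
rewrite opprD addrACA; apply: le_lt_trans (rnormD _ _) _; lra.
Qed.

Lemma tends_map {V W : normedZmodType R[i]} (T : V -> W) (k : R) (u : nat -> V) (l : V) :
  (forall x y, rnorm (T x - T y) <= k * rnorm (x - y)) ->
  tends u l -> tends (fun n => T (u n)) (T l).
Proof.
move=> Tk ul e e0.
have k0 : 0 < `|k| + 1 by rewrite ltr_wpDl.
have [|N NP] := ul (e / (`|k| + 1)); first by rewrite divr_gt0.
exists N => n /NP h; apply: le_lt_trans (Tk _ _) _.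
apply: le_lt_trans (_ : _ <= (`|k| + 1) * rnorm (u n - l)) _.
  by rewrite ler_wpM2r ?rnorm_ge0 // ler_wpDr ?ler_norm.
by rewrite mulrC -ltr_pdivlMr.
Qed.

Lemma tendsM (a : R[i]) (u : nat -> R[i]) l : tends u l -> tends (fun n => a * u n) (a * l).
Proof.
by apply: (tends_map (T := *%R a) (k := rnorm a)) => x y; rewrite -mulrBr rnormM.
Qed.

Lemma tends_sum {V : normedZmodType R[i]} (I : finType) (u : I -> nat -> V) (l : I -> V) :
  (forall i, tends (u i) (l i)) -> tends (fun n => \sum_i u i n) (\sum_i l i).
Proof.
move=> h; rewrite (_ : (fun n => _) = \sum_i u i).
  elim/big_rec2: _ => [|i x y _]; first exact: tends_const.
  exact: tendsD.
by apply/funext => n; rewrite (big_morph (fun f : nat -> V => f n) (id1 := 0) (op1 := +%R)).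
Qed.

Lemma tends_le {V : normedZmodType R[i]} (u : nat -> V) (l : V) (k : R) :
  tends u l -> (exists N, forall n, (N <= n)%N -> rnorm (u n) <= k) -> rnorm l <= k.
Proof.
move=> ul [N' uk]; apply/ler_addgt0Pr => e e0; have [N NP] := ul e e0.
have := NP (maxn N N') (leq_maxl _ _); have := uk _ (leq_maxr N N').
set x := u _ => xk xl; have -> : l = x - (x - l) by rewrite opprB addrC subrK.
by apply: le_trans (rnormD _ _) _; rewrite rnormN; lra.
Qed.

Lemma tends_unique {V : normedZmodType R[i]} (u : nat -> V) (l l' : V) :
  tends u l -> tends u l' -> l = l'.
Proof.
move=> ul ul'; apply/eqP; rewrite -subr_eq0; apply/eqP/rnorm0_eq0/eqP.
rewrite eq_le rnorm_ge0 andbT; apply/ler_addgt0Pr => e e0; rewrite add0r.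
have e2 : 0 < e / 2 by rewrite divr_gt0.
have [N NP] := ul _ e2; have [N' NP'] := ul' _ e2.
have := NP (maxn N N') (leq_maxl _ _); have := NP' (maxn N N') (leq_maxr _ _).
set x := u _ => h1 h2.
have -> : l - l' = - (x - l) + (x - l') by rewrite opprB addrA subrK.
by apply: le_trans (rnormD _ _) _; rewrite rnormN; lra.
Qed.

Lemma tends_subseq {V : normedZmodType R[i]} (u : nat -> V) (l : V) (s : nat -> nat) :
  (forall n, (n <= s n)%N) -> tends u l -> tends (u \o s) l.
Proof.
move=> sn ul e e0; have [N NP] := ul e e0; exists N => n Nn; apply: NP.
exact: leq_trans Nn (sn n).
Qed.
End Limits.

Section SquareSummable.
Context {R : realType} {H : hilbertType R}.

Lemma square_summableP (xi : nat -> H) :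
  square_summable xi <-> exists k : R, forall n, \sum_(i < n) rnorm (xi i) ^+ 2 <= k.
Proof.
have nd : nondecreasing_seq (series (fun n => rnorm (xi n) ^+ 2)).
  by apply: nondecreasing_series => n _ _; exact: sqr_ge0.
have serE n : series (fun n => rnorm (xi n) ^+ 2) n = \sum_(i < n) rnorm (xi i) ^+ 2.
  by rewrite seriesEnat /= big_mkord.
split=> [cv|[k kP]].
  exists (limn (series (fun n => rnorm (xi n) ^+ 2))) => n.
  by rewrite -serE; exact: nondecreasing_cvgn_le.
by apply: nondecreasing_is_cvgn => //; exists k => _ [n _ <-]; rewrite serE.
Qed.

Lemma square_summable_ge0 (xi : nat -> H) : square_summable xi ->
  exists2 k : R, 0 <= k & forall n, \sum_(i < n) rnorm (xi i) ^+ 2 <= k.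
Proof.
by move=> /square_summableP[k kP]; exists k => //; have := kP 0%N; rewrite big_ord0.
Qed.
End SquareSummable.

Section NormalFunctionals.
Context {R : realType} {H : hilbertType R} {M : vnAlgebra H}.

Lemma normalP (f : M -> R[i]) : (f \in @normal R H M) <->
  exists xi eta : nat -> H, [/\ square_summable xi, square_summable eta &
   forall x : M, tends (fun n => \sum_(k < n) inner (x (xi k)) (eta k)) (f x)].
Proof.
split=> [/asboolP[xi [eta [h1 h2 h3]]]|[xi [eta [h1 h2 h3]]]].
  exists xi, eta; split=> // x; have /tendsP := h3 x.
  by rewrite (_ : series _ = (fun n => \sum_(k < n) inner (x (xi k)) (eta k))) //;
     apply/funext => n; rewrite seriesEnat /= big_mkord.
apply/asboolP; exists xi, eta; split=> // x; apply/tendsP.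
by rewrite (_ : series _ = (fun n => \sum_(k < n) inner (x (xi k)) (eta k))) //;
   apply/funext => n; rewrite seriesEnat /= big_mkord.
Qed.

Lemma predualP (f : predual M) :
  exists xi eta : nat -> H, [/\ square_summable xi, square_summable eta &
   forall x : M, tends (fun n => \sum_(k < n) inner (x (xi k)) (eta k)) (f x)].
Proof. exact/normalP/predual_normal. Qed.

Lemma predual_linear (f : predual M) a x y : f (a *: x + y) = a * f x + f y.
Proof.
have [xi [eta [_ _ h]]] := predualP f; apply: tends_unique (h _) _.
rewrite (_ : (fun n => _) = fun n => a * (\sum_(k < n) inner (x (xi k)) (eta k)) +
   \sum_(k < n) inner (y (xi k)) (eta k)); first by apply: tendsD => //; exact: tendsM.
apply/funext => n; rewrite mulr_sumr -big_split /=; apply: eq_bigr => k _.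
by rewrite -innerZl -innerDl.
Qed.

Lemma predualD (f : predual M) x y : f (x + y) = f x + f y.
Proof. by rewrite -[x]scale1r predual_linear mul1r scale1r. Qed.

Lemma predual0 (f : predual M) : f 0 = 0.
Proof. by apply: (addrI (f 0)); rewrite -predualD !addr0. Qed.

Lemma predualZ (f : predual M) a x : f (a *: x) = a * f x.
Proof. by rewrite -[a *: x]addr0 predual_linear predual0 addr0. Qed.

Lemma predualN (f : predual M) x : f (- x) = - f x.
Proof. by rewrite -scaleN1r predualZ mulN1r. Qed.

Lemma predual_sum (I : finType) (f : predual M) (F : I -> M) :
  f (\sum_i F i) = \sum_i f (F i).
Proof. exact: (big_morph f (predualD f) (predual0 f)). Qed.

Lemma predual_addE (f g : predual M) x : (f + g) x = f x + g x. Proof. by []. Qed.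
Lemma predual_oppE (f : predual M) x : (- f) x = - f x. Proof. by []. Qed.
Lemma predual_scaleE a (f : predual M) x : (a *: f) x = a * f x. Proof. by []. Qed.
Lemma predual_sumE (I : finType) (F : I -> predual M) x : (\sum_i F i) x = \sum_i F i x.
Proof. exact: (big_morph (fun f : predual M => f x) (fun f g => predual_addE f g x)). Qed.
Lemma predual_ext (f g : predual M) : (forall x, f x = g x) -> f = g.
Proof. by move=> h; apply: val_inj; apply/funext. Qed.

(** The scalar form is the limit of sums over m of forms of [X] at the vectors [b j *: xi m] and
    [d i *: eta m], whose square norms are |b| |xi_m| and |d| |eta_m|. So f is completely bounded by
    the sum of the |xi_m| |eta_m|. *)
Lemma series_functional_bound (f : M -> R[i]) (xi eta : nat -> H) (c : R) :
  (forall x : M, tends (fun n => \sum_(k < n) inner (x (xi k)) (eta k)) (f x)) ->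
  (forall n, \sum_(k < n) rnorm (xi k) * rnorm (eta k) <= c) ->
  forall n (X : 'M[M]_n) b d,
    rnorm (sform (fun i j => f (X i j)) b d) <= c * mnorm X * l2norm b * l2norm d.
Proof.
move=> h cP n X b d.
have lim : tends (fun N => \sum_i \sum_j
    (b j * Num.conj (d i)) * (\sum_(m < N) inner (X i j (xi m)) (eta m)))
    (sform (fun i j => f (X i j)) b d).
  rewrite sformE; apply: tends_sum => i; apply: tends_sum => j.
  by rewrite -mulrA [f _ * _]mulrC; apply: tendsM.
apply: tends_le lim _; exists 0%N => N _.
have -> : \sum_i \sum_j (b j * Num.conj (d i)) * (\sum_(m < N) inner (X i j (xi m)) (eta m))
   = \sum_(m < N) hform (fun i j => X i j : bop H) (fun j => b j *: xi m) (fun i => d i *: eta m).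
  under [RHS]eq_bigr do rewrite hformE.
  rewrite [RHS]exchange_big /=; apply: eq_bigr => i _.
  rewrite [RHS]exchange_big /=; apply: eq_bigr => j _.
  rewrite mulr_sumr; apply: eq_bigr => m _.
  by rewrite bopZ innerZl innerZr mulrA.
apply: le_trans (rnorm_sum _) _.
have X0 : 0 <= mnorm X * l2norm b * l2norm d.
  by rewrite !mulr_ge0 ?l2norm_ge0 ?mnorm_vn_ge0.
apply: le_trans (_ : _ <= \sum_(m < N) mnorm X * l2norm b * l2norm d *
   (rnorm (xi m) * rnorm (eta m))) _; last first.
  rewrite (_ : c * _ * _ * _ = mnorm X * l2norm b * l2norm d * c); last by ring.
  by rewrite -mulr_sumr; apply: ler_wpM2l => //; exact: cP.
apply: ler_sum => m _; apply: le_trans (hform_le_mnorm _ _ _) _.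
rewrite (l2norm_scale (r := rnorm (xi m)) (v := b) (w := fun j => b j *: xi m)) ?rnorm_ge0 //;
  last by move=> i; rewrite rnormZ mulrC.
rewrite (l2norm_scale (r := rnorm (eta m)) (v := d) (w := fun j => d j *: eta m)) ?rnorm_ge0 //;
  last by move=> i; rewrite rnormZ mulrC.
by rewrite le_eqVlt; apply/orP; left; apply/eqP; ring.
Qed.

Lemma square_summableM (xi eta : nat -> H) : square_summable xi -> square_summable eta ->
  exists2 c : R, 0 <= c & forall n, \sum_(k < n) rnorm (xi k) * rnorm (eta k) <= c.
Proof.
move=> /square_summable_ge0[k k0 kP] /square_summable_ge0[l l0 lP].
exists (k + l) => [|n]; first exact: addr_ge0.
apply: le_trans (lerD (kP n) (lP n)); rewrite -big_split /=; apply: ler_sum => m _.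
have := rnorm_ge0 (xi m); have := rnorm_ge0 (eta m); nra.
Qed.

Lemma predual_bounded (f : predual M) : exists2 c : R, 0 <= c &
  forall n (X : 'M[M]_n) b d,
    rnorm (sform (fun i j => f (X i j)) b d) <= c * mnorm X * l2norm b * l2norm d.
Proof.
have [xi [eta [xi2 eta2 h]]] := predualP f.
have [c c0 cP] := square_summableM xi2 eta2.
by exists c => //; exact: series_functional_bound h cP.
Qed.
End NormalFunctionals.

(** * Completely bounded norms and matrices of functionals *)

Section CbNorm.
Context {R : realType}.
Implicit Types E F : matrixNormedType R.

(* The library scales matrices only by elements of their own coefficient ring. *)
Definition scale_mx E n (a : R[i]) (X : 'M[E]_n) : 'M[E]_n := map_mx ( *:%R a) X.

(** What a cb-norm needs in order to be an operator bound. One inequality is enough: applied to the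
    inverse of t it gives the other. Nonzero matrices of norm 0 are allowed. *)
Definition homogeneous_mnorm E : Prop := forall n (X : 'M[E]_n),
  0 <= mnorm X /\ forall t : R, 0 < t -> mnorm (scale_mx t%:C X) <= t * mnorm X.

Lemma homogeneous_mnormE E n (X : 'M[E]_n) (t : R) : homogeneous_mnorm E -> 0 < t ->
  mnorm (scale_mx t%:C X) = t * mnorm X.
Proof.
move=> hE t0; apply/eqP; rewrite eq_le (hE n X).2 //=.
have := (hE n (scale_mx t%:C X)).2 t^-1.
rewrite (_ : scale_mx _ (scale_mx _ _) = X); last first.
  by apply/matrixP => i j; rewrite !mxE scalerA -rmorphM mulVf ?gt_eqF // scale1r.
by rewrite invr_gt0 => /(_ t0); rewrite mulrC ler_pdivlMr // mulrC.
Qed.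

Lemma homogeneous_mnorm0 E n : homogeneous_mnorm E -> mnorm (0 : 'M[E]_n) = 0.
Proof.
move=> hE; have := @homogeneous_mnormE E n 0 2 hE.
rewrite (_ : scale_mx _ _ = 0); last by apply/matrixP => i j; rewrite !mxE scaler0.
by move=> /(_ (ltr0Sn _ _)); lra.
Qed.

Lemma map_mx_scale E F (T : E -> F) n (X : 'M[E]_n) a :
  linear T -> map_mx T (scale_mx a X) = scale_mx a (map_mx T X).
Proof.
move=> lT; apply/matrixP => i j; rewrite !mxE.
have T0 : T 0 = 0.
  by have := lT (-1) 0 0; rewrite scaler0 addr0 scaleN1r addNr.
by rewrite -[a *: X i j]addr0 lT T0 addr0.
Qed.

Lemma cb_norm_leP E F (T : E -> F) (k : R) :
  homogeneous_mnorm E -> homogeneous_mnorm F -> linear T -> 0 <= k ->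
  (cb_norm T <= k%:E)%E <-> forall n (X : 'M[E]_n), mnorm (map_mx T X) <= k * mnorm X.
Proof.
move=> hE hF lT k0; split=> [le_k n X|h]; last first.
  apply: ge_ereal_sup => _ [n [X [X1 ->]]]; rewrite lee_fin.
  by apply: le_trans (h n X) _; rewrite ler_piMr.
have le1 (Y : 'M[E]_n) : mnorm Y <= 1 -> mnorm (map_mx T Y) <= k.
  by move=> Y1; rewrite -lee_fin; apply: le_trans le_k; apply: ereal_sup_ubound; exists n, Y.
have [X0|Xn0] := eqVneq (mnorm X) 0.
  (* All multiples of X lie in the unit ball; the factor (k + 1) / e forces the image of X to have
     norm at most e. *)
  rewrite X0 mulr0; apply/ler_addgt0Pr => e e0; rewrite add0r.
  have t0 : 0 < (k + 1) / e by rewrite divr_gt0 // ltr_wpDl.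
  have := le1 (scale_mx ((k + 1) / e)%:C X).
  rewrite homogeneous_mnormE // X0 mulr0 ler01 => /(_ isT).
  rewrite map_mx_scale // homogeneous_mnormE // mulrAC ler_pdivrMr // => h.
  have k1 : 0 < k + 1 by rewrite ltr_wpDl.
  rewrite -(ler_pM2l k1); apply: le_trans h _.
  by rewrite mulrDl mul1r lerDl ltW.
have Xp : 0 < mnorm X by rewrite lt_neqAle eq_sym Xn0 (hE n X).1.
have := le1 (scale_mx (mnorm X)^-1%:C X).
rewrite map_mx_scale // !homogeneous_mnormE ?invr_gt0 // mulVf // lexx => /(_ isT).
by rewrite mulrC ler_pdivrMr.
Qed.

Lemma cb_norm_ge0 E F (T : E -> F) : homogeneous_mnorm E -> homogeneous_mnorm F ->
  (0 <= cb_norm T)%E.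
Proof.
move=> hE hF; apply: le_trans (_ : (mnorm (map_mx T (0 : 'M[E]_0)))%:E <= _)%E.
  by rewrite lee_fin (hF _ _).1.
by apply: ereal_sup_ubound; exists 0%N, 0; rewrite homogeneous_mnorm0.
Qed.

Lemma cb_norm_fin E F (T : E -> F) (c : R) :
  homogeneous_mnorm E -> homogeneous_mnorm F -> linear T -> 0 <= c ->
  (forall n (X : 'M[E]_n), mnorm (map_mx T X) <= c * mnorm X) ->
  cb_norm T \is a fin_num.
Proof.
move=> hE hF lT c0 cP; rewrite ge0_fin_numE ?cb_norm_ge0 //.
by apply: le_lt_trans (ltry c); apply/cb_norm_leP.
Qed.

Lemma scalar_form_shuffle (n m : nat) (A : 'M['M[R[i]]_m]_n) (k : R) : 0 <= k ->
  mnorm A <= k <->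
  forall b d, rnorm (sform (fun p q : 'I_n * 'I_m => A p.1 q.1 p.2 q.2) b d)
    <= k * l2norm b * l2norm d.
Proof. exact: scalar_opnormP. Qed.

Lemma homogeneous_scalar m : homogeneous_mnorm 'M[R[i]]_m.
Proof.
move=> n A; split=> [|t t0]; first exact: scalar_opnorm_ge0.
have A0 : 0 <= mnorm A by exact: scalar_opnorm_ge0.
apply/scalar_form_shuffle => [|b d]; first by rewrite mulr_ge0 // ltW.
have -> : sform (fun p q : 'I_n * 'I_m => (scale_mx t%:C A) p.1 q.1 p.2 q.2) b d =
    t%:C * sform (fun p q => A p.1 q.1 p.2 q.2) b d.
  rewrite !sformE mulr_sumr; apply: eq_bigr => p _.
  by rewrite mulr_sumr; apply: eq_bigr => q _; rewrite !mxE !mulrA.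
rewrite rnormM rnorm_real gtr0_norm // -!mulrA ler_wpM2l ?(ltW t0) // mulrA.
exact: (scalar_form_shuffle A A0).1 (lexx _) b d.
Qed.

Section Functionals.
Variable E : matrixNormedType R.
Hypothesis hE : homogeneous_mnorm E.
Variables (m : nat) (phi : 'I_m -> 'I_m -> E -> R[i]).
Hypothesis lin_phi : forall p q a x y, phi p q (a *: x + y) = a * phi p q x + phi p q y.
Let T (x : E) : 'M[R[i]]_m := \matrix_(p, q) phi p q x.

Lemma functional_matrix_linear : linear T.
Proof. by move=> a x y; apply/matrixP => p q; rewrite !mxE lin_phi. Qed.

Lemma functional_matrix_normP n (X : 'M[E]_n) (k : R) : 0 <= k ->
  mnorm (map_mx T X) <= k <-> forall b d,
   rnorm (sform (fun p q : 'I_n * 'I_m => phi p.2 q.2 (X p.1 q.1)) b d)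
     <= k * l2norm b * l2norm d.
Proof.
move=> k0; rewrite scalar_form_shuffle //.
have E1 b d : sform (fun p q : 'I_n * 'I_m => (map_mx T X) p.1 q.1 p.2 q.2) b d =
   sform (fun p q : 'I_n * 'I_m => phi p.2 q.2 (X p.1 q.1)) b d.
  by rewrite !sformE; apply: eq_bigr => p _; apply: eq_bigr => q _; rewrite !mxE.
by split=> h b d; [rewrite -E1|rewrite E1]; exact: h.
Qed.

Hypothesis bounded_phi : exists2 c : R, 0 <= c & forall n (X : 'M[E]_n) b d,
  rnorm (sform (fun p q : 'I_n * 'I_m => phi p.2 q.2 (X p.1 q.1)) b d)
    <= c * mnorm X * l2norm b * l2norm d.

(** [fine] sends an infinite cb-norm to 0, so [bounded_phi] must first make the norm finite. *)
Lemma functional_cb_normP (k : R) : 0 <= k ->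
  fine (cb_norm T) <= k <-> forall n (X : 'M[E]_n) b d,
   rnorm (sform (fun p q : 'I_n * 'I_m => phi p.2 q.2 (X p.1 q.1)) b d)
     <= k * mnorm X * l2norm b * l2norm d.
Proof.
move=> k0; have [c c0 cP] := bounded_phi.
have hC := @homogeneous_scalar m; have lT := functional_matrix_linear.
have fin : cb_norm T \is a fin_num.
  apply: (cb_norm_fin hE hC lT c0) => n X.
  apply/functional_matrix_normP; first by rewrite mulr_ge0 // (hE X).1.
  exact: cP.
rewrite -lee_fin fineK // cb_norm_leP //.
split=> [h n X|h n X]; last first.
  apply/functional_matrix_normP; first by rewrite mulr_ge0 // (hE X).1.
  exact: h.
apply: (functional_matrix_normP X _).1 (h n X); by rewrite mulr_ge0 // (hE X).1.
Qed.

Lemma functional_cb_norm_ge0 : 0 <= fine (cb_norm T).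
Proof.
by apply: fine_ge0; apply: cb_norm_ge0 => //; exact: homogeneous_scalar.
Qed.
End Functionals.
End CbNorm.

Section PredualNorm.
Context {R : realType} {H : hilbertType R} {M : vnAlgebra H}.

Lemma homogeneous_vn : homogeneous_mnorm M.
Proof.
move=> n X; split=> [|t t0]; first exact: mnorm_vn_ge0.
apply/mnorm_vnP => [|v w]; first by rewrite mulr_ge0 ?mnorm_vn_ge0 // ltW.
have -> : hform (fun i j => (scale_mx t%:C X) i j : bop H) v w =
    t%:C * hform (fun i j => X i j : bop H) v w.
  rewrite !hformE mulr_sumr; apply: eq_bigr => p _.
  by rewrite mulr_sumr; apply: eq_bigr => q _; rewrite mxE vn_scaleE innerZl.
rewrite rnormM rnorm_real gtr0_norm // -!mulrA ler_wpM2l ?(ltW t0) // mulrA.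
exact: hform_le_mnorm.
Qed.

(* Rows and columns are indexed by 'I_n * 'I_m, as in the matrix norm of M_n(M_m). *)
Definition pairing m n (f : 'M[predual M]_m) (X : 'M[M]_n) (p q : 'I_n * 'I_m) : R[i] :=
  f p.2 q.2 (X p.1 q.1).

(** A crude bound, the sum of the bounds of the entries: only its finiteness matters, as input for
    [functional_cb_normP]. *)
Lemma pairing_bounded m (f : 'M[predual M]_m) : exists2 c : R, 0 <= c &
  forall n (X : 'M[M]_n) b d,
    rnorm (sform (pairing f X) b d) <= c * mnorm X * l2norm b * l2norm d.
Proof.
have /choice[c cP] (p : 'I_m * 'I_m) : exists c : R, 0 <= c /\
    forall n (X : 'M[M]_n) b d,
    rnorm (sform (fun i j => f p.1 p.2 (X i j)) b d) <= c * mnorm X * l2norm b * l2norm d.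
  by have [c c0 cP] := predual_bounded (f p.1 p.2); exists c.
exists (\sum_p c p) => [|n X b d]; first by apply: sumr_ge0 => p _; case: (cP p).
have le_sub (I J : finType) (b' : I * J -> R[i]) q : l2norm (fun i => b' (i, q)) <= l2norm b'.
  rewrite -(@ler_pXn2r _ 2) ?nnegrE ?l2norm_ge0 // !l2norm_sq.
  have -> : \sum_p rnorm (b' p) ^+ 2 = \sum_i \sum_j rnorm (b' (i, j)) ^+ 2.
    by rewrite pair_bigA /=; apply: eq_bigr => -[].
  apply: ler_sum => i _; rewrite (bigD1 q) //= lerDl.
  by apply: sumr_ge0 => j _; exact: sqr_ge0.
have -> : sform (pairing f X) b d =
   \sum_(p : 'I_m * 'I_m) sform (fun i j => f p.1 p.2 (X i j))
      (fun j => b (j, p.2)) (fun i => d (i, p.1)).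
  rewrite sformE.
  transitivity (\sum_i \sum_p \sum_j \sum_q f p q (X i j) * b (j, q) * Num.conj (d (i, p))).
    rewrite [RHS]pair_bigA /=; apply: eq_bigr => -[i p] _.
    by rewrite [RHS]pair_bigA /=; apply: eq_bigr => -[j q] _.
  rewrite -(pair_bigA _ (fun p q => sform (fun i j => f p q (X i j))
     (fun j => b (j, q)) (fun i => d (i, p)))) /= exchange_big /=.
  apply: eq_bigr => p _; under [RHS]eq_bigr do rewrite sformE.
  rewrite [RHS]exchange_big /=; apply: eq_bigr => i _.
  by rewrite exchange_big.
apply: le_trans (rnorm_sum _) _; rewrite !mulr_suml; apply: ler_sum => p _.
apply: le_trans ((cP p).2 _ _ _ _) _.
have c0 : 0 <= c p * mnorm X by rewrite mulr_ge0 ?mnorm_vn_ge0 //; case: (cP p).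
rewrite -!(mulrA (c p * _)) ler_wpM2l // ler_pM ?l2norm_ge0 //; exact: le_sub.
Qed.

Lemma mnorm_predualP m (f : 'M[predual M]_m) (k : R) : 0 <= k ->
  mnorm f <= k <-> forall n (X : 'M[M]_n) b d,
    rnorm (sform (pairing f X) b d) <= k * mnorm X * l2norm b * l2norm d.
Proof.
apply: (functional_cb_normP homogeneous_vn); last exact: pairing_bounded.
by move=> p q a x y; exact: predual_linear.
Qed.

Lemma mnorm_predual_ge0 m (f : 'M[predual M]_m) : 0 <= mnorm f.
Proof. exact: functional_cb_norm_ge0 homogeneous_vn _ _. Qed.

Lemma pairing_le m n (f : 'M[predual M]_m) (X : 'M[M]_n) b d :
  rnorm (sform (pairing f X) b d) <= mnorm f * mnorm X * l2norm b * l2norm d.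
Proof. exact: (mnorm_predualP f (mnorm_predual_ge0 f)).1 (lexx _) n X b d. Qed.

Lemma homogeneous_predual : homogeneous_mnorm (predual M).
Proof.
move=> m f; split=> [|t t0]; first exact: mnorm_predual_ge0.
apply/mnorm_predualP => [|n X b d]; first by rewrite mulr_ge0 ?mnorm_predual_ge0 // ltW.
have -> : sform (pairing (scale_mx t%:C f) X) b d = t%:C * sform (pairing f X) b d.
  rewrite !sformE mulr_sumr; apply: eq_bigr => p _.
  by rewrite mulr_sumr; apply: eq_bigr => q _; rewrite /pairing mxE predual_scaleE !mulrA.
rewrite rnormM rnorm_real gtr0_norm // -!mulrA ler_wpM2l ?(ltW t0) // !mulrA.
exact: pairing_le.
Qed.

Lemma pairing_swap m n (f : 'M[predual M]_m) (X : 'M[M]_n) b d :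
  sform (fun p q : 'I_m * 'I_n => f p.1 q.1 (X p.2 q.2)) b d =
  sform (pairing f X) (fun p => b (p.2, p.1)) (fun p => d (p.2, p.1)).
Proof.
have bs : bijective (fun p : 'I_n * 'I_m => (p.2, p.1)).
  by exists (fun p => (p.2, p.1)) => -[].
by rewrite (sform_reindex _ _ _ bs bs).
Qed.

Lemma l2norm_swap (m n : nat) (b : 'I_m * 'I_n -> R[i]) :
  l2norm (fun p : 'I_n * 'I_m => b (p.2, p.1)) = l2norm b.
Proof.
apply: (l2norm_reindex (h := fun p : 'I_n * 'I_m => (p.2, p.1))).
by exists (fun p => (p.2, p.1)) => -[].
Qed.

Lemma pairing_swap_le m n (f : 'M[predual M]_m) (X : 'M[M]_n) b d :
  rnorm (sform (fun p q : 'I_m * 'I_n => f p.1 q.1 (X p.2 q.2)) b d) <=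
  mnorm X * mnorm f * l2norm b * l2norm d.
Proof.
rewrite pairing_swap -(l2norm_swap b) -(l2norm_swap d) [mnorm X * _]mulrC.
exact: pairing_le.
Qed.

Lemma dual_linear (phi : dual (predual M)) a f g : phi (a *: f + g) = a * phi f + phi g.
Proof. by have /asboolP[] := dual_prop phi. Qed.

Lemma dual_addE (f g : dual (predual M)) x : (f + g) x = f x + g x. Proof. by []. Qed.
Lemma dual_oppE (f : dual (predual M)) x : (- f) x = - f x. Proof. by []. Qed.
Lemma dual_scaleE a (f : dual (predual M)) x : (a *: f) x = a * f x. Proof. by []. Qed.
Lemma dual_ext (f g : dual (predual M)) : (forall x, f x = g x) -> f = g.
Proof. by move=> h; apply: val_inj; apply/funext. Qed.
Lemma dual_sumE (I : finType) (F : I -> dual (predual M)) x : (\sum_i F i) x = \sum_i F i x.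
Proof.
exact: (big_morph (fun f : dual (predual M) => f x) (fun f g => dual_addE f g x)).
Qed.

Section DualNorm.
Variables (m : nat) (Z : 'M[dual (predual M)]_m) (z : 'M[M]_m).
Hypothesis Zz : forall p q f, Z p q f = f (z p q).

(** The matrix [z] over M represents [Z]; its norm supplies the finiteness of the cb-norm. Such a
    [z] always exists by [dual_predual_repr]. *)
Lemma mnorm_dualP (k : R) : 0 <= k ->
  mnorm Z <= k <-> forall n (f : 'M[predual M]_n) b d,
    rnorm (sform (fun p q : 'I_n * 'I_m => f p.1 q.1 (z p.2 q.2)) b d) <=
      k * mnorm f * l2norm b * l2norm d.
Proof.
have E1 n (f : 'M[predual M]_n) b d :
    sform (fun p q : 'I_n * 'I_m => f p.1 q.1 (z p.2 q.2)) b d =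
    sform (fun p q : 'I_n * 'I_m => Z p.2 q.2 (f p.1 q.1)) b d.
  by rewrite !sformE; apply: eq_bigr => p _; apply: eq_bigr => q _; rewrite Zz.
move=> k0.
have -> : mnorm Z = fine (cb_norm (fun x : predual M => \matrix_(i, j) Z i j x)) by [].
rewrite (functional_cb_normP homogeneous_predual) //.
- by split=> h n f b d; [rewrite E1|rewrite -E1]; exact: h.
- by move=> p q a x y; exact: dual_linear.
- exists (mnorm z) => [|n f b d]; first exact: mnorm_vn_ge0.
  by rewrite -E1; exact: pairing_swap_le.
Qed.

Lemma mnorm_dual_ge0 : 0 <= mnorm Z.
Proof. exact: functional_cb_norm_ge0 homogeneous_predual _ _. Qed.

Lemma mnorm_dual_le : mnorm Z <= mnorm z.
Proof.
by apply/mnorm_dualP => [|n f b d]; [exact: mnorm_vn_ge0|exact: pairing_swap_le].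
Qed.

Lemma dual_pairing_le n (f : 'M[predual M]_n) b d :
  rnorm (sform (fun p q : 'I_n * 'I_m => f p.1 q.1 (z p.2 q.2)) b d) <=
      mnorm Z * mnorm f * l2norm b * l2norm d.
Proof. exact: (mnorm_dualP mnorm_dual_ge0).1 (lexx _) n f b d. Qed.
End DualNorm.
End PredualNorm.

(** * Vector functionals and the duality (M_* )^* = M *)

Section Orthonormal.
Context {R : realType} {H : hilbertType R}.

Definition orthonormal m (e : 'I_m -> H) : Prop :=
  forall p q, inner (e p) (e q) = (p == q)%:R.

Lemma orthonormal_inner m (e : 'I_m -> H) (b c : 'I_m -> R[i]) : orthonormal e ->
  inner (\sum_p b p *: e p) (\sum_q c q *: e q) = \sum_p b p * Num.conj (c p).
Proof.
move=> oe; rewrite inner_suml; apply: eq_bigr => p _.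
rewrite innerZl inner_sumr (bigD1 p) //= big1 => [|q qp].
  by rewrite innerZr oe eqxx mulr1 addr0.
by rewrite innerZr oe eq_sym (negbTE qp) mulr0.
Qed.

Lemma orthonormal_rnorm m (e : 'I_m -> H) (b : 'I_m -> R[i]) : orthonormal e ->
  rnorm (\sum_p b p *: e p) ^+ 2 = \sum_p rnorm (b p) ^+ 2.
Proof.
move=> oe; apply: complexI; rewrite -inner_self orthonormal_inner // rmorph_sum /=.
by apply: eq_bigr => p _; rewrite rmorphXn /= -rnormE normCK.
Qed.

Lemma Gram_Schmidt_seq (s : seq H) : exists m (e : 'I_m -> H), orthonormal e /\
  forall u, u \in s -> exists c : 'I_m -> R[i], u = \sum_p c p *: e p.
Proof.
elim: s => [|u s [m [e [oe eP]]]].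
  by exists 0%N, (fun=> 0); split=> // -[].
pose r := u - \sum_p inner u (e p) *: e p.
have re q : inner r (e q) = 0.
  rewrite /r innerDl innerNl inner_suml (bigD1 q) //= big1 => [|p pq].
    by rewrite innerZl oe eqxx mulr1 addr0 subrr.
  by rewrite innerZl oe (negbTE pq) mulr0.
have [r0|rn0] := eqVneq r 0.
  exists m, e; split=> // v; rewrite inE => /orP[/eqP ->|/eP //].
  by exists (fun p => inner u (e p)); apply/eqP; rewrite -subr_eq0; apply/eqP.
pose n := rnorm r.
have n0 : n%:C != 0 :> R[i].
  by apply: contra rn0 => /eqP h; apply/eqP/rnorm0_eq0; exact: complexI.
pose e' (p : 'I_m.+1) := if unlift ord0 p is Some q then e q else n%:C^-1 *: r.
have e'0 : e' ord0 = n%:C^-1 *: r by rewrite /e' unlift_none.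
have e'S q : e' (lift ord0 q) = e q by rewrite /e' liftK.
have cnr : Num.conj (n%:C^-1 : R[i]) = n%:C^-1.
  by rewrite fmorphV; congr (_^-1); apply/conj_Creal; rewrite complex_real.
exists m.+1, e'; split.
  move=> p q; case: (unliftP ord0 p) => [p'|] ->; case: (unliftP ord0 q) => [q'|] ->.
  - by rewrite !e'S oe (inj_eq (@lift_inj _ ord0)).
  - by rewrite e'S e'0 innerZr innerC re rmorph0 mulr0.
  - by rewrite e'S e'0 innerZl re mulr0.
  - rewrite e'0 innerZl innerZr inner_self eqxx cnr -/n expr2 rmorphM /=.
    by rewrite (mulrA n%:C^-1) mulrACA mulVf // mulr1.
move=> v; rewrite inE => /orP[/eqP ->|/eP[c ->]].
  exists (fun p => if unlift ord0 p is Some q then inner u (e q) else n%:C).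
  rewrite big_ord_recl unlift_none e'0 scalerA mulfV // scale1r.
  rewrite (eq_bigr (fun p => inner u (e p) *: e p)); first by rewrite /r subrK.
  by move=> p _; rewrite liftK e'S.
exists (fun p => if unlift ord0 p is Some q then c q else 0).
rewrite big_ord_recl unlift_none scale0r add0r.
by apply: eq_bigr => p _; rewrite liftK e'S.
Qed.

Lemma Gram_Schmidt (I : finType) (u : I -> H) : exists m (e : 'I_m -> H) (c : I -> 'I_m -> R[i]),
  orthonormal e /\ forall i, u i = \sum_p c i p *: e p.
Proof.
have [m [e [oe eP]]] := Gram_Schmidt_seq [seq u i | i <- enum I].
have /choice[c cP] i : exists c : 'I_m -> R[i], u i = \sum_p c p *: e p.
  by apply: eP; apply/mapP; exists i; rewrite ?mem_enum.
by exists m, e, c.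
Qed.

(** Operators are mostly constructed through this: a bounded sesquilinear form is the form of an
    operator. Riesz represents s in its first variable, which yields the adjoint of the operator
    sought. *)
Lemma form_bop (s : H -> H -> R[i]) (k : R) : 0 <= k ->
  (forall a u u' v, s (a *: u + u') v = a * s u v + s u' v) ->
  (forall a u v v', s u (a *: v + v') = Num.conj a * s u v + s u v') ->
  (forall u v, rnorm (s u v) <= k * rnorm u * rnorm v) ->
  exists b : bop H, (forall u v, inner (b u) v = s u v) /\
    forall u, rnorm (b u) <= k * rnorm u.
Proof.
move=> k0 sl sr sk.
have /choice[z zP] v : exists z, (forall u, s u v = inner u z) /\ rnorm z <= k * rnorm v.
  have [||| z zP zk] := @Riesz _ _ (s ^~ v) (k * rnorm v).
  - by rewrite mulr_ge0 ?rnorm_ge0.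
  - by move=> a u u'; exact: sl.
  - by move=> u; rewrite mulrAC.
  - by exists z.
have bz : z \in bounded_operator.
  apply/bounded_operatorP; split; last by exists k => // u; case: (zP u).
  by move=> c u v; apply: inner_ext => w; rewrite innerDr innerZr -!(zP _).1 sr.
exists (adj (Bop bz)).
have bP u v : inner (adj (Bop bz) u) v = s u v by rewrite adjP adjK (zP v).1.
split=> // u; set b := adj _ u.
have [b0|bn0] := eqVneq (rnorm b) 0; first by rewrite b0 mulr_ge0 ?rnorm_ge0.
have bp : 0 < rnorm b by rewrite lt_neqAle eq_sym bn0 rnorm_ge0.
rewrite -(ler_pM2r bp) -expr2 rnorm_sq bP.
by apply: le_trans (ler_norm _) _; apply: le_trans (Re_le_rnorm _) _.
Qed.
End Orthonormal.

Section VectorFunctionals.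
Context {R : realType} {H : hilbertType R} {M : vnAlgebra H}.

Lemma vector_functional_normal (u v : H) :
  (fun x : M => inner (x u) v) \in @normal R H M.
Proof.
apply/normalP; pose at0 w n : H := if n is 0%N then w else 0.
have sq w : square_summable (at0 w).
  apply/square_summableP; exists (rnorm w ^+ 2) => -[|n].
    by rewrite big_ord0 sqr_ge0.
  by rewrite big_ord_recl /= big1 ?addr0 // => i _; rewrite rnorm0 expr0n.
exists (at0 u), (at0 v); split=> // x e e0; exists 1%N => -[//|n _].
rewrite big_ord_recl /= big1 ?addr0 ?subrr ?rnorm0 // => i _.
by rewrite bop0 inner0l.
Qed.
Definition omega u v : predual M := Predual (vector_functional_normal u v).

Lemma omegaE u v x : omega u v x = inner (x u) v. Proof. by []. Qed.

Lemma omega_linearl a u u' v : omega (a *: u + u') v = a *: omega u v + omega u' v.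
Proof.
apply: predual_ext => x.
by rewrite predual_addE predual_scaleE !omegaE bop_linear innerDl innerZl.
Qed.

Lemma omega_linearr a u v v' : omega u (a *: v + v') = Num.conj a *: omega u v + omega u v'.
Proof.
apply: predual_ext => x.
by rewrite predual_addE predual_scaleE !omegaE innerDr innerZr.
Qed.

(** As a map from M to the m by m matrices, this is the compression to the span of [e]; hence the
    transposed order of the two vectors. *)
Definition omega_mx m (e : 'I_m -> H) : 'M[predual M]_m := \matrix_(p, q) omega (e q) (e p).

Lemma omega_mx_pairing m n (e : 'I_m -> H) (X : 'M[M]_n) b d :
  sform (pairing (omega_mx e) X) b d =
  hform (fun i j => X i j : bop H) (fun j => \sum_q b (j, q) *: e q)
    (fun i => \sum_p d (i, p) *: e p).
Proof.
rewrite sformE.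
transitivity (\sum_i \sum_p \sum_j \sum_q
    inner (X i j (e q)) (e p) * b (j, q) * Num.conj (d (i, p))).
  rewrite [RHS]pair_bigA /=; apply: eq_bigr => -[i p] _.
  rewrite [RHS]pair_bigA /=; apply: eq_bigr => -[j q] _.
  by rewrite /pairing /= mxE.
rewrite hformE; apply: eq_bigr => i _; rewrite exchange_big /=; apply: eq_bigr => j _.
rewrite bop_sum inner_suml exchange_big /=; apply: eq_bigr => q _.
rewrite inner_sumr; apply: eq_bigr => p _.
by rewrite bopZ innerZl innerZr; ring.
Qed.

Lemma orthonormal_l2norm m n (e : 'I_m -> H) (b : 'I_n * 'I_m -> R[i]) : orthonormal e ->
  l2norm (fun j => \sum_q b (j, q) *: e q) = l2norm b.
Proof.
move=> oe; apply/eqP; rewrite -(@eqrXn2 _ 2) ?l2norm_ge0 // !l2norm_sq; apply/eqP.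
under eq_bigr do rewrite orthonormal_rnorm //.
by rewrite pair_bigA /=; apply: eq_bigr => -[].
Qed.

(** Coefficient vectors over an orthonormal family have the norm of the vectors they describe, so
    the pairing with [X] is a value of the form of [X] itself. *)
Lemma mnorm_omega_mx m (e : 'I_m -> H) : orthonormal e -> mnorm (omega_mx e) <= 1.
Proof.
move=> oe; apply/mnorm_predualP => // n X b d.
rewrite omega_mx_pairing mul1r -(orthonormal_l2norm b oe) -(orthonormal_l2norm d oe).
exact: hform_le_mnorm.
Qed.

(** The entries of [v] and [w] span a finite-dimensional space; over an orthonormal basis of it the
    form of [X] at [v] and [w] becomes a form of a compression. *)
Lemma mnorm_vn_compress n (X : 'M[M]_n) (k : R) : 0 <= k ->
  (forall m (e : 'I_m -> H) b d, orthonormal e ->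
    rnorm (sform (pairing (omega_mx e) X) b d) <= k * l2norm b * l2norm d) ->
  mnorm X <= k.
Proof.
move=> k0 h; apply/mnorm_vnP => // v w.
have [m [e [c [oe cP]]]] := Gram_Schmidt (fun i : 'I_n + 'I_n => match i with
  inl i => v i | inr i => w i end).
have := h m e (fun p => c (inl p.1) p.2) (fun p => c (inr p.1) p.2) oe.
rewrite omega_mx_pairing -!(orthonormal_l2norm _ oe) /=.
have -> : (fun j => \sum_q c (inl j) q *: e q) = v by apply/funext => j; rewrite -cP.
by have -> : (fun j => \sum_q c (inr j) q *: e q) = w by apply/funext => j; rewrite -cP.
Qed.

Lemma norm1_series (f : predual M) (xi eta : nat -> H) (c : R) : 0 <= c ->
  (forall x : M, tends (fun n => \sum_(k < n) inner (x (xi k)) (eta k)) (f x)) ->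
  (forall n, \sum_(k < n) rnorm (xi k) * rnorm (eta k) <= c) ->
  norm1 f <= c.
Proof.
move=> c0 h cP; apply/mnorm_predualP => // n X b d.
have bs : bijective (fun i : 'I_n => (i, ord0 : 'I_1)).
  by exists fst => // -[i j]; rewrite (ord1 j).
rewrite (sform_reindex _ _ _ bs bs) -(l2norm_reindex b bs) -(l2norm_reindex d bs).
have -> : (fun i j => pairing (const_mx f : 'M[predual M]_1) X (i, ord0) (j, ord0)) =
    (fun i j => f (X i j)).
  by apply/funext => i; apply/funext => j; rewrite /pairing /= mxE.
exact: series_functional_bound h cP _ _ _ _.
Qed.

Lemma norm1_omega u v : norm1 (omega u v) <= rnorm u * rnorm v.
Proof.
pose at0 w n : H := if n is 0%N then w else 0.
apply: (norm1_series (xi := at0 u) (eta := at0 v)).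
- by rewrite mulr_ge0 ?rnorm_ge0.
- move=> x e e0; exists 1%N => -[//|n _].
  rewrite big_ord_recl /= big1 ?addr0 ?subrr ?rnorm0 // => i _.
  by rewrite bop0 inner0l.
- move=> [|n]; first by rewrite big_ord0 mulr_ge0 ?rnorm_ge0.
  by rewrite big_ord_recl /= big1 ?addr0 // => i _; rewrite rnorm0 mul0r.
Qed.

Lemma bounded_series_tail (a : nat -> R) (c : R) : (forall n, 0 <= a n) ->
  (forall n, \sum_(k < n) a k <= c) ->
  forall e : R, 0 < e -> exists N, forall m, (N <= m)%N ->
    forall n, \sum_(k < n) a (m + k)%N <= e.
Proof.
move=> a0 ac e e0; pose S := range (fun n => \sum_(k < n) a k).
have hS : has_sup S by split; [exists 0, 0%N => //; rewrite big_ord0|exists c => _ [n _ <-]].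
have [_ [N _ <-] NP] := sup_adherent e0 hS.
exists N => m Nm n.
have split_sum p q : \sum_(k < p + q) a k = \sum_(k < p) a k + \sum_(k < q) a (p + k)%N.
  by rewrite big_split_ord.
have : \sum_(k < m + n) a k <= sup S.
  by apply: ub_le_sup; [case: hS|exists (m + n)%N].
rewrite split_sum -(subnKC Nm) split_sum.
have : 0 <= \sum_(k < m - N) a (N + k)%N by apply: sumr_ge0.
rewrite (subnKC Nm); lra.
Qed.

(** Finite sums of vector functionals are norm dense in M_*: the remainder is again a series, and
    [norm1_series] bounds it by its tail. *)
Lemma predual_tail (f : predual M) (xi eta : nat -> H) :
  square_summable xi -> square_summable eta ->
  (forall x : M, tends (fun n => \sum_(k < n) inner (x (xi k)) (eta k)) (f x)) ->
  forall e : R, 0 < e -> exists N, forall n, (N <= n)%N ->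
    norm1 (f - \sum_(k < n) omega (xi k) (eta k)) <= e.
Proof.
move=> xi2 eta2 h e e0; have [c c0 cP] := square_summableM xi2 eta2.
have [|N NP] := bounded_series_tail (a := fun k => rnorm (xi k) * rnorm (eta k)) _ cP e0.
  by move=> n; rewrite mulr_ge0 ?rnorm_ge0.
exists N => n Nn.
apply: (norm1_series (xi := fun k => xi (n + k)%N) (eta := fun k => eta (n + k)%N)).
- exact: ltW.
- move=> x; rewrite predual_addE predual_oppE predual_sumE.
  rewrite (_ : (fun _ => _) = fun m => \sum_(k < n + m) inner (x (xi k)) (eta k) +
     - (\sum_(k < n) inner (x (xi k)) (eta k))).
    apply: tendsD; last exact: tends_const.
    by apply: (tends_subseq (s := fun m => (n + m)%N)) (h x) => m; rewrite leq_addl.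
  by apply/funext => m; rewrite big_split_ord /= [X in X - _]addrC addrK.
- exact: NP.
Qed.

(** The bicommutant property in terms of matrix coefficients, for operators known only through their
    forms. *)
Lemma commutant_mem (b : bop H) :
  (forall d, commutant (vn_set M) d -> forall u v, inner (b (d u)) v = inner (b u) (adj d v)) ->
  b \in vn_pred M.
Proof.
move=> h; apply/asboolP; rewrite -vn_bicommutant => d hd.
apply/bopP => u; apply: inner_ext => w.
by rewrite innerC [RHS]innerC; congr (Num.conj _); rewrite /= adjP -h //.
Qed.

(** The form (u, v) |-> phi (omega u v) is that of an operator b. For d in the commutant of M,
    [omega (d u) v] and [omega u (adj d v)] agree on M, so b lies in the bicommutant. Norm density
    of the sums of vector functionals does the rest. *)
Lemma dual_predual_repr (phi : dual (predual M)) : exists x : M, forall f, phi f = f x.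
Proof.
have /asboolP[_ [k0' kP]] := dual_prop phi.
pose k := `|k0'|; have k0 : 0 <= k by rewrite normr_ge0.
have phik f : rnorm (phi f) <= k * norm1 f.
  apply: le_trans (kP f) _; rewrite ler_wpM2r ?ler_norm //.
  exact: mnorm_predual_ge0.
have [||||b [bP _]] := @form_bop _ _ (fun u v => phi (omega u v)) k.
- by [].
- by move=> a u u' v; rewrite omega_linearl dual_linear.
- by move=> a u v v'; rewrite omega_linearr dual_linear.
- move=> u v; apply: le_trans (phik _) _; rewrite -mulrA ler_wpM2l //.
  exact: norm1_omega.
have bM : b \in vn_pred M.
  apply: commutant_mem => d hd u v; rewrite !bP; congr (phi _).
  apply: predual_ext => x; rewrite !omegaE -adjP.
  have /hd/bopP/(_ u) /= -> // : vn_set M x by apply/asboolP/vn_prop.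
exists (VNElt bM) => f; have [xi [eta [xi2 eta2 h]]] := predualP f.
apply: tends_unique (h (VNElt bM)) => e e0.
have e1 : 0 < e / (k + 1) by rewrite divr_gt0 // ltr_wpDl.
have [N NP] := predual_tail xi2 eta2 h e1.
exists N => n Nn; rewrite -rnormN opprB.
have -> : \sum_(i < n) inner (VNElt bM (xi i)) (eta i) = phi (\sum_(i < n) omega (xi i) (eta i)).
  have phiD : {morph (phi : predual M -> R[i]) : f g / f + g}.
    by move=> f1 f2; rewrite -[f1]scale1r dual_linear mul1r scale1r.
  have phi0 : phi 0 = 0 by apply: (addrI (phi 0)); rewrite -phiD !addr0.
  rewrite (big_morph _ phiD phi0); apply: eq_bigr => i _; exact: bP.
have -> : phi f - phi (\sum_(i < n) omega (xi i) (eta i)) =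
    phi (f - \sum_(i < n) omega (xi i) (eta i)).
  by rewrite -mulN1r addrC -dual_linear scaleN1r addrC.
apply: le_lt_trans (phik _) _; apply: le_lt_trans (_ : _ <= k * (e / (k + 1))) _.
  by rewrite ler_wpM2l // NP.
rewrite mulrA ltr_pdivrMr ?ltr_wpDl // mulrDr mulr1 mulrC ltrDl //.
Qed.
End VectorFunctionals.

(** * Operator space structure of the predual and of annihilators *)

Section RuanAxioms.
Context {R : realType} {H : hilbertType R} {M : vnAlgebra H}.

Lemma l2norm_le_dual (I : finType) (y : I -> R[i]) (k : R) : 0 <= k ->
  (forall w : I -> R[i], rnorm (\sum_i y i * Num.conj (w i)) <= k * l2norm w) -> l2norm y <= k.
Proof.
move=> k0 /(_ y).
have -> : \sum_i y i * Num.conj (y i) = (l2norm y ^+ 2)%:C.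
  by rewrite l2norm_sq rmorph_sum; apply: eq_bigr => i _; rewrite rmorphXn /= -rnormE normCK.
rewrite rnorm_real ger0_norm ?sqr_ge0 // expr2.
have [->|y0] := eqVneq (l2norm y) 0; first by [].
by rewrite ler_pM2r // lt_neqAle eq_sym y0 l2norm_ge0.
Qed.

Lemma scalar_norm_ge0 m n (a : 'M[R[i]]_(m, n)) : 0 <= scalar_norm a.
Proof. exact: (scalar_opnorm_ge0 (fun i j => a i j)). Qed.

Lemma sform_le_scalar_norm m n (a : 'M[R[i]]_(m, n)) b c :
  rnorm (sform (fun i j => a i j) b c) <= scalar_norm a * l2norm b * l2norm c.
Proof.
exact: (scalar_opnormP (fun i j => a i j) (scalar_norm_ge0 a)).1 (lexx _) b c.
Qed.

Lemma l2norm_fibers (I J : finType) (b : I * J -> R[i]) :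
  l2norm b ^+ 2 = \sum_i l2norm (fun j => b (i, j)) ^+ 2.
Proof.
under eq_bigr do rewrite l2norm_sq.
by rewrite l2norm_sq pair_bigA /=; apply: eq_bigr => -[].
Qed.

Lemma l2norm_fibers_le (I J J' : finType) (b : I * J -> R[i]) (b' : I * J' -> R[i]) (k : R) :
  0 <= k -> (forall i, l2norm (fun j => b' (i, j)) <= k * l2norm (fun j => b (i, j))) ->
  l2norm b' <= k * l2norm b.
Proof.
move=> k0 h; rewrite -(@ler_pXn2r _ 2) ?nnegrE ?mulr_ge0 ?l2norm_ge0 // exprMn.
rewrite !l2norm_fibers mulr_sumr; apply: ler_sum => i _; rewrite -exprMn.
by rewrite ler_pXn2r ?nnegrE ?mulr_ge0 ?l2norm_ge0.
Qed.

(** The matrix acts on each fibre, as 1 (x) a, and an amplification does not increase the norm. *)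
Lemma l2norm_mul_mx m n (I : finType) (a : 'M[R[i]]_(m, n)) (b : I * 'I_n -> R[i]) :
  l2norm (fun p : I * 'I_m => \sum_q a p.2 q * b (p.1, q)) <= scalar_norm a * l2norm b.
Proof.
apply: l2norm_fibers_le => [|i]; first exact: scalar_norm_ge0.
apply: l2norm_le_dual => [|w]; first by rewrite mulr_ge0 ?scalar_norm_ge0 ?l2norm_ge0.
exact: (sform_le_scalar_norm a (fun q => b (i, q)) w).
Qed.

Lemma l2norm_adj_mx m n (I : finType) (a : 'M[R[i]]_(m, n)) (b : I * 'I_m -> R[i]) :
  l2norm (fun p : I * 'I_n => \sum_q Num.conj (a q p.2) * b (p.1, q)) <= scalar_norm a * l2norm b.
Proof.
apply: l2norm_fibers_le => [|i]; first exact: scalar_norm_ge0.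
apply: l2norm_le_dual => [|w]; first by rewrite mulr_ge0 ?scalar_norm_ge0 ?l2norm_ge0.
rewrite -rnorm_conj rmorph_sum /=; apply: le_trans (_ : _ <= _) _; last first.
  by rewrite mulrAC; exact: (sform_le_scalar_norm a w (fun q => b (i, q))).
rewrite le_eqVlt; apply/orP; left; apply/eqP; congr rnorm.
rewrite sformE exchange_big /=; apply: eq_bigr => k _.
rewrite rmorphM /= conjCK rmorph_sum mulr_suml; apply: eq_bigr => p _.
by rewrite rmorphM /= conjCK; ring.
Qed.

Lemma pairing_bimod m n k (a : 'M[R[i]]_(m, k)) (f : 'M[predual M]_k) (b : 'M[R[i]]_(k, m))
    (X : 'M[M]_n) c d :
  sform (pairing (bimod a f b) X) c d =
  sform (pairing f X) (fun p => \sum_q b p.2 q * c (p.1, q))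
    (fun p => \sum_q Num.conj (a q p.2) * d (p.1, q)).
Proof.
rewrite !sformE.
transitivity (\sum_i \sum_p \sum_j \sum_q \sum_s \sum_t
   a p s * b t q * f s t (X i j) * c (j, q) * Num.conj (d (i, p))).
  rewrite [RHS]pair_bigA /=; apply: eq_bigr => -[i p] _.
  rewrite [RHS]pair_bigA /=; apply: eq_bigr => -[j q] _.
  rewrite /pairing /= mxE predual_sumE !mulr_suml; apply: eq_bigr => s _.
  by rewrite predual_sumE !mulr_suml; apply: eq_bigr => t _; rewrite predual_scaleE.
transitivity (\sum_i \sum_s \sum_j \sum_t \sum_q \sum_p
   a p s * b t q * f s t (X i j) * c (j, q) * Num.conj (d (i, p))); last first.
  rewrite [LHS]pair_bigA /=; apply: eq_bigr => -[i s] _.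
  rewrite [LHS]pair_bigA /=; apply: eq_bigr => -[j t] _.
  rewrite /pairing /= mulr_sumr mulr_suml; apply: eq_bigr => q _.
  rewrite rmorph_sum mulr_sumr; apply: eq_bigr => p _.
  by rewrite rmorphM /= conjCK; ring.
apply: eq_bigr => i _.
under eq_bigr => p _.
  under eq_bigr => j _ do rewrite exchange_big /=.
  rewrite exchange_big /=.
  over.
rewrite exchange_big /=; apply: eq_bigr => s _.
rewrite exchange_big /=; apply: eq_bigr => j _.
under eq_bigr do rewrite exchange_big /=.
rewrite exchange_big /=; apply: eq_bigr => t _.
by rewrite exchange_big.
Qed.

Lemma pairing_dsum m n k (f : 'M[predual M]_m) (g : 'M[predual M]_n) (X : 'M[M]_k) c d :
  sform (pairing (block_mx f 0 0 g) X) c d =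
  sform (pairing f X) (fun p => c (p.1, lshift n p.2)) (fun p => d (p.1, lshift n p.2)) +
  sform (pairing g X) (fun p => c (p.1, rshift m p.2)) (fun p => d (p.1, rshift m p.2)).
Proof.
have E (l : nat) (h : 'M[predual M]_l) c' d' : sform (pairing h X) c' d' =
   \sum_i \sum_p \sum_j \sum_q h p q (X i j) * c' (j, q) * Num.conj (d' (i, p)).
  rewrite sformE [RHS]pair_bigA /=; apply: eq_bigr => -[i p] _.
  by rewrite [RHS]pair_bigA /=; apply: eq_bigr => -[j q] _.
rewrite !E -big_split /=; apply: eq_bigr => i _; rewrite big_split_ord /=.
congr (_ + _); apply: eq_bigr => p _; apply: eq_bigr => j _; rewrite big_split_ord /=.
  rewrite [X in _ + X]big1 ?addr0 => [|q _]; last first.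
    by rewrite block_mxEur mxE !mul0r.
  by apply: eq_bigr => q _; rewrite block_mxEul.
rewrite [X in X + _]big1 ?add0r => [|q _]; last first.
  by rewrite block_mxEdl mxE !mul0r.
by apply: eq_bigr => q _; rewrite block_mxEdr.
Qed.

Lemma l2norm_dsum (m n : nat) (I : finType) (b : I * 'I_(m + n) -> R[i]) :
  l2norm b ^+ 2 = l2norm (fun p : I * 'I_m => b (p.1, lshift n p.2)) ^+ 2 +
    l2norm (fun p : I * 'I_n => b (p.1, rshift m p.2)) ^+ 2.
Proof.
rewrite !l2norm_fibers -big_split /=; apply: eq_bigr => i _.
by rewrite !l2norm_sq big_split_ord.
Qed.

(** All norms are read off from scalar forms. Scalar matrices pass from the functionals to the test
    vectors, and for a direct sum the test vectors split orthogonally, so that the two contributions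
    combine by Cauchy-Schwarz. *)
Lemma operator_space_predual : operator_space (predual M).
Proof.
split.
- move=> m f f0; apply/matrixP => p q; rewrite mxE; apply: predual_ext => y.
  (* Against unit coordinate vectors the form is the single number [f p q y]. *)
  have := pairing_le f (const_mx y : 'M[M]_1) (fun r => (r.2 == q)%:R) (fun r => (r.2 == p)%:R).
  rewrite f0 !mul0r => h; apply: rnorm0_eq0; apply/eqP; rewrite eq_le rnorm_ge0 andbT.
  apply: le_trans h; rewrite le_eqVlt; apply/orP; left; apply/eqP; congr rnorm.
  rewrite sformE (bigD1 (ord0, p)) //= (bigD1 (ord0, q)) //= !big1; last first.
  + move=> [i r]; rewrite (ord1 i) xpair_eqE eqxx /= => /negbTE rq.
    by rewrite /= rq mulr0 mul0r.
  + move=> [i r]; rewrite (ord1 i) xpair_eqE eqxx /= => /negbTE rp.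
    by rewrite big1 // => j _; rewrite rp rmorph0 mulr0.
  by rewrite /pairing /= mxE !eqxx /= rmorph_nat !mulr1 !addr0.
- move=> m f g; apply/mnorm_predualP => [|n X b d].
    by rewrite addr_ge0 ?mnorm_predual_ge0.
  have -> : sform (pairing (f + g) X) b d = sform (pairing f X) b d + sform (pairing g X) b d.
    rewrite !sformE -big_split; apply: eq_bigr => p _.
    rewrite -big_split; apply: eq_bigr => q _ /=.
    by rewrite /pairing mxE predual_addE !mulrDl.
  apply: le_trans (rnormD _ _) _; rewrite !mulrDl; apply: lerD; exact: pairing_le.
- move=> m n a f b; apply/mnorm_predualP => [|k X c d].
    by rewrite !mulr_ge0 ?scalar_norm_ge0 ?mnorm_predual_ge0.
  rewrite pairing_bimod; apply: le_trans (pairing_le _ _ _ _) _.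
  have := l2norm_mul_mx b c; have := l2norm_adj_mx a d.
  set u := l2norm _; set v := l2norm d; set w := l2norm _; set z := l2norm c => h1 h2.
  rewrite (_ : _ * z * v = mnorm f * mnorm X * (scalar_norm b * z) * (scalar_norm a * v));
    last by ring.
  apply: ler_pM; rewrite ?mulr_ge0 ?mnorm_predual_ge0 ?mnorm_vn_ge0 ?l2norm_ge0 //.
  by rewrite ler_wpM2l // ?mulr_ge0 ?mnorm_predual_ge0 ?mnorm_vn_ge0.
- move=> m n f g; apply/eqP; rewrite eq_le; apply/andP; split.
    apply/mnorm_predualP => [|k X c d].
      by rewrite le_max mnorm_predual_ge0.
    rewrite pairing_dsum; apply: le_trans (rnormD _ _) _.
    set K := Num.max _ _.
    have c2 := l2norm_dsum c; have d2 := l2norm_dsum d.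
    apply: le_trans (lerD (pairing_le _ _ _ _) (pairing_le _ _ _ _)) _.
    move: c2 d2; set c1 := l2norm (fun p => c (p.1, lshift n p.2));
      set c2 := l2norm (fun p => c (p.1, rshift m p.2)).
    set d1 := l2norm (fun p => d (p.1, lshift n p.2));
      set d2 := l2norm (fun p => d (p.1, rshift m p.2)) => ec ed.
    have K0 : 0 <= K by rewrite le_max mnorm_predual_ge0.
    have fK : mnorm f <= K by rewrite le_max lexx.
    have gK : mnorm g <= K by rewrite le_max lexx orbT.
    have X0 : 0 <= mnorm X := mnorm_vn_ge0 X.
    have p1 : 0 <= c1 * d1 by rewrite mulr_ge0 ?l2norm_ge0.
    have p2 : 0 <= c2 * d2 by rewrite mulr_ge0 ?l2norm_ge0.
    apply: le_trans (_ : K * mnorm X * (c1 * d1) + K * mnorm X * (c2 * d2) <= _).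
      by apply: lerD; rewrite -[leLHS]mulrA; apply: ler_wpM2r => //; apply: ler_wpM2r.
    rewrite -mulrDr -(mulrA (K * _)) ler_wpM2l ?mulr_ge0 //.
    rewrite -(@ler_pXn2r _ 2) ?nnegrE ?addr_ge0 ?mulr_ge0 ?l2norm_ge0 // exprMn ec ed.
    by have := sqr_ge0 (c1 * d2 - c2 * d1); nra.
  rewrite ge_max; apply/andP; split;
    (apply/mnorm_predualP => [|k X c d]; first exact: mnorm_predual_ge0).
    (* Extension by zero turns a form of the block [f] into one of the direct sum, with test vectors
       of the same norm. *)
    pose c' (p : 'I_k * 'I_(m + n)) := if fintype.split p.2 is inl q then c (p.1, q) else 0.
    pose d' (p : 'I_k * 'I_(m + n)) := if fintype.split p.2 is inl q then d (p.1, q) else 0.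
    have l2 (a : 'I_k * 'I_m -> R[i]) (a' : 'I_k * 'I_(m + n) -> R[i]) :
        (forall p, a' p = if fintype.split p.2 is inl q then a (p.1, q) else 0) ->
        l2norm a' = l2norm a.
      move=> h; apply/eqP; rewrite -(@eqrXn2 _ 2) ?l2norm_ge0 // l2norm_dsum; apply/eqP.
      rewrite (_ : (fun p => a' (p.1, lshift n p.2)) = a).
        rewrite [X in _ + X ^+ 2](_ : _ = 0) ?expr0n ?addr0 //.
        rewrite -[RHS](l2norm0 (V := R[i]) (I := ('I_k * 'I_n)%type)); congr l2norm.
        by apply/funext => p; rewrite h /= (unsplitK (inr _ p.2)).
      by apply/funext => -[i p]; rewrite h /= (unsplitK (inl _ p)).
    rewrite -(l2 c c') // -(l2 d d') //; apply: le_trans (pairing_le (block_mx f 0 0 g) X c' d').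
    rewrite le_eqVlt; apply/orP; left; apply/eqP; congr rnorm; rewrite pairing_dsum.
    rewrite [X in _ + X]sformE [X in _ + X]big1 ?addr0 => [|p _].
      congr sform; apply/funext => -[i p]; by rewrite /c' /d' /= (unsplitK (inl _ p)).
    by rewrite big1 // => q _; rewrite /c' /= (unsplitK (inr _ q.2)) mulr0 mul0r.
  pose c' (p : 'I_k * 'I_(m + n)) := if fintype.split p.2 is inr q then c (p.1, q) else 0.
  pose d' (p : 'I_k * 'I_(m + n)) := if fintype.split p.2 is inr q then d (p.1, q) else 0.
  have l2 (a : 'I_k * 'I_n -> R[i]) (a' : 'I_k * 'I_(m + n) -> R[i]) :
      (forall p, a' p = if fintype.split p.2 is inr q then a (p.1, q) else 0) ->
        l2norm a' = l2norm a.
    move=> h; apply/eqP; rewrite -(@eqrXn2 _ 2) ?l2norm_ge0 // l2norm_dsum; apply/eqP.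
    rewrite (_ : (fun p => a' (p.1, rshift m p.2)) = a).
      rewrite [X in X ^+ 2 + _](_ : _ = 0) ?expr0n ?add0r //.
      rewrite -[RHS](l2norm0 (V := R[i]) (I := ('I_k * 'I_m)%type)); congr l2norm.
      by apply/funext => p; rewrite h /= (unsplitK (inl _ p.2)).
    by apply/funext => -[i p]; rewrite h /= (unsplitK (inr _ p)).
  rewrite -(l2 c c') // -(l2 d d') //; apply: le_trans (pairing_le (block_mx f 0 0 g) X c' d').
  rewrite le_eqVlt; apply/orP; left; apply/eqP; congr rnorm; rewrite pairing_dsum.
  rewrite [X in X + _]sformE [X in X + _]big1 ?add0r => [|p _].
    congr sform; apply/funext => -[i p]; by rewrite /c' /d' /= (unsplitK (inr _ p)).
  by rewrite big1 // => q _; rewrite /c' /= (unsplitK (inl _ q.2)) mulr0 mul0r.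
Qed.
End RuanAxioms.

(** That only 0 has norm 0 in E is part of the conclusion, and it is drawn from the injectivity of
    [j]. *)
Lemma sub_operator_space {R : realType} (E F : matrixNormedType R) (j : E -> F) :
  injective j -> complete_isometry j -> operator_space F -> operator_space E.
Proof.
move=> inj_j [lj ij] [F0 FD FM Fd].
have j0 : j 0 = 0 by have := lj (-1) 0 0; rewrite scaler0 addr0 scaleN1r addNr.
have jD : {morph j : x y / x + y}.
  by move=> x y; rewrite -[x]scale1r lj !scale1r.
have jZ a x : j (a *: x) = a *: j x by rewrite -[a *: x]addr0 lj j0 addr0.
have js (I : finType) (G : I -> E) : j (\sum_i G i) = \sum_i j (G i).
  exact: (big_morph j jD j0).
split.
- move=> n x; rewrite -ij => /F0 /matrixP h; apply/matrixP => p q.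
  by rewrite mxE; apply: inj_j; have := h p q; rewrite !mxE j0.
- move=> n x y; rewrite -!ij; rewrite (_ : map_mx j (x + y) = map_mx j x + map_mx j y) //.
  by apply/matrixP => p q; rewrite !mxE jD.
- move=> m n a x b; rewrite -!ij.
  rewrite (_ : map_mx j (bimod a x b) = bimod a (map_mx j x) b) //.
  apply/matrixP => p q; rewrite !mxE js; apply: eq_bigr => k _.
  by rewrite js; apply: eq_bigr => l _; rewrite jZ mxE.
- move=> m n x y; rewrite -!ij map_block_mx -Fd; congr (mnorm (block_mx _ _ _ _)).
    by apply/matrixP => p q; rewrite !mxE j0.
  by apply/matrixP => p q; rewrite !mxE j0.
Qed.

Section Annihilator.
Context {R : realType} {H : hilbertType R} {M : vnAlgebra H} {n : nat} (y : 'I_n -> M).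

Definition annihilates : {pred predual M} := [pred f : predual M | `[< forall i, f (y i) = 0 >]].

Lemma annihilates_submod : submod_closed annihilates.
Proof.
split=> [|a f g /asboolP hf /asboolP hg]; apply/asboolP => i //.
by rewrite predual_addE predual_scaleE hf hg mulr0 addr0.
Qed.
HB.instance Definition _ := GRing.isSubmodClosed.Build R[i] (predual M)
  annihilates annihilates_submod.

Record annihilator := Annihilator { ann_val :> predual M; ann_prop : ann_val \in annihilates }.
HB.instance Definition _ := [isSub for ann_val].
HB.instance Definition _ := [Choice of annihilator by <:].
HB.instance Definition _ := [SubChoice_isSubLmodule of annihilator by <:].
HB.instance Definition _ := Lmodule_isMatrixNormed.Build R annihilator
  (fun n (f : 'M[annihilator]_n) => mnorm (map_mx ann_val f)).

Lemma ann_val_isometry : complete_isometry ann_val.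
Proof. by []. Qed.

Lemma operator_space_annihilator : operator_space annihilator.
Proof.
apply: (sub_operator_space (j := ann_val)) ann_val_isometry operator_space_predual.
exact: val_inj.
Qed.
End Annihilator.

Lemma factor_through_functionals {K : fieldType} {V W : lmodType K} n
    (b : 'I_n -> V -> K) (U : V -> W) :
  (forall i a x y, b i (a *: x + y) = a * b i x + b i y) ->
  linear U -> (forall x, (forall i, b i x = 0) -> U x = 0) ->
  exists c : 'I_n -> W, forall x, U x = \sum_i b i x *: c i.
Proof.
elim: n b U => [|n IH] b U lb lU h.
  by exists (fun=> 0) => x; rewrite big_ord0 h // => -[].
have [[v [v0 vP]]|nv] := pselect (exists v, b ord0 v != 0 /\
    forall i, b (lift ord0 i) v = 0); last first.
  have [|//||c cP] := IH (fun i => b (lift ord0 i)) U; first by move=> i; exact: lb.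
    move=> x hx; apply: h => i; case: (unliftP ord0 i) => [j|] ->; first exact: hx.
    by apply/eqP/negPn/negP => b0; apply: nv; exists x.
  exists (fun i => if unlift ord0 i is Some j then c j else 0) => x.
  rewrite big_ord_recl unlift_none scaler0 add0r cP.
  by apply: eq_bigr => i _; rewrite liftK.
pose w := (b ord0 v)^-1 *: v.
have b0 i : b i 0 = 0 by have := lb i (-1) 0 0; rewrite scaler0 addr0 mulN1r addNr.
have bZ i a x : b i (a *: x) = a * b i x by rewrite -[a *: x]addr0 lb b0 addr0.
have w1 : b ord0 w = 1 by rewrite bZ mulVf.
have wi i : b (lift ord0 i) w = 0 by rewrite bZ vP mulr0.
have [||x hx|c cP] := IH (fun i => b (lift ord0 i)) (fun x => U x - b ord0 x *: U w).
- by move=> i; exact: lb.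
- move=> a x y /=; rewrite lU lb scalerDl scalerBr opprD addrACA scalerA.
  by [].
- rewrite addrC -scaleNr -lU; apply: h => i; rewrite lb.
  case: (unliftP ord0 i) => [j|] ->; first by rewrite wi hx mulr0 addr0.
  by rewrite w1 mulr1 addNr.
exists (fun i => if unlift ord0 i is Some j then c j else U w) => x.
rewrite big_ord_recl unlift_none.
rewrite (eq_bigr (fun i => b (lift ord0 i) x *: c i)); last by move=> i _; rewrite liftK.
by rewrite -cP addrC subrK.
Qed.

(** * Closed subspaces of the space of square-summable sequences *)

Section ComplexSeries.
Context {R : realType}.

Lemma tends_real (a : nat -> R) (c : R) : (forall n, \sum_(k < n) `|a k| <= c) ->
  exists l : R, forall e : R, 0 < e -> exists N, forall n, (N <= n)%N ->
    `|\sum_(k < n) a k - l| < e.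
Proof.
move=> ac.
have /normed_cvg/cvg_ex[l /cvgrPdist_lt al] : cvgn [normed series (a : nat -> R^o)].
  apply: nondecreasing_is_cvgn; first by apply: nondecreasing_series => n _ _; exact: normr_ge0.
  by exists c => _ [n _ <-]; rewrite /normed_series_of -[leLHS]/(\sum_(0 <= k < n) `|a k|) big_mkord.
exists l => e e0; have [N _ NP] := al e e0; exists N => n Nn.
by have := NP n Nn; rewrite /= distrC seriesEnat /= big_mkord.
Qed.

Lemma rnorm_ReIm (z : R[i]) : rnorm z <= `|complex.Re z| + `|complex.Im z|.
Proof.
rewrite -(@ler_pXn2r _ 2) ?nnegrE ?rnorm_ge0 ?addr_ge0 //.
have -> : rnorm z ^+ 2 = complex.Re z ^+ 2 + complex.Im z ^+ 2.
  by case: z => x y; rewrite /rnorm normc_def /= sqr_sqrtr // addr_ge0 ?sqr_ge0.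
rewrite sqrrD -[complex.Re z ^+ 2]real_normK ?num_real //.
rewrite -[complex.Im z ^+ 2]real_normK ?num_real // lerD2r lerDl.
by rewrite mulrn_wge0 // mulr_ge0.
Qed.

Lemma Im_le_rnorm (z : R[i]) : `|complex.Im z| <= rnorm z.
Proof.
rewrite -(@ler_pXn2r _ 2) ?nnegrE ?rnorm_ge0 // real_normK ?num_real //.
case: z => x y; rewrite /rnorm normc_def /= sqr_sqrtr ?addr_ge0 ?sqr_ge0 //.
by rewrite lerDr sqr_ge0.
Qed.

Lemma tends_complex_series (a : nat -> R[i]) (c : R) :
  (forall n, \sum_(k < n) rnorm (a k) <= c) ->
  exists l, tends (fun n => \sum_(k < n) a k) l.
Proof.
move=> ac.
have [|x xP] := @tends_real (fun k => complex.Re (a k)) c.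
  by move=> n; apply: le_trans (ac n); apply: ler_sum => k _; exact: Re_le_rnorm.
have [|y yP] := @tends_real (fun k => complex.Im (a k)) c.
  by move=> n; apply: le_trans (ac n); apply: ler_sum => k _; exact: Im_le_rnorm.
exists (Complex x y) => e e0; have e2 : 0 < e / 2 by rewrite divr_gt0.
have [N NP] := xP _ e2; have [N' NP'] := yP _ e2.
exists (maxn N N') => n; rewrite geq_max => /andP[/NP h /NP' h'].
apply: le_lt_trans (rnorm_ReIm _) _.
have eRe : complex.Re (\sum_(k < n) a k - Complex x y) = \sum_(k < n) complex.Re (a k) - x.
  by rewrite raddfB raddf_sum.
have eIm : complex.Im (\sum_(k < n) a k - Complex x y) = \sum_(k < n) complex.Im (a k) - y.
  by rewrite raddfB raddf_sum.
rewrite eRe eIm; lra.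
Qed.

Lemma Cauchy_tends {V : completeNormedModType R[i]} (u : nat -> V) :
  (forall e : R, 0 < e -> exists N, forall n m, (N <= n)%N -> (N <= m)%N ->
     rnorm (u n - u m) < e) -> exists l, tends u l.
Proof.
move=> h; have cvu : cvg (u @ \oo).
  apply: cauchy_cvg; apply: cauchy_exP => e e0.
  have [e' e'0 ->] : exists2 e' : R, 0 < e' & e = e'%:C.
    by move: e0; case: e => a b; rewrite ltcE /= => /andP[/eqP -> ?]; exists a.
  have [N NP] := h _ e'0; exists (u N); exists N => // n /= Nn.
  by rewrite -ball_normE /ball_ /= rnormE ltcR NP.
by exists (lim (u @ \oo)); apply/tendsP.
Qed.
End ComplexSeries.

Section SequenceSpace.
Context {R : realType} {K : hilbertType R}.
Implicit Types s z : nat -> K.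

(** Total on all sequences, with value 0 where the series diverges; for square-summable sequences
    [seq_inner_tends] gives convergence. *)
Definition seq_inner s z : R[i] :=
  xget 0 [set l | tends (fun n => \sum_(k < n) inner (s k) (z k)) l].

Definition seq_norm s : R := Num.sqrt (complex.Re (seq_inner s s)).

Lemma seq_inner_tends s z : square_summable s -> square_summable z ->
  tends (fun n => \sum_(k < n) inner (s k) (z k)) (seq_inner s z).
Proof.
move=> s2 z2; have [c c0 cP] := square_summableM s2 z2.
have [n|l lP] := @tends_complex_series R (fun k => inner (s k) (z k)) c.
  by apply: le_trans (cP n); apply: ler_sum => k _; exact: Cauchy_Schwarz.
by rewrite /seq_inner; case: xgetP => [y -> //|/(_ l)/(_ lP)].
Qed.

Lemma seq_innerE s z l : tends (fun n => \sum_(k < n) inner (s k) (z k)) l ->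
  seq_inner s z = l.
Proof.
move=> h; rewrite /seq_inner; case: xgetP => [y -> yP|/(_ l)/(_ h)//].
exact: tends_unique yP h.
Qed.

Lemma square_summable_lin a s z : square_summable s -> square_summable z ->
  square_summable (a *: s + z).
Proof.
move=> /square_summable_ge0[k k0 kP] /square_summable_ge0[l l0 lP].
apply/square_summableP; exists (2 * rnorm a ^+ 2 * k + 2 * l) => n.
have a2 : 0 <= 2 * rnorm a ^+ 2 by rewrite mulr_ge0 ?sqr_ge0.
have two : 0 <= 2 :> R by [].
apply: le_trans (lerD (ler_wpM2l a2 (kP n)) (ler_wpM2l two (lP n))).
rewrite !mulr_sumr -big_split /=; apply: ler_sum => i _.
have := rnormD (a *: s i) (z i); rewrite rnormZ.
change ((a *: s + z) i) with (a *: s i + z i).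
have := rnorm_ge0 (a *: s i + z i); have := rnorm_ge0 (s i); have := rnorm_ge0 (z i).
have := rnorm_ge0 a; set p := rnorm (_ + _); set q := rnorm a * _.
move=> a0 z0 s0 p0 pq; rewrite -mulrA -exprMn -/q.
have q0 : 0 <= q by rewrite mulr_ge0.
have : p ^+ 2 <= (q + rnorm (z i)) ^+ 2 by rewrite ler_pXn2r ?nnegrE ?addr_ge0.
have := sqr_ge0 (q - rnorm (z i)); nra.
Qed.

Lemma square_summable0 : square_summable (0 : nat -> K).
Proof.
by apply/square_summableP; exists 0 => n; rewrite big1 // => i _; rewrite rnorm0 expr0n.
Qed.

Lemma seq_inner_linl a s s' z : square_summable s -> square_summable s' -> square_summable z ->
  seq_inner (a *: s + s') z = a * seq_inner s z + seq_inner s' z.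
Proof.
move=> h h' hz; apply: seq_innerE.
have := tendsD (tendsM a (seq_inner_tends h hz)) (seq_inner_tends h' hz).
congr tends; apply/funext => n; rewrite mulr_sumr -big_split /=.
by apply: eq_bigr => k _; rewrite -innerZl -innerDl.
Qed.

Lemma seq_innerC s z : square_summable s -> square_summable z ->
  seq_inner s z = Num.conj (seq_inner z s).
Proof.
move=> h hz; apply: seq_innerE.
have := tends_map (T := @Num.conj R[i]) (k := 1) _ (seq_inner_tends hz h).
move=> hh; rewrite (_ : (fun _ => _) = fun n => Num.conj (\sum_(k < n) inner (z k) (s k))).
  by apply: hh => x y; rewrite -rmorphB rnorm_conj mul1r.
by apply/funext => n; rewrite rmorph_sum; apply: eq_bigr => k _; exact: innerC.
Qed.

Lemma seq_inner0l z : seq_inner 0 z = 0.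
Proof.
apply: seq_innerE; rewrite (_ : (fun _ => _) = fun=> 0); first exact: tends_const.
by apply/funext => n; rewrite big1 // => i _; exact: inner0l.
Qed.

Lemma seq_inner_ge_partial s n : square_summable s ->
  \sum_(k < n) rnorm (s k) ^+ 2 <= complex.Re (seq_inner s s).
Proof.
move=> h; apply/ler_addgt0Pr => e e0; have [N NP] := seq_inner_tends h h e0.
have := NP (maxn N n) (leq_maxl _ _).
rewrite -(subnKC (leq_maxr N n)) big_split_ord /=.
set A := \sum_(i < n) _; set B := \sum_(i < _) _ => lt.
have := le_lt_trans (Re_le_rnorm _) lt; rewrite raddfB raddfD /=.
have -> : complex.Re A = \sum_(k < n) rnorm (s k) ^+ 2.
  by rewrite raddf_sum; apply: eq_bigr => k _; exact/esym/rnorm_sq.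
have : 0 <= complex.Re B.
  rewrite raddf_sum; apply: sumr_ge0 => k _.
  by have := sqr_ge0 (rnorm (s (n + k)%N)); rewrite rnorm_sq.
rewrite ltr_norml => B0 /andP[_]; lra.
Qed.

Lemma seq_inner_self_ge0 s : square_summable s -> 0 <= complex.Re (seq_inner s s).
Proof. by move=> h; have := seq_inner_ge_partial 0 h; rewrite big_ord0. Qed.

Lemma seq_inner_self s : square_summable s -> seq_inner s s = (seq_norm s ^+ 2)%:C.
Proof.
move=> h; rewrite /seq_norm sqr_sqrtr ?seq_inner_self_ge0 //.
have := seq_innerC h h; case: (seq_inner s s) => a b /= [bb].
by congr Complex; apply/eqP; rewrite -[_ == _]orFb -[false](pnatr_eq0 R 2) -mulf_eq0
  -(subr_eq0 (2 * b)) subr0; apply/eqP; lra.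
Qed.

Lemma seq_norm_le s (c : R) : square_summable s -> 0 <= c ->
  (forall n, \sum_(k < n) rnorm (s k) ^+ 2 <= c ^+ 2) -> seq_norm s <= c.
Proof.
move=> h c0 hc; rewrite -(@ler_pXn2r _ 2) ?nnegrE ?sqrtr_ge0 //.
rewrite -[leLHS]ger0_norm ?sqr_ge0 // -rnorm_real -seq_inner_self //.
apply: (tends_le (seq_inner_tends h h)); exists 0%N => n _.
rewrite (_ : \sum_(k < n) _ = (\sum_(k < n) rnorm (s k) ^+ 2)%:C).
  by rewrite rnorm_real ger0_norm ?hc // sumr_ge0 // => k _; rewrite sqr_ge0.
by rewrite rmorph_sum; apply: eq_bigr => k _; rewrite inner_self.
Qed.

Lemma partial_le_seq_norm s n : square_summable s ->
  l2norm (fun k : 'I_n => s k) <= seq_norm s.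
Proof.
move=> h; rewrite -(@ler_pXn2r _ 2) ?nnegrE ?sqrtr_ge0 // l2norm_sq.
by rewrite /seq_norm sqr_sqrtr ?seq_inner_self_ge0 // seq_inner_ge_partial.
Qed.

Lemma seq_Cauchy_Schwarz s z : square_summable s -> square_summable z ->
  rnorm (seq_inner s z) <= seq_norm s * seq_norm z.
Proof.
move=> h hz; apply: (tends_le (seq_inner_tends h hz)); exists 0%N => n _.
apply: le_trans (rnorm_sum _) _.
apply: le_trans (_ : \sum_(k < n) rnorm (s k) * rnorm (z k) <= _).
  by apply: ler_sum => k _; exact: Cauchy_Schwarz.
apply: le_trans (sum_l2norm _ _) _.
by apply: ler_pM; rewrite ?l2norm_ge0 ?partial_le_seq_norm.
Qed.

Lemma seq_norm_triangle s z : square_summable s -> square_summable z ->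
  seq_norm (s + z) <= seq_norm s + seq_norm z.
Proof.
move=> h hz; have hs : square_summable (s + z).
  by rewrite -[s]scale1r; exact: square_summable_lin.
rewrite -(@ler_pXn2r _ 2) ?nnegrE ?addr_ge0 ?sqrtr_ge0 //.
have e1 : seq_inner (s + z) (s + z) = seq_inner s s + seq_inner z s +
    (seq_inner s z + seq_inner z z).
  have D a b c : square_summable a -> square_summable b -> square_summable c ->
      seq_inner (a + b) c = seq_inner a c + seq_inner b c.
    by move=> ha hb hc; rewrite -[a]scale1r seq_inner_linl // mul1r scale1r.
  have Dr a b c : square_summable a -> square_summable b -> square_summable c ->
      seq_inner c (a + b) = seq_inner c a + seq_inner c b.
    move=> ha hb hc; rewrite seq_innerC //; last by rewrite -[a]scale1r; exact: square_summable_lin.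
    by rewrite D // rmorphD /= -!seq_innerC.
  by rewrite (D s z _ h hz hs) (Dr s z s h hz h) (Dr s z z h hz hz) addrACA.
have -> : seq_norm (s + z) ^+ 2 = complex.Re (seq_inner (s + z) (s + z)).
  by rewrite seq_inner_self.
rewrite e1 !raddfD /= (seq_inner_self h) (seq_inner_self hz) /=.
have := seq_Cauchy_Schwarz h hz; have := seq_Cauchy_Schwarz hz h.
have := le_trans (ler_norm _) (Re_le_rnorm (seq_inner s z)).
have := le_trans (ler_norm _) (Re_le_rnorm (seq_inner z s)).
set x := complex.Re _; set y := complex.Re _; set a := seq_norm s; set b := seq_norm z.
move: x y a b => x y a b h1 h2 h3 h4.
have aux : y <= a * b by exact: le_trans h2 h4.
have aux' : x <= b * a by exact: le_trans h1 h3.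
by rewrite sqrrD mulr2n; move: aux'; rewrite mulrC; lra.
Qed.

Lemma seq_normZ a s : square_summable s -> seq_norm (a *: s) = rnorm a * seq_norm s.
Proof.
move=> h; have Z b t z : square_summable t -> square_summable z ->
    seq_inner (b *: t) z = b * seq_inner t z.
  move=> ht hz; rewrite -[b *: t]addr0 seq_inner_linl // ?seq_inner0l ?addr0 //.
  exact: square_summable0.
have ha : square_summable (a *: s).
  rewrite -[a *: s]addr0; apply: square_summable_lin => //; exact: square_summable0.
have e : seq_inner (a *: s) (a *: s) = ((rnorm a * seq_norm s) ^+ 2)%:C.
  rewrite Z // seq_innerC // Z // rmorphM /= seq_inner_self // mulrA -normCK rnormE.
  by rewrite conj_Creal ?complex_real // -rmorphXn -rmorphM exprMn.
by rewrite {1}/seq_norm e /= sqrtr_sqr ger0_norm // mulr_ge0 ?rnorm_ge0 ?sqrtr_ge0.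
Qed.

Lemma seq_norm_eq0 s : square_summable s -> seq_norm s = 0 -> s = 0.
Proof.
move=> h s0; apply/funext => n; apply: rnorm0_eq0; apply/eqP.
rewrite eq_le rnorm_ge0 andbT -s0.
apply: le_trans (partial_le_seq_norm n.+1 h).
exact: (@rnorm_le_l2norm _ _ _ (fun k : 'I_n.+1 => s k) ord_max).
Qed.

Lemma l2norm_le_hilbert (I : finType) (y : I -> K) (k : R) : 0 <= k ->
  (forall w : I -> K, rnorm (\sum_i inner (y i) (w i)) <= k * l2norm w) -> l2norm y <= k.
Proof.
move=> k0 /(_ y).
have -> : \sum_i inner (y i) (y i) = (l2norm y ^+ 2)%:C.
  by rewrite l2norm_sq rmorph_sum; apply: eq_bigr => i _; rewrite inner_self.
rewrite rnorm_real ger0_norm ?sqr_ge0 // expr2.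
have [->|y0] := eqVneq (l2norm y) 0; first by [].
by rewrite ler_pM2r // lt_neqAle eq_sym y0 l2norm_ge0.
Qed.

Variable Z : set (nat -> K).

(** An orthogonal complement is automatically closed, and a closure can be had as a double
    complement. This avoids any completion. *)
Definition perp_pred : {pred nat -> K} := [pred s | `[< square_summable s /\
  forall z, Z z -> square_summable z -> seq_inner s z = 0 >]].

Lemma perp_submod : submod_closed perp_pred.
Proof.
split=> [|a s t /asboolP[hs sZ] /asboolP[ht tZ]]; apply/asboolP.
  by split=> [|z _ _]; [exact: square_summable0|exact: seq_inner0l].
split=> [|z Zz hz]; first exact: square_summable_lin.
by rewrite seq_inner_linl // sZ // tZ // mulr0 addr0.
Qed.
HB.instance Definition _ := GRing.isSubmodClosed.Build R[i] (nat -> K) perp_pred perp_submod.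

Record perp := Perp { perp_seq :> nat -> K; perp_prop : perp_seq \in perp_pred }.
HB.instance Definition _ := [isSub for perp_seq].
HB.instance Definition _ := [Choice of perp by <:].
HB.instance Definition _ := [SubChoice_isSubLmodule of perp by <:].

Lemma perp_summable (s : perp) : square_summable s.
Proof. by case/asboolP: (perp_prop s). Qed.
Arguments perp_summable _ : clear implicits.

Lemma perp_ortho (s : perp) z : Z z -> square_summable z -> seq_inner s z = 0.
Proof. by case/asboolP: (perp_prop s) => _ h; exact: h. Qed.

Definition perp_norm (s : perp) : R[i] := (seq_norm s)%:C.

Lemma perp_normD (s t : perp) : perp_norm (s + t) <= perp_norm s + perp_norm t.
Proof. by rewrite -rmorphD lecR; apply: seq_norm_triangle; exact: perp_summable. Qed.

Lemma perp_normZ a (s : perp) : perp_norm (a *: s) = `|a| * perp_norm s.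
Proof.
rewrite rnormE -rmorphM; congr (_%:C); apply: seq_normZ; exact: perp_summable.
Qed.

Lemma perp_norm_eq0 (s : perp) : perp_norm s = 0 -> s = 0.
Proof.
by move=> h; apply: val_inj; exact: seq_norm_eq0 (perp_summable s) (complexI h).
Qed.

HB.instance Definition _ := Lmodule_isNormed.Build R[i] perp perp_normD perp_normZ perp_norm_eq0.

Lemma rnorm_perp (s : perp) : rnorm s = seq_norm s.
Proof. by []. Qed.

Lemma rnorm_coord (s : perp) k : rnorm (s k) <= rnorm s.
Proof.
apply: le_trans (partial_le_seq_norm k.+1 (perp_summable s)).
exact: (@rnorm_le_l2norm _ _ _ (fun j : 'I_k.+1 => s j) ord_max).
Qed.

(** The limit is formed coordinatewise. Testing the first N coordinates against a finite family lets
    the bound pass to the limit in m, uniformly in N. The rate is the one met in [perp_complete],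
    where s n is the centre of a ball of radius 1 / (n + 1) that belongs to the filter. *)
Lemma perp_seq_complete (s : nat -> perp) :
  (forall n m, rnorm (s n - s m) <= n.+1%:R^-1 + m.+1%:R^-1) ->
  exists l, forall n, rnorm (s n - l) <= n.+1%:R^-1.
Proof.
move=> h; have inv_small (e : R) : 0 < e -> exists N, forall n, (N <= n)%N -> n.+1%:R^-1 < e.
  by move=> e0; have [N _ NP] := near_infty_natSinv_lt (PosNum e0); exists N.
have /choice[l lP] k : exists l, tends (fun n => s n k) l.
  apply: Cauchy_tends => e e0; have e2 : 0 < e / 2 by rewrite divr_gt0.
  have [N NP] := inv_small _ e2; exists N => n m /NP hn /NP hm.
  apply: le_lt_trans (rnorm_coord (s n - s m) k) _.
  by apply: le_lt_trans (h n m) _; rewrite [ltRHS]splitr; exact: ltrD.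
have part n N : l2norm (fun k : 'I_N => s n k - l k) <= n.+1%:R^-1.
  apply: l2norm_le_hilbert => // w.
  have lim : tends (fun m => \sum_(k < N) inner (s n k - s m k) (w k))
     (\sum_(k < N) inner (s n k - l k) (w k)).
    apply: tends_sum => k.
    apply: (tends_map (T := fun x => inner (s n k - x) (w k)) (k := rnorm (w k))) (lP k) => x y.
    rewrite -innerNl -innerDl opprB addrC addrA subrK -rnormN -innerNl opprB mulrC.
    exact: Cauchy_Schwarz.
  apply/ler_addgt0Pr => e e0.
  pose d := e / (l2norm w + 1); have w0 : 0 <= l2norm w := l2norm_ge0 w.
  have d0 : 0 < d by rewrite divr_gt0 // ltr_wpDl.
  apply: (tends_le lim); have [M MP] := inv_small _ d0; exists M => m /MP hm.
  apply: le_trans (rnorm_sum _) _.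
  apply: le_trans (_ : \sum_(k < N) rnorm ((s n - s m) k) * rnorm (w k) <= _).
    by apply: ler_sum => k _; exact: Cauchy_Schwarz.
  apply: le_trans (sum_l2norm _ _) _.
  apply: le_trans (_ : (n.+1%:R^-1 + d) * l2norm w <= _).
    apply: ler_wpM2r => //; apply: le_trans (partial_le_seq_norm _ (perp_summable _)) _.
    apply: le_trans (h n m) _; by rewrite lerD2l ltW.
  rewrite mulrDl lerD2l /d mulrAC ler_pdivrMr ?ltr_wpDl // mulrDr mulr1 lerDl.
  exact: ltW.
have sqd n : square_summable (fun k => s n k - l k).
  apply/square_summableP; exists (n.+1%:R^-1 ^+ 2) => N.
  rewrite -(l2norm_sq (fun k : 'I_N => s n k - l k)).
  by rewrite ler_pXn2r ?nnegrE ?l2norm_ge0.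
have nd n : seq_norm (fun k => s n k - l k) <= n.+1%:R^-1.
  apply: seq_norm_le => // N; rewrite -(l2norm_sq (fun k : 'I_N => s n k - l k)).
  by rewrite ler_pXn2r ?nnegrE ?l2norm_ge0.
have le n : l = -1 *: (fun k => s n k - l k) + (s n : nat -> K).
  by apply/funext => k; rewrite !fctE /= scaleN1r opprB subrK.
have lperp : l \in perp_pred.
  apply/asboolP; split.
    by rewrite (le 0%N); apply: square_summable_lin => //; exact: perp_summable.
  move=> z Zz hz; apply: rnorm0_eq0; apply/eqP; rewrite eq_le rnorm_ge0 andbT.
  apply/ler_addgt0Pr => e e0; rewrite add0r.
  have z0 : 0 <= seq_norm z by exact: sqrtr_ge0.
  have d0 : 0 < e / (seq_norm z + 1) by rewrite divr_gt0 // ltr_wpDl.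
  have [N /(_ N (leqnn _)) NP] := inv_small _ d0.
  rewrite (le N) seq_inner_linl //; last exact: perp_summable.
  rewrite perp_ortho // addr0 mulN1r rnormN.
  apply: le_trans (seq_Cauchy_Schwarz _ _) _ => //.
  apply: le_trans (_ : e / (seq_norm z + 1) * seq_norm z <= _).
    by apply: ler_wpM2r => //; apply: le_trans (nd N) _; exact: ltW.
  rewrite mulrAC ler_pdivrMr ?ltr_wpDl // mulrDr mulr1 lerDl; exact: ltW.
by exists (Perp lperp) => n; exact: nd.
Qed.

Lemma perp_complete (F : set_system perp) : ProperFilter F -> cauchy F -> cvg F.
Proof.
move=> FF /cauchyP Fc.
have /choice[s sP] n : exists x : perp, F (ball x (n.+1%:R^-1 : R)%:C).
  by apply: Fc; rewrite ltcR invr_gt0.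
have [|l lP] := perp_seq_complete (s := s).
  move=> n m; have Fnm : F (ball (s n) (n.+1%:R^-1 : R)%:C `&` ball (s m) (m.+1%:R^-1 : R)%:C).
    by apply: filterI.
  have [x [xn xm]] := filter_ex Fnm.
  have -> : s n - s m = (s n - x) - (s m - x) by rewrite opprB addrA subrK.
  by apply: le_trans (rnormD _ _) _; rewrite rnormN lerD // ltW // ball_rnorm.
apply/cvg_ex; exists l; apply/cvgrPdist_lt => e e0.
have [e' e'0 ->] : exists2 e' : R, 0 < e' & e = e'%:C.
  by move: e0; case: e => a b; rewrite ltcE /= => /andP[/eqP -> ?]; exists a.
have e2 : 0 < e' / 2 by rewrite divr_gt0.
have [N _ /(_ N (leqnn _)) NP] := near_infty_natSinv_lt (PosNum e2).
apply: filterS (sP N) => x /ball_rnorm xN; rewrite rnormE ltcR.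
have -> : l - x = (s N - x) - (s N - l).
  by rewrite opprB [RHS]addrC addrA subrK.
apply: le_lt_trans (rnormD _ _) _; rewrite rnormN.
rewrite [ltRHS]splitr; apply: ltrD; first exact: lt_trans xN NP.
exact: le_lt_trans (lP N) NP.
Qed.

HB.instance Definition _ := Uniform_isComplete.Build perp perp_complete.

Definition perp_inner (s t : perp) : R[i] := seq_inner s t.

Lemma perp_inner_bilinear : bilinear_for
  (GRing.Scale.Law.clone _ _ *%R _) (GRing.Scale.Law.clone _ _ (@Num.conj R[i] \; *%R) _)
  perp_inner.
Proof.
split=> [t a s s'|s a t t'].
  by rewrite /perp_inner -seq_inner_linl; try exact: perp_summable.
rewrite /perp_inner seq_innerC; try exact: perp_summable.
rewrite (seq_innerC (perp_summable s) (perp_summable t)).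
rewrite (seq_innerC (perp_summable s) (perp_summable t')) /= -rmorphM -rmorphD.
by rewrite -seq_inner_linl; try exact: perp_summable.
Qed.
HB.instance Definition _ := bilinear_isBilinear.Build R[i] perp perp R[i]
  _ _ perp_inner perp_inner_bilinear.

Lemma perp_inner_hermitian (s t : perp) :
  perp_inner s t = (-1) ^+ false * Num.conj (perp_inner t s).
Proof. by rewrite expr0 mul1r; apply: seq_innerC; exact: perp_summable. Qed.
HB.instance Definition _ := isHermitianSesquilinear.Build R[i] perp false Num.conj
  perp_inner perp_inner_hermitian.

Lemma perp_inner_gt0 (s : perp) : s != 0 -> 0 < perp_inner s s.
Proof.
move=> s0; rewrite /perp_inner seq_inner_self; last exact: perp_summable.
rewrite ltcR exprn_gt0 // lt_neqAle sqrtr_ge0 andbT eq_sym.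
by apply: contra s0 => /eqP h; apply/eqP/perp_norm_eq0; rewrite /perp_norm h.
Qed.
HB.instance Definition _ := isDotProduct.Build R[i] perp perp_inner perp_inner_gt0.

Lemma perp_normr_inner (s : perp) : `|s| ^+ 2 = perp_inner s s.
Proof.
by rewrite rnormE rnorm_perp -rmorphXn /= /perp_inner seq_inner_self //; exact: perp_summable.
Qed.
HB.instance Definition _ := CompleteNormedModule_isHilbert.Build R perp perp_normr_inner.
End SequenceSpace.

(** * The bicommutant and slice maps *)

Section Bicommutant.
Context {R : realType} {K : hilbertType R}.
Implicit Types s z : nat -> K.

Lemma square_summable_bop (a : bop K) s : square_summable s -> square_summable (a \o s).
Proof.
move=> /square_summable_ge0[k k0 kP]; have [l l0 lP] := bop_bounded a.
apply/square_summableP; exists (l ^+ 2 * k) => n.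
apply: le_trans (ler_wpM2l (sqr_ge0 l) (kP n)); rewrite mulr_sumr; apply: ler_sum => i _.
rewrite -exprMn ler_pXn2r ?nnegrE ?mulr_ge0 ?rnorm_ge0 //; exact: lP.
Qed.

Lemma seq_inner_adj (a : bop K) s z : seq_inner (a \o s) z = seq_inner s (adj a \o z).
Proof.
rewrite /seq_inner; have -> // : (fun n => \sum_(k < n) inner ((a \o s) k) (z k)) =
  fun n => \sum_(k < n) inner (s k) ((adj a \o z) k).
by apply/funext => n; apply: eq_bigr => k _; rewrite /= adjP.
Qed.

Variable S : set (bop K).
Hypothesis S1 : S bop1.
Hypothesis SM : forall a b, S a -> S b -> S (bop_mul a b).
Hypothesis SA : forall a, S a -> S (adj a).
Variables xi eta : nat -> K.
Hypothesis xi2 : square_summable xi.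
Hypothesis eta2 : square_summable eta.
Hypothesis S0 : forall a, S a -> seq_inner (a \o xi) eta = 0.

(** Z is the complement of the orbit of [xi] under S, and V, the complement of Z, is the closed span
    of this orbit. S need not be a subspace, since Z sees only its span. *)
Let Z := [set z | square_summable z /\ forall a, S a -> seq_inner (a \o xi) z = 0].
Let V := perp Z.

Lemma cyclic_perp : xi \in perp_pred Z.
Proof.
by apply/asboolP; split=> // z [_ /(_ _ S1)]; rewrite (_ : _ \o xi = xi).
Qed.

Lemma perp_invariant (a : bop K) (s : V) : S a -> a \o s \in perp_pred Z.
Proof.
move=> Sa; have hs : square_summable s by exact: perp_summable.
apply/asboolP; split; first exact: square_summable_bop.
move=> z [hz Zz] _; rewrite seq_inner_adj; apply: (perp_ortho s).
  split=> [|b Sb]; first exact: square_summable_bop.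
  by rewrite -seq_inner_adj -(Zz _ (SM Sa Sb)).
exact: square_summable_bop.
Qed.

(* [Q m v] is the projection onto [V] of the sequence with the single entry [v]
   at [m]; its coordinates are operators that commute with [S]. *)
Lemma coordinate_projection : exists Q : nat -> K -> V,
  [/\ forall m v (s : V), inner (s m) v = inner s (Q m v),
      forall m v, rnorm (Q m v) <= rnorm v,
      forall m a, S a -> forall v, Q m (a v) = a \o Q m v :> (nat -> K) &
      forall m a v v', Q m (a *: v + v') = a *: Q m v + Q m v'].
Proof.
have /choice[Q0 Q0P] (p : nat * K) : exists q : V,
    (forall s : V, inner (s p.1) p.2 = inner s q) /\ rnorm q <= rnorm p.2.
  have [||| z zP zk] := @Riesz R V (fun s : V => inner (s p.1) p.2) (rnorm p.2).
  - exact: rnorm_ge0.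
  - by move=> a s t; rewrite -innerZl -innerDl.
  - move=> s; apply: le_trans (Cauchy_Schwarz _ _) _; rewrite mulrC.
    by rewrite ler_wpM2l ?rnorm_ge0 ?rnorm_coord.
  - by exists z.
pose Q m v := Q0 (m, v); exists Q.
have QP m v (s : V) : inner (s m) v = inner s (Q m v) by case: (Q0P (m, v)) => + _; apply.
split=> //.
- by move=> m v; case: (Q0P (m, v)).
- move=> m a Sa v.
  have -> // : Q m (a v) = Perp (perp_invariant (Q m v) Sa).
  apply: inner_ext => s; rewrite -QP.
  have -> : inner (s m) (a v) = inner (adj a (s m)) v by rewrite adjP adjK.
  have := QP m v (Perp (perp_invariant s (SA Sa))); rewrite /= => ->.
  have -> : inner (Perp (perp_invariant s (SA Sa))) (Q m v) = seq_inner (adj a \o s) (Q m v).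
    by [].
  by rewrite seq_inner_adj adjK.
- move=> m a v v'; apply: inner_ext => s.
  by rewrite -QP !innerDr !innerZr !QP.
Qed.

(** Von Neumann's density theorem on square-summable sequences: the blocks of the projection onto V
    commute with S, hence with c, so c applied to [xi] stays in V, whereas [eta] is orthogonal to
    V. *)
Lemma bicommutant_vanish (c : bop K) : commutant (commutant S) c ->
  seq_inner (c \o xi) eta = 0.
Proof.
move=> Sc; have [Q [QP Q1 QS Qlin]] := coordinate_projection.
have qb m n : (fun v => Q m v n) \in bounded_operator.
  apply/bounded_operatorP; split; first by move=> a u v; rewrite Qlin.
  exists 1 => // u; rewrite mul1r; apply: le_trans (Q1 m u); exact: rnorm_coord.
have qc m v : Q m (c v) = c \o Q m v :> (nat -> K).
  apply/funext => n; have : commutant S (Bop (qb m n)).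
    by move=> a Sa; apply/bopP => u /=; rewrite QS.
  by move=> /Sc /bopP /(_ v).
have hc : square_summable (adj c \o eta) by exact: square_summable_bop.
have [||| p pP _] := @Riesz R V (fun s : V => seq_inner s (adj c \o eta))
  (seq_norm (adj c \o eta)).
- exact: sqrtr_ge0.
- by move=> a s t; rewrite -seq_inner_linl //; exact: perp_summable.
- move=> s; rewrite mulrC; apply: seq_Cauchy_Schwarz => //; exact: perp_summable.
(* p is the projection of [adj c \o eta] onto V. The square norm of its entry at m is, up to
   conjugation, the product of [Q m (c (p m))], which lies in V, with [eta], which lies in Z. *)
have p0 m : p m = 0.
  apply: inner_eq0; rewrite QP innerC -pP -seq_inner_adj -qc.
  by rewrite (perp_ortho (Q m (c (p m)))) ?rmorph0.
have px : inner (Perp cyclic_perp : V) p = 0.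
  by rewrite (_ : p = 0) ?inner0r //; apply: val_inj; apply/funext.
by rewrite seq_inner_adj -px -pP.
Qed.
End Bicommutant.

(** * Operators on Hilbert space tensor products *)

Section TensorOperators.
Context {R : realType} {H1 H2 K : hilbertType R} (t : hilbertTensor H1 H2 K).

Lemma tensDl u u' v : t (u + u') v = t u v + t u' v.
Proof. by rewrite -[u]scale1r tens_linearl !scale1r. Qed.
Lemma tensDr u v v' : t u (v + v') = t u v + t u v'.
Proof. by rewrite -[v]scale1r tens_linearr !scale1r. Qed.
Lemma tens0l v : t 0 v = 0.
Proof. by apply: (addrI (t 0 v)); rewrite -tensDl !addr0. Qed.
Lemma tens0r u : t u 0 = 0.
Proof. by apply: (addrI (t u 0)); rewrite -tensDr !addr0. Qed.
Lemma tensZl a u v : t (a *: u) v = a *: t u v.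
Proof. by rewrite -[a *: u]addr0 tens_linearl tens0l addr0. Qed.
Lemma tensZr a u v : t u (a *: v) = a *: t u v.
Proof. by rewrite -[a *: v]addr0 tens_linearr tens0r addr0. Qed.
Lemma tens_suml (I : finType) (F : I -> H1) v : t (\sum_i F i) v = \sum_i t (F i) v.
Proof. exact: (big_morph (t ^~ v) (fun x y => tensDl x y v) (tens0l v)). Qed.
Lemma tens_sumr (I : finType) u (F : I -> H2) : t u (\sum_i F i) = \sum_i t u (F i).
Proof. exact: (big_morph (t u) (tensDr u) (tens0r u)). Qed.

Lemma rnorm_tens u v : rnorm (t u v) = rnorm u * rnorm v.
Proof.
apply/eqP; rewrite -(@eqrXn2 _ 2) ?mulr_ge0 ?rnorm_ge0 //; apply/eqP/complexI.
by rewrite -inner_self inner_tens !inner_self -rmorphM -exprMn.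
Qed.

Lemma tens_orthonormal m (w : 'I_m -> H1) (e : 'I_m -> H2) : orthonormal e ->
  rnorm (\sum_p t (w p) (e p)) ^+ 2 = \sum_p rnorm (w p) ^+ 2.
Proof.
move=> oe; apply: complexI; rewrite -inner_self inner_suml rmorph_sum.
apply: eq_bigr => p _; rewrite inner_sumr (bigD1 p) //= big1 => [|q qp].
  by rewrite inner_tens oe eqxx mulr1 addr0 inner_self.
by rewrite inner_tens oe eq_sym (negbTE qp) mulr0.
Qed.

Lemma tens_rebase (I : finType) (u : I -> H1) (v : I -> H2) :
  exists m (e : 'I_m -> H2) (w : 'I_m -> H1), orthonormal e /\
    forall a : bop H1, \sum_i t (a (u i)) (v i) = \sum_p t (a (w p)) (e p).
Proof.
have [m [e [c [oe cP]]]] := Gram_Schmidt v.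
exists m, e, (fun p => \sum_i c i p *: u i); split=> // a.
under eq_bigr do rewrite cP tens_sumr.
rewrite exchange_big /=; apply: eq_bigr => p _; rewrite bop_sum tens_suml.
by apply: eq_bigr => i _; rewrite bopZ tensZl tensZr.
Qed.

(* Rebasing makes the second legs orthonormal, so that both norms are square sums. *)
Lemma tens_bop_le (I : finType) (u : I -> H1) (v : I -> H2) (a : bop H1) (k : R) : 0 <= k ->
  (forall x, rnorm (a x) <= k * rnorm x) ->
  rnorm (\sum_i t (a (u i)) (v i)) <= k * rnorm (\sum_i t (u i) (v i)).
Proof.
move=> k0 ak; have [m [e [w [oe wP]]]] := tens_rebase u v.
rewrite wP; have := wP bop1; rewrite /= => ->.
rewrite -(@ler_pXn2r _ 2) ?nnegrE ?mulr_ge0 ?rnorm_ge0 // exprMn.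
rewrite (tens_orthonormal (fun p => a (w p))) // tens_orthonormal // mulr_sumr.
apply: ler_sum => p _; rewrite -exprMn ler_pXn2r ?nnegrE ?mulr_ge0 ?rnorm_ge0 //.
Qed.

Lemma bop_tens_ext (c d : bop K) : (forall u v, c (t u v) = d (t u v)) -> c = d.
Proof.
move=> h; apply/bopP => w; apply: inner_ext => w'.
rewrite innerC [RHS]innerC; congr (Num.conj _); rewrite !adjP.
have -> // : adj c w' = adj d w'.
apply/eqP; rewrite -subr_eq0; apply/eqP/(tens_total (t := t)) => u v.
by rewrite innerDr innerNr -!adjP h subrr.
Qed.

Section Extension.
Variables (t' : H1 -> H2 -> K) (k : R).
Hypothesis k0 : 0 <= k.
Hypothesis t'Z : forall a u v, t' (a *: u) v = a *: t' u v.
Hypothesis t'_le : forall (I : finType) (u : I -> H1) (v : I -> H2),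
  rnorm (\sum_i t' (u i) (v i)) <= k * rnorm (\sum_i t (u i) (v i)).

(* The closure of the graph of the map induced by [t'] on sums of elementary tensors. *)
Let graph (w z : K) := forall e : R, 0 < e -> exists (I : finType) (u : I -> H1) (v : I -> H2),
  rnorm (w - \sum_i t (u i) (v i)) <= e /\ rnorm (z - \sum_i t' (u i) (v i)) <= e.

Let graph_linear a w z w' z' : graph w z -> graph w' z' -> graph (a *: w + w') (a *: z + z').
Proof.
move=> h h' e e0; pose d := e / (rnorm a + 1).
have a0 : 0 <= rnorm a := rnorm_ge0 a.
have d0 : 0 < d by rewrite divr_gt0 // ltr_wpDl.
have de : rnorm a * d + d = e.
  by rewrite -[X in _ + X]mul1r -mulrDl mulrC /d mulfVK // gt_eqF // ltr_wpDl.
have [I [u [v [h1 h2]]]] := h d d0; have [J [u' [v' [h1' h2']]]] := h' d d0.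
exists (I + J)%type, (fun i => match i with inl i => a *: u i | inr j => u' j end),
  (fun i => match i with inl i => v i | inr j => v' j end).
have split_sum (F : I -> K) (G : J -> K) (x y : K) :
    rnorm (x - \sum_i F i) <= d -> rnorm (y - \sum_j G j) <= d ->
    rnorm (a *: x + y - (a *: (\sum_i F i) + \sum_j G j)) <= e.
  move=> hx hy; rewrite opprD addrACA -scalerBr; apply: le_trans (rnormD _ _) _.
  by rewrite rnormZ -de lerD // ler_wpM2l.
split; rewrite big_sumType /=.
  under eq_bigr do rewrite tensZl.
  by rewrite -scaler_sumr; exact: split_sum.
under eq_bigr do rewrite t'Z.
by rewrite -scaler_sumr; exact: split_sum.
Qed.

Let graph_bound w z : graph w z -> rnorm z <= k * rnorm w.
Proof.
move=> h; apply/ler_addgt0Pr => e e0; pose d := e / (k + 1).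
have d0 : 0 < d by rewrite divr_gt0 // ltr_wpDl.
have [I [u [v [h1 h2]]]] := h d d0; have := t'_le u v.
set S := \sum_i t _ _ in h1 *; set T := \sum_i t' _ _ in h2 * => TS.
have z_le : rnorm z <= d + rnorm T.
  rewrite -[z](subrK T); apply: le_trans (rnormD _ _) _; by rewrite lerD2r.
have S_le : rnorm S <= d + rnorm w.
  rewrite -[S](subrK w); apply: le_trans (rnormD _ _) _.
  by rewrite lerD2r -rnormN opprB.
have -> : e = k * d + d.
  by rewrite -[X in _ + X]mul1r -mulrDl mulrC /d mulfVK // gt_eqF // ltr_wpDl.
have := ler_wpM2l k0 S_le; lra.
Qed.

Let graph_total w : exists z, graph w z.
Proof.
have pos n : 0 < n.+1%:R^-1 :> R by rewrite invr_gt0.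
have /choice[D DP] n : exists D : {n : nat & (('I_n -> H1) * ('I_n -> H2))%type},
    rnorm (w - \sum_i t ((projT2 D).1 i) ((projT2 D).2 i)) < n.+1%:R^-1.
  by have [m [u [v h]]] := tens_dense t w (pos n); exists (existT _ m (u, v)).
pose S n := \sum_i t ((projT2 (D n)).1 i) ((projT2 (D n)).2 i).
pose T n := \sum_i t' ((projT2 (D n)).1 i) ((projT2 (D n)).2 i).
have inv_small (e : R) : 0 < e -> exists N, forall n, (N <= n)%N -> n.+1%:R^-1 < e.
  by move=> e0; have [N _ NP] := near_infty_natSinv_lt (PosNum e0); exists N.
have gST n : graph (S n) (T n).
  move=> e e0; eexists _, (projT2 (D n)).1, (projT2 (D n)).2.
  by rewrite !subrr rnorm0 ltW.
have TS n m : rnorm (T n - T m) <= k * rnorm (S n - S m).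
  apply: graph_bound; have := graph_linear (-1) (gST m) (gST n).
  by rewrite !scaleN1r ![- _ + _]addrC.
have [|z zP] := Cauchy_tends (u := T).
  move=> e e0; have d0 : 0 < e / (2 * (k + 1)) by rewrite divr_gt0 // mulr_gt0 // ltr_wpDl.
  have [N NP] := inv_small _ d0; exists N => n m /NP hn /NP hm.
  apply: le_lt_trans (TS n m) _.
  have SS : rnorm (S n - S m) <= e / (2 * (k + 1)) * 2.
    have -> : S n - S m = (w - S m) - (w - S n) by rewrite opprB [RHS]addrC addrA subrK.
    apply: le_trans (rnormD _ _) _; rewrite rnormN mulr2n mulrDr mulr1.
    by rewrite lerD // ltW //; apply: lt_trans (DP _) _.
  apply: le_lt_trans (ler_wpM2l k0 SS) _.
  have -> : k * (e / (2 * (k + 1)) * 2) = k * e / (k + 1).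
    by field; rewrite gt_eqF // ltr_wpDl.
  by rewrite ltr_pdivrMr ?ltr_wpDl // mulrDr mulr1 mulrC ltrDl.
exists z => e e0; have [N NP] := zP _ e0; have [N' NP'] := inv_small _ e0.
pose n := maxn N N'.
exists 'I_(projT1 (D n)), (projT2 (D n)).1, (projT2 (D n)).2; split; apply: ltW.
  apply: lt_trans (DP n) _; apply: NP'; exact: leq_maxr.
by rewrite -rnormN opprB; apply: NP; exact: leq_maxl.
Qed.

(** The closed graph is total by density and completeness, and single-valued because the bound by k
    survives the closure. Arbitrary finite index types let two sums be joined over I + J. *)
Lemma tensor_extend : exists c : bop K, forall u v, c (t u v) = t' u v.
Proof.
have /choice[c cP] := graph_total.
have uniq w z z' : graph w z -> graph w z' -> z = z'.
  move=> h h'; have := graph_bound (graph_linear (-1) h' h).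
  rewrite !scaleN1r addNr rnorm0 mulr0 => le0; apply/eqP; rewrite -subr_eq0 addrC.
  by apply/eqP/rnorm0_eq0/eqP; rewrite eq_le le0 rnorm_ge0.
have cb : c \in bounded_operator.
  apply/bounded_operatorP; split; last by exists k => // w; exact: graph_bound.
  by move=> a u v; apply: uniq (cP _) _; exact: graph_linear.
exists (Bop cb) => u v; apply: uniq (cP _) _ => e e0.
exists 'I_1, (fun=> u), (fun=> v).
by rewrite !big_ord1 !subrr rnorm0 ltW.
Qed.
End Extension.
End TensorOperators.

Lemma flip_tens_dense {R : realType} {H1 H2 K : hilbertType R} (t : hilbertTensor H1 H2 K)
  (w : K) (e : R) : 0 < e -> exists n (u : 'I_n -> H2) (v : 'I_n -> H1),
      rnorm (w - \sum_i t (v i) (u i)) < e.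
Proof. by move=> e0; have [n [u [v h]]] := tens_dense t w e0; exists n, v, u. Qed.

Definition flip_tens {R : realType} {H1 H2 K : hilbertType R} (t : hilbertTensor H1 H2 K) :
    hilbertTensor H2 H1 K :=
  @HilbertTensor R H2 H1 K (fun u v => t v u) (tens_linearr t) (tens_linearl t)
    (fun u v u' v' => etrans (inner_tens t v u v' u') (mulrC _ _)) (flip_tens_dense t).

Section TensorOperatorExists.
Context {R : realType} {H1 H2 K : hilbertType R} (t : hilbertTensor H1 H2 K).

(** The bound splits as for (a (x) 1)(1 (x) b), the second factor being handled by [flip_tens]. *)
Lemma tensor_op_exists (a : bop H1) (b : bop H2) : exists c, is_tensor_op t a b c.
Proof.
have [k k0 kP] := bop_bounded a; have [l l0 lP] := bop_bounded b.
apply: (tensor_extend (k := k * l)) => [||I u v].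
- exact: mulr_ge0.
- by move=> z u v; rewrite bopZ tensZl.
apply: le_trans (tens_bop_le t u (fun i => b (v i)) k0 kP) _.
rewrite -mulrA ler_wpM2l //; exact: (tens_bop_le (flip_tens t) v u l0 lP).
Qed.
End TensorOperatorExists.

Section Slices.
Context {R : realType} {H1 H2 K : hilbertType R} (t : hilbertTensor H1 H2 K).
Context {M : vnAlgebra H1} {N : vnAlgebra H2}.
Local Notation MN := (vn_tensor t M N).
Implicit Types W : MN.

Lemma norm1_vn_le {H : hilbertType R} {A : vnAlgebra H} (x : A) (k : R) : 0 <= k ->
  (forall u v, rnorm (inner (x u) v) <= k * rnorm u * rnorm v) -> norm1 x <= k.
Proof.
move=> k0 h; apply/mnorm_vnP => // v w; rewrite hformE !big_ord1 mxE.
by rewrite /l2norm !big_ord1 !sqrtr_sqr !ger0_norm ?rnorm_ge0.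
Qed.

Lemma norm1_vnP {H : hilbertType R} {A : vnAlgebra H} (x : A) u v :
  rnorm (inner (x u) v) <= norm1 x * rnorm u * rnorm v.
Proof.
have := hform_le_mnorm (const_mx x : 'M[A]_1) (fun=> u) (fun=> v).
rewrite hformE !big_ord1 mxE.
by rewrite /l2norm !big_ord1 !sqrtr_sqr !ger0_norm ?rnorm_ge0.
Qed.

Lemma norm1_vn_ge0 {H : hilbertType R} {A : vnAlgebra H} (x : A) : 0 <= norm1 x.
Proof. exact: mnorm_vn_ge0. Qed.

Lemma norm1_predualP {H : hilbertType R} {A : vnAlgebra H} (f : predual A) (x : A) :
  rnorm (f x) <= norm1 f * norm1 x.
Proof.
have := pairing_le (const_mx f : 'M[predual A]_1) (const_mx x : 'M[A]_1) (fun=> 1) (fun=> 1).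
have -> : l2norm (fun _ : 'I_1 * 'I_1 => 1 : R[i]) = 1 :> R.
  rewrite /l2norm (eq_bigr (fun=> 1)) => [|i _]; last first.
    by rewrite -(rmorph1 (real_complex R)) rnorm_real normr1 expr1n.
  by rewrite sumr_const card_prod card_ord sqrtr1.
rewrite !mulr1 sformE (bigD1 (ord0, ord0)) //= [X in _ + X]big1 => [|[i j]]; last first.
  by rewrite (ord1 i) (ord1 j) eqxx.
rewrite (bigD1 (ord0, ord0)) //= [X in _ + X + _]big1 => [|[i j]]; last first.
  by rewrite (ord1 i) (ord1 j) eqxx.
by rewrite /pairing /= !mxE rmorph1 !mulr1 !addr0.
Qed.

Lemma vn_tensor_commute W (d : bop K) :
  commutant (elementary_tensors t M N) d -> forall w, W (d w) = d (W w).
Proof.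
move=> hd w; have WK : commutant (commutant (elementary_tensors t M N)) W.
  by have /asboolP := vn_prop W.
by have /bopP/(_ w) /= := WK d hd.
Qed.

(** The slice is (omega xi eta (x) id)(W). It lies in N because every d in the commutant of N gives
    an operator 1 (x) d in the commutant of the elementary tensors, which commutes with W. *)
Lemma slice_exists xi eta W : exists s : N,
  forall v v', inner (s v) v' = inner (W (t xi v)) (t eta v').
Proof.
have W0 := norm1_vn_ge0 W.
have [||||s [sP _]] := @form_bop _ _ (fun v v' => inner (W (t xi v)) (t eta v'))
  (norm1 W * rnorm xi * rnorm eta).
- by rewrite !mulr_ge0 ?rnorm_ge0.
- by move=> a u u' v; rewrite tens_linearr bop_linear innerDl innerZl.
- by move=> a u v v'; rewrite tens_linearr innerDr innerZr.
- move=> u v; apply: le_trans (norm1_vnP _ _ _) _; rewrite !rnorm_tens.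
  by rewrite le_eqVlt; apply/orP; left; apply/eqP; ring.
have sN : s \in vn_pred N.
  apply: commutant_mem => d hd u v; rewrite !sP.
  have [D DP] := tensor_op_exists t bop1 d.
  have cD : commutant (elementary_tensors t M N) D.
    move=> c [a [b abc]]; apply: (bop_tens_ext (t := t)) => x y /=.
    rewrite DP !abc DP /=; congr (t _ _).
    by have /bopP/(_ y) /= := hd b (asboolW (vn_prop b)).
  have /= <- := DP xi u; rewrite vn_tensor_commute // adjP; congr (inner _ _).
  have /= -> := adj_tensor_op DP eta v; congr (t _ _).
  by apply: inner_ext => z; rewrite -adjP.
by exists (VNElt sN).
Qed.
Definition slice xi eta W : N := projT1 (cid (slice_exists xi eta W)).

Lemma sliceE xi eta W v v' : inner (slice xi eta W v) v' = inner (W (t xi v)) (t eta v').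
Proof. exact: (projT2 (cid (slice_exists xi eta W))). Qed.

Lemma slice_ext xi eta W (x : N) :
  (forall v v', inner (x v) v' = inner (W (t xi v)) (t eta v')) -> x = slice xi eta W.
Proof.
move=> h; apply: vn_ext => v; apply: inner_ext => v'.
by rewrite innerC [RHS]innerC h sliceE.
Qed.

Lemma slice_linearl a xi xi' eta W :
  slice (a *: xi + xi') eta W = a *: slice xi eta W + slice xi' eta W.
Proof.
apply/esym/slice_ext => v v'; rewrite vn_addE vn_scaleE innerDl innerZl !sliceE.
by rewrite tens_linearl bop_linear innerDl innerZl.
Qed.

Lemma slice_linearr a xi eta eta' W :
  slice xi (a *: eta + eta') W = Num.conj a *: slice xi eta W + slice xi eta' W.
Proof.
apply/esym/slice_ext => v v'; rewrite vn_addE vn_scaleE innerDl innerZl !sliceE.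
by rewrite tens_linearl innerDr innerZr.
Qed.

Lemma slice_linear a xi eta W W' :
  slice xi eta (a *: W + W') = a *: slice xi eta W + slice xi eta W'.
Proof.
apply/esym/slice_ext => v v'; rewrite vn_addE vn_scaleE innerDl innerZl !sliceE.
by rewrite vn_addE vn_scaleE innerDl innerZl.
Qed.

Lemma norm1_slice xi eta W : norm1 (slice xi eta W) <= norm1 W * rnorm xi * rnorm eta.
Proof.
apply: norm1_vn_le => [|u v]; first by rewrite !mulr_ge0 ?rnorm_ge0 ?norm1_vn_ge0.
rewrite sliceE; apply: le_trans (norm1_vnP _ _ _) _; rewrite !rnorm_tens.
by rewrite le_eqVlt; apply/orP; left; apply/eqP; ring.
Qed.

(** The slice is (id (x) g)(W), read off from vector slices in the first leg; d (x) 1 now plays the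
    part of 1 (x) d. *)
Lemma rslice_exists (g : predual N) W : exists s : M,
  forall xi eta, inner (s xi) eta = g (slice xi eta W).
Proof.
have g0 : 0 <= norm1 g by exact: mnorm_predual_ge0.
have [||||s [sP _]] := @form_bop _ _ (fun xi eta => g (slice xi eta W)) (norm1 g * norm1 W).
- by rewrite mulr_ge0 ?norm1_vn_ge0.
- by move=> a u u' v; rewrite slice_linearl predual_linear.
- by move=> a u v v'; rewrite slice_linearr predual_linear.
- move=> u v; apply: le_trans (norm1_predualP _ _) _; rewrite -!mulrA ler_wpM2l //.
  by rewrite mulrA; exact: norm1_slice.
have sM : s \in vn_pred M.
  apply: commutant_mem => d hd u v; rewrite !sP; congr (g _); apply: slice_ext => x y.
  rewrite sliceE; have [D DP] := tensor_op_exists t d bop1.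
  have cD : commutant (elementary_tensors t M N) D.
    move=> c [a [b abc]]; apply: (bop_tens_ext (t := t)) => z z' /=.
    rewrite DP !abc DP /=; congr (t _ _).
    by have /bopP/(_ z) /= := hd a (asboolW (vn_prop a)).
  have /= <- := DP u x; rewrite vn_tensor_commute // adjP; congr (inner _ _).
  have /= -> := adj_tensor_op DP v y; congr (t _ _).
  by apply: inner_ext => z; rewrite -adjP.
by exists (VNElt sM).
Qed.
(* With this definition, (f (x) g)(W) is f (rslice g W). *)
Definition rslice g W : M := projT1 (cid (rslice_exists g W)).

Lemma rsliceE g W xi eta : inner (rslice g W xi) eta = g (slice xi eta W).
Proof. exact: (projT2 (cid (rslice_exists g W))). Qed.

Lemma rslice_ext (g : predual N) W (x : M) :
  (forall xi eta, inner (x xi) eta = g (slice xi eta W)) -> x = rslice g W.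
Proof.
move=> h; apply: vn_ext => v; apply: inner_ext => v'.
by rewrite innerC [RHS]innerC h rsliceE.
Qed.

Lemma rslice_linearl a (g g' : predual N) W :
  rslice (a *: g + g') W = a *: rslice g W + rslice g' W.
Proof.
apply/esym/rslice_ext => u v; rewrite vn_addE vn_scaleE innerDl innerZl !rsliceE.
by rewrite predual_addE predual_scaleE.
Qed.

Lemma rslice_linear a (g : predual N) W W' : rslice g (a *: W + W') = a *: rslice g W + rslice g W'.
Proof.
apply/esym/rslice_ext => u v; rewrite vn_addE vn_scaleE innerDl innerZl !rsliceE.
by rewrite slice_linear predual_linear.
Qed.

Lemma rslice_tensor (g : predual N) (a : M) (b : N) W : is_tensor_op t a b W ->
  rslice g W = g b *: a.
Proof.
move=> abW; apply/esym/rslice_ext => u v; rewrite vn_scaleE innerZl.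
rewrite -(slice_ext (x := inner (a u) v *: b)) => [|x y].
  by rewrite predualZ mulrC.
by rewrite vn_scaleE innerZl abW inner_tens.
Qed.
End Slices.

(** * Tensor products of normal functionals *)

Section PairSeries.

Definition pair_code (i j : nat) : nat := pickle (i, j).

(* The partial inverse [pickle_inv] is not total: the sequence is 0 off the codes of pairs. *)
Definition pair_seq {V : nmodType} (a : nat -> nat -> V) (k : nat) : V :=
  if pickle_inv k is Some p then a p.1 p.2 else 0.

(** Each index below N is the code of at most one pair, and every large enough square contains all
    the pairs so coded. *)
Lemma sum_pair_seq {V : nmodType} (a : nat -> nat -> V) N : exists L0, forall L, (L0 <= L)%N ->
  \sum_(k < N) pair_seq a k =
  \sum_(i < L) \sum_(j < L) if (pair_code i j < N)%N then a i j else 0.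
Proof.
pose bd (k : nat) := if pickle_inv k is Some p then maxn (p : nat * nat).1.+1 p.2.+1 else 0%N.
exists (\max_(k < N) bd k) => L L0.
have bdL (k : 'I_N) i j : pickle_inv k = Some (i, j) -> (i < L)%N && (j < L)%N.
  move=> kij; have := leq_trans (@leq_bigmax _ (fun k : 'I_N => bd k) k) L0.
  by rewrite /bd kij /= geq_max.
transitivity (\sum_(p : 'I_L * 'I_L) \sum_(k < N)
    if pair_code p.1 p.2 == k then a p.1 p.2 else 0); last first.
  rewrite [RHS]pair_bigA /=; apply: eq_bigr => -[i j] _ /=.
  case: ltnP => [lt|ge].
    rewrite (bigD1 (Ordinal lt)) //= eqxx big1 ?addr0 // => k.
    by rewrite -val_eqE /= eq_sym => /negbTE ->.
  by rewrite big1 // => k _; case: eqP => // e; move: ge; rewrite e leqNgt ltn_ord.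
rewrite exchange_big /=; apply: eq_bigr => k _; rewrite /pair_seq.
case ek : (pickle_inv (k : nat)) => [[i j]|]; last first.
  rewrite big1 // => p _; case: eqP => // e; move: ek; rewrite -e /pair_code pickleK_inv //.
have /andP[iL jL] := bdL k i j ek.
have pk : pair_code i j = k.
  by have := pickle_invK (T := (nat * nat)%type) k; rewrite ek.
rewrite (bigD1 (Ordinal iL, Ordinal jL)) //= pk eqxx big1 ?addr0 // => -[i' j'] ne /=.
case: eqP => // e; case/negP: ne.
have := pickleK_inv (i' : nat, j' : nat); rewrite -/(pair_code i' j') e ek => -[ei ej].
by rewrite xpair_eqE -!val_eqE /= ei ej !eqxx.
Qed.

Context {R : realType}.

Lemma pair_seq_bound (a : nat -> nat -> R) (x y : nat -> R) (c d : R) :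
  (forall i, 0 <= x i) -> (forall j, 0 <= y j) ->
  (forall i j, 0 <= a i j <= x i * y j) ->
  (forall n, \sum_(i < n) x i <= c) -> (forall n, \sum_(i < n) y i <= d) ->
  forall N, \sum_(k < N) pair_seq a k <= c * d.
Proof.
move=> x0 y0 axy xc yd N; have [L0 /(_ L0 (leqnn _)) ->] := sum_pair_seq a N.
apply: le_trans (_ : (\sum_(i < L0) x i) * (\sum_(j < L0) y j) <= _); last first.
  by apply: ler_pM => //; apply: sumr_ge0.
rewrite mulr_suml; apply: ler_sum => i _; rewrite mulr_sumr; apply: ler_sum => j _.
by have /andP[a0 le] := axy i j; case: ifP => // _; exact: le_trans le.
Qed.

Lemma tends_pair_seq (a : nat -> nat -> R[i]) (x y : nat -> R) (c d : R)
    (r : nat -> R[i]) (l : R[i]) :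
  (forall i, 0 <= x i) -> (forall j, 0 <= y j) ->
  (forall i j, rnorm (a i j) <= x i * y j) ->
  (forall n, \sum_(i < n) x i <= c) -> (forall n, \sum_(i < n) y i <= d) ->
  (forall i, tends (fun n => \sum_(j < n) a i j) (r i)) ->
  tends (fun n => \sum_(i < n) r i) l ->
  tends (fun n => \sum_(k < n) pair_seq a k) l.
Proof.
move=> x0 y0 axy xc yd ar rl e e0.
have c0 : 0 <= c by have := xc 0%N; rewrite big_ord0.
have d0 : 0 <= d by have := yd 0%N; rewrite big_ord0.
(* With q = e / D, cutting the rows at L costs c q and cutting the sum of the rows costs q; the
   enumerated entries outside the L by L square cost c q and q d. The total stays below D q = e. *)
pose D := 2 * c + d + 2; have D0 : 0 < D by rewrite /D; lra.
pose q := e / D; have q0 : 0 < q by rewrite divr_gt0.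
have [N1 N1P] := bounded_series_tail x0 xc q0.
have [N2 N2P] := bounded_series_tail y0 yd q0.
have [N3 N3P] := rl _ q0.
pose L := maxn N1 (maxn N2 N3).
have L1 : (N1 <= L)%N by rewrite leq_maxl.
have L2 : (N2 <= L)%N by rewrite /L leq_max leq_maxl orbT.
have L3 : (N3 <= L)%N by rewrite /L leq_max leq_maxr orbT.
pose A := \sum_(i < L) \sum_(j < L) a i j.
have Al : rnorm (A - l) < c * q + q.
  have -> : A - l = (A - \sum_(i < L) r i) + (\sum_(i < L) r i - l) by rewrite addrA subrK.
  apply: le_lt_trans (rnormD _ _) _; apply: ler_ltD; last exact: N3P.
  rewrite /A -sumrB; apply: le_trans (rnorm_sum _) _.
  apply: le_trans (_ : (\sum_(i < L) x i) * q <= _); last first.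
    by rewrite ler_wpM2r // ltW.
  rewrite mulr_suml; apply: ler_sum => i _; rewrite -rnormN opprB.
  have lim : tends (fun n => \sum_(j < n) a i (L + j)%N) (r i - \sum_(j < L) a i j).
    rewrite (_ : (fun _ => _) = fun n => \sum_(j < L + n) a i j + - \sum_(j < L) a i j).
      apply: tendsD; last exact: tends_const.
      by apply: (tends_subseq (s := fun n => (L + n)%N)) (ar i) => n; rewrite leq_addl.
    by apply/funext => n; rewrite big_split_ord /= [X in X - _]addrC addrK.
  apply: (tends_le lim); exists 0%N => n _; apply: le_trans (rnorm_sum _) _.
  apply: le_trans (_ : x i * \sum_(j < n) y (L + j)%N <= _).
    by rewrite mulr_sumr; apply: ler_sum.
  by rewrite ler_wpM2l // N2P.
(* From N0 on, the whole L by L square has been enumerated. *)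
pose N0 := \max_(i < L) \max_(j < L) (pair_code i j).+1.
exists N0 => N NN.
have [L0 /(_ (maxn L0 L) (leq_maxl _ _)) ->] := sum_pair_seq a N.
set L' := maxn L0 L; have LL' : (L <= L')%N := leq_maxr _ _.
pose b i j : R[i] := if (pair_code i j < N)%N then a i j else 0.
have bn i j : rnorm (b i j) <= x i * y j.
  by rewrite /b; case: ifP => // _; rewrite rnorm0 mulr_ge0.
have ba i j : (i < L)%N -> (j < L)%N -> b i j = a i j.
  move=> iL jL; rewrite /b ifT //; apply: leq_trans NN.
  apply: leq_trans (leq_bigmax (F := fun i : 'I_L => \max_(j < L) (pair_code i j).+1)
    (Ordinal iL)).
  exact: (leq_bigmax (F := fun j : 'I_L => (pair_code i j).+1) (Ordinal jL)).
have -> : \sum_(i < L') \sum_(j < L') (if (pair_code i j < N)%N then a i j else 0)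
    = \sum_(i < L') \sum_(j < L') b i j by [].
have tailx : \sum_(i < L' - L) x (L + i)%N <= q by exact: N1P.
have taily : \sum_(j < L' - L) y (L + j)%N <= q by exact: N2P.
have split' (V : nmodType) (F : nat -> V) :
    \sum_(i < L') F i = \sum_(i < L) F i + \sum_(i < L' - L) F (L + i)%N.
  have : \sum_(i < L + (L' - L)) F i = \sum_(i < L) F i + \sum_(i < L' - L) F (L + i)%N.
    by rewrite big_split_ord.
  by rewrite subnKC.
have row i : rnorm (\sum_(j < L') b i j) <= x i * d.
  apply: le_trans (rnorm_sum _) _; apply: le_trans (_ : x i * \sum_(j < L') y j <= _).
    by rewrite mulr_sumr; apply: ler_sum.
  by rewrite ler_wpM2l.
rewrite (split' _ (fun i => \sum_(j < L') b i j)).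
have -> : \sum_(i < L) \sum_(j < L') b i j = A + \sum_(i < L) \sum_(j < L' - L) b i (L + j)%N.
  rewrite /A -big_split /=; apply: eq_bigr => i _; rewrite (split' _ (b i)); congr (_ + _).
  by apply: eq_bigr => j _; exact: ba.
have s1 : rnorm (\sum_(i < L) \sum_(j < L' - L) b i (L + j)%N) <= c * q.
  apply: le_trans (rnorm_sum _) _.
  apply: le_trans (_ : (\sum_(i < L) x i) * q <= _); last by rewrite ler_wpM2r // ltW.
  rewrite mulr_suml; apply: ler_sum => i _; apply: le_trans (rnorm_sum _) _.
  apply: le_trans (_ : x i * \sum_(j < L' - L) y (L + j)%N <= _).
    by rewrite mulr_sumr; apply: ler_sum.
  by rewrite ler_wpM2l.
have s2 : rnorm (\sum_(i < L' - L) \sum_(j < L') b (L + i)%N j) <= q * d.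
  apply: le_trans (rnorm_sum _) _.
  apply: le_trans (_ : (\sum_(i < L' - L) x (L + i)%N) * d <= _); last by rewrite ler_wpM2r.
  by rewrite mulr_suml; apply: ler_sum.
move: Al s1 s2.
set S1 := \sum_(i < L) \sum_j _; set S2 := \sum_(i < L' - L) _ => Al s1 s2.
have -> : A + S1 + S2 - l = (A - l) + S1 + S2 by ring.
have De : q * D = e by rewrite /q mulfVK // gt_eqF.
apply: le_lt_trans (rnormD _ _) _; apply: le_lt_trans (lerD (rnormD _ _) (lexx _)) _.
move: De; rewrite /D; nra.
Qed.
End PairSeries.

Section PredualTensor.
Context {R : realType} {H1 H2 K : hilbertType R} (t : hilbertTensor H1 H2 K).
Context {M : vnAlgebra H1} {N : vnAlgebra H2}.
Local Notation MN := (vn_tensor t M N).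
Implicit Types W : MN.

(** The elementary tensors contain 1 and are stable under products and adjoints, so
    [bicommutant_vanish] applies to the difference of F and G. *)
Lemma predual_tensor_ext (F G : predual MN) :
  (forall (a : M) (b : N) (c : MN), is_tensor_op t a b c -> F c = G c) -> F = G.
Proof.
move=> h; apply/eqP; rewrite -subr_eq0; apply/eqP/predual_ext => x.
have [xi [eta [xi2 eta2 D]]] := predualP (F - G).
have DE (y : MN) : (F - G) y = seq_inner (y \o xi) eta by rewrite (seq_innerE (D y)).
rewrite DE; apply: (@bicommutant_vanish R K (elementary_tensors t M N)) => //.
- by exists vn_one, vn_one.
- move=> a b [a1 [a2 ha]] [b1 [b2 hb]]; exists (vn_mul a1 b1), (vn_mul a2 b2) => u v /=.
  by rewrite hb ha.
- by move=> a [a1 [a2 ha]]; exists (vn_star a1), (vn_star a2); exact: adj_tensor_op.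
- move=> a Sa; have aW : a \in vn_pred MN.
    by apply/asboolP => d hd; have := hd a Sa.
  have [a1 [a2 ha]] := Sa.
  rewrite -(DE (VNElt aW)) predual_addE predual_oppE (h a1 a2) ?subrr //.
- by have /asboolP := vn_prop x.
Qed.

(** Expanding f and g gives an iterated series of coefficients of W at the vectors
    [t (xi i) (xi' j)] and [t (eta i) (eta' j)]; enumerating the pairs makes it a single series. *)
Lemma tensor_functional_normal (f : predual M) (g : predual N) :
  (fun W : MN => f (rslice g W)) \in @normal R K MN.
Proof.
have [xi [eta [xi2 eta2 fP]]] := predualP f.
have [xi' [eta' [xi'2 eta'2 gP]]] := predualP g.
have sq (u : nat -> H1) (v : nat -> H2) : square_summable u -> square_summable v ->
    square_summable (pair_seq (fun i j => t (u i) (v j))).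
  move=> /square_summableP[c cP] /square_summableP[d dP].
  apply/square_summableP; exists (c * d) => n.
  rewrite (eq_bigr (fun k : 'I_n => pair_seq (fun i j => rnorm (t (u i) (v j)) ^+ 2) k)); last first.
    move=> k _; rewrite /pair_seq; case: (pickle_inv _) => //.
    by rewrite rnorm0 expr0n.
  apply: (pair_seq_bound (x := fun i => rnorm (u i) ^+ 2) (y := fun j => rnorm (v j) ^+ 2)) => //.
  - by move=> i; exact: sqr_ge0.
  - by move=> i; exact: sqr_ge0.
  - by move=> i j; rewrite sqr_ge0 rnorm_tens exprMn lexx.
apply/normalP; exists (pair_seq (fun i j => t (xi i) (xi' j))),
  (pair_seq (fun i j => t (eta i) (eta' j))).
split; [exact: sq|exact: sq|move=> W].
have [c c0 cP] := square_summableM xi2 eta2.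
have [d d0 dP] := square_summableM xi'2 eta'2.
rewrite (_ : (fun n => _) = fun n => \sum_(k < n)
    pair_seq (fun i j => inner (W (t (xi i) (xi' j))) (t (eta i) (eta' j))) k); last first.
  apply/funext => n; apply: eq_bigr => k _; rewrite /pair_seq.
  by case: (pickle_inv _) => //; rewrite inner0r.
have W0 := norm1_vn_ge0 W.
apply: (tends_pair_seq (x := fun i => norm1 W * (rnorm (xi i) * rnorm (eta i)))
  (y := fun j => rnorm (xi' j) * rnorm (eta' j)) (c := norm1 W * c) (d := d)
  (r := fun i => g (slice (xi i) (eta i) W))) => //.
- by move=> i; rewrite !mulr_ge0 ?rnorm_ge0.
- by move=> i; rewrite !mulr_ge0 ?rnorm_ge0.
- move=> i j; apply: le_trans (norm1_vnP _ _ _) _; rewrite !rnorm_tens.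
  by rewrite le_eqVlt; apply/orP; left; apply/eqP; ring.
- by move=> n; rewrite -mulr_sumr ler_wpM2l.
- move=> i; have := gP (slice (xi i) (eta i) W); congr tends; apply/funext => n.
  by apply: eq_bigr => j _; rewrite sliceE.
- have := fP (rslice g W); congr tends; apply/funext => n.
  by apply: eq_bigr => j _; rewrite rsliceE.
Qed.

Lemma predual_tensorE (f : predual M) (g : predual N) W :
  predual_tensor t f g W = f (rslice g W).
Proof.
pose F0 := Predual (tensor_functional_normal f g).
have F0P (a : M) (b : N) (c : MN) : is_tensor_op t a b c -> F0 c = f a * g b.
  by move=> abc; rewrite /F0 /= (rslice_tensor _ abc) predualZ mulrC.
suff -> : predual_tensor t f g = F0 by [].
rewrite /predual_tensor; case: xgetP => [F -> FP|none]; last by case: (none F0).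
by apply: predual_tensor_ext => a b c abc; rewrite (FP _ _ _ abc) (F0P _ _ _ abc).
Qed.
End PredualTensor.

(** * Normal homomorphisms and the minimal tensor product *)

Section NormInequalities.
Context {R : realType} {H : hilbertType R} {A : vnAlgebra H}.
Implicit Types x y : A.

Lemma rnorm_vn x u : rnorm (x u) <= norm1 x * rnorm u.
Proof.
have [x0|xn0] := eqVneq (rnorm (x u)) 0.
  by rewrite x0 mulr_ge0 ?norm1_vn_ge0 ?rnorm_ge0.
have xp : 0 < rnorm (x u) by rewrite lt_neqAle eq_sym xn0 rnorm_ge0.
rewrite -(ler_pM2r xp) -expr2; apply: le_trans (norm1_vnP x u (x u)).
by rewrite inner_self rnorm_real ger0_norm ?sqr_ge0.
Qed.

Lemma norm1_le_rnorm x (k : R) : 0 <= k -> (forall u, rnorm (x u) <= k * rnorm u) ->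
  norm1 x <= k.
Proof.
move=> k0 h; apply: norm1_vn_le => // u v; apply: le_trans (Cauchy_Schwarz _ _) _.
by rewrite ler_wpM2r ?rnorm_ge0.
Qed.

Lemma norm1_lin a x y : norm1 (a *: x + y) <= rnorm a * norm1 x + norm1 y.
Proof.
have x0 := norm1_vn_ge0 x; have y0 := norm1_vn_ge0 y.
apply: norm1_le_rnorm => [|u]; first by rewrite addr_ge0 // mulr_ge0 // rnorm_ge0.
rewrite vn_addE vn_scaleE; apply: le_trans (rnormD _ _) _.
by rewrite rnormZ mulrDl -mulrA lerD ?rnorm_vn // ler_wpM2l ?rnorm_ge0 ?rnorm_vn.
Qed.

Lemma norm1_mul x y : norm1 (vn_mul x y) <= norm1 x * norm1 y.
Proof.
have x0 := norm1_vn_ge0 x; have y0 := norm1_vn_ge0 y.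
apply: norm1_le_rnorm => [|u]; first exact: mulr_ge0.
apply: le_trans (rnorm_vn x (y u)) _; rewrite -mulrA ler_wpM2l //; exact: rnorm_vn.
Qed.

Lemma norm1_star x : norm1 (vn_star x) <= norm1 x.
Proof.
have x0 := norm1_vn_ge0 x; apply: norm1_vn_le => // u v.
rewrite /= innerC -adjP rnorm_conj; apply: le_trans (norm1_vnP _ _ _) _.
by rewrite mulrAC.
Qed.
End NormInequalities.

(** If k < r with k positive, Bernoulli's inequality makes the powers of r / k exceed every
    constant. *)
Lemma le_of_powers {R : realType} (r k c : R) : 0 <= r -> 0 <= k ->
  (forall n, r ^+ (2 ^ n) <= c * k ^+ (2 ^ n)) -> r <= k.
Proof.
move=> r0 k0 h; rewrite leNgt; apply/negP => kr.
have [kk|kn] := eqVneq k 0.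
  by have := h 0%N; rewrite kk expn0 !expr1 mulr0 leNgt -kk kr.
have kp : 0 < k by rewrite lt_neqAle eq_sym kn.
pose q := r / k - 1; have q0 : 0 < q by rewrite /q subr_gt0 ltr_pdivlMr // mul1r.
have bern n : 1 + n%:R * q <= (1 + q) ^+ n.
  elim: n => [|n IH]; first by rewrite mul0r addr0 expr0.
  rewrite exprS; apply: le_trans (_ : (1 + q) * (1 + n%:R * q) <= _); last first.
    by rewrite ler_wpM2l // addr_ge0 // ltW.
  have : 0 <= n%:R * q * q by rewrite !mulr_ge0 // ltW.
  rewrite -natr1; nra.
have le_c n : n%:R * q <= c.
  have : (1 + q) ^+ (2 ^ n) <= c.
    by rewrite /q addrC subrK expr_div_n ler_pdivrMr ?exprn_gt0.
  apply: le_trans; apply: le_trans (bern _); rewrite -[leLHS]add0r lerD //.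
  by rewrite ler_wpM2r ?(ltW q0) // ler_nat; exact/ltnW/ltn_expl.
have cq : 0 <= `|c| / q by rewrite divr_ge0 ?(ltW q0).
have := archi_boundP cq; rewrite ltr_pdivrMr // => lt.
have := le_c (Num.bound (`|c| / q)); have := ler_norm c; lra.
Qed.

Section Contractive.
Context {R : realType} {H K : hilbertType R} {M : vnAlgebra H} {N : vnAlgebra K}.
Variables (Phi : M -> N) (hPhi : normal_unital_star_hom Phi).

Let power {L : hilbertType R} {A : vnAlgebra L} (y : A) n : A := iter n (vn_mul y) vn_one.

Let powerD {L : hilbertType R} {A : vnAlgebra L} (y : A) m n u :
  power y (m + n) u = power y m (power y n u).
Proof. by elim: m => //= m ->. Qed.

(* Normality bounds <h^n u, u> by C |y|^n for h = Phi y and y = x^* x; repeated squaring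
   by Cauchy-Schwarz then removes the constant C. *)
Lemma norm1_hom x : norm1 (Phi x) <= norm1 x.
Proof.
have x0 := norm1_vn_ge0 x.
apply: norm1_le_rnorm => // u.
have [u0|un0] := eqVneq (rnorm u) 0.
  by rewrite (rnorm0_eq0 u0) bop0 rnorm0 mulr0.
have up : 0 < rnorm u by rewrite lt_neqAle eq_sym un0 rnorm_ge0.
pose y := vn_mul (vn_star x) x; pose h := Phi y.
have hE v : h v = adj (Phi x) (Phi x v).
  by rewrite /h /y (hom_mul hPhi) (hom_star hPhi).
have hadj v w : inner (h v) w = inner v (h w).
  by rewrite !hE adjP adjK -adjP.
have hpow n v w : inner (power h n v) w = inner v (power h n w).
  elim: n v w => [//|n IH] v w; rewrite /= hadj IH; congr (inner _ _).
  have := powerD h n 1 w; rewrite addn1 /= => <- //.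
have Phipow n : Phi (power y n) = power h n.
  by elim: n => [|n IH]; [exact: (hom_one hPhi)|rewrite /= (hom_mul hPhi) IH].
pose G := Predual (hom_normal hPhi (omega u u)).
pose k := norm1 x ^+ 2; have k0 : 0 <= k by rewrite sqr_ge0.
have ypow n : norm1 (power y n) <= k ^+ n.
  elim: n => [|n IH].
    by apply: norm1_le_rnorm => // v; rewrite mul1r.
  rewrite exprS; apply: le_trans (norm1_mul _ _) _; apply: ler_pM; rewrite ?norm1_vn_ge0 //.
  apply: le_trans (norm1_mul _ _) _; rewrite /k expr2 ler_wpM2r //; exact: norm1_star.
(* After division by |u|^2, Cauchy-Schwarz reads a_n^2 <= a_2n, with no constant to accumulate. *)
pose a n := rnorm (inner (power h n u) u) / rnorm u ^+ 2.
have up2 : 0 < rnorm u ^+ 2 by rewrite exprn_gt0.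
have a_sq n : a n ^+ 2 <= a (n + n)%N.
  rewrite /a; set U := rnorm u ^+ 2 in up2 *.
  rewrite expr_div_n ler_pdivrMr ?exprn_gt0 // [U ^+ 2 in leRHS]expr2 mulrA divfK ?gt_eqF //.
  have -> : inner (power h (n + n) u) u = inner (power h n u) (power h n u).
    by rewrite powerD hpow.
  rewrite inner_self rnorm_real ger0_norm ?sqr_ge0 // /U -exprMn.
  by rewrite ler_pXn2r ?nnegrE ?mulr_ge0 ?rnorm_ge0 // Cauchy_Schwarz.
have a0 n : 0 <= a n by rewrite divr_ge0 ?sqr_ge0 ?rnorm_ge0.
have a_pow n : a 1%N ^+ (2 ^ n) <= a (2 ^ n)%N.
  elim: n => [|n IH]; first by rewrite expn0 expr1.
  rewrite expnSr mulnC mul2n -addnn exprD; apply: le_trans (a_sq _).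
  by rewrite expr2 ler_pM ?exprn_ge0.
have a_le n : a n <= norm1 G / rnorm u ^+ 2 * k ^+ n.
  rewrite /a mulrAC ler_wpM2r ?invr_ge0 ?sqr_ge0 //.
  have -> : inner (power h n u) u = G (power y n) by rewrite /G /= Phipow.
  apply: le_trans (norm1_predualP _ _) _; rewrite ler_wpM2l //; exact: mnorm_predual_ge0.
have : a 1%N <= k by apply: le_of_powers => // n; exact: le_trans (a_le _).
rewrite /a ler_pdivrMr // /k -exprMn.
have -> : inner (power h 1 u) u = (rnorm (Phi x u) ^+ 2)%:C.
  by rewrite -inner_self /= hE innerC -adjP -innerC.
rewrite rnorm_real ger0_norm ?sqr_ge0 // ler_pXn2r ?nnegrE ?mulr_ge0 ?rnorm_ge0 //.
Qed.
End Contractive.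

Section MinimalTensorProduct.
Context {R : realType} {H K : hilbertType R} (t : hilbertTensor H H K) {A : vnAlgebra H}.
Local Notation AA := (vn_tensor t A A).
Implicit Types W C : AA.

Lemma elementary_mem (a b : A) : exists C : AA, is_tensor_op t a b C.
Proof.
have [c cP] := tensor_op_exists t a b.
have cA : c \in vn_pred AA.
  by apply/asboolP => d hd; rewrite (hd c) //; exists a, b.
by exists (VNElt cA).
Qed.

Definition is_tensor_sum (I : finType) (a b : I -> A) C : Prop :=
  forall u v, C (t u v) = \sum_i t (a i u) (b i v).

Lemma tensor_sum_exists (I : finType) (a b : I -> A) : exists C, is_tensor_sum a b C.
Proof.
have /choice[C CP] i : exists C : AA, is_tensor_op t (a i) (b i) C by exact: elementary_mem.
by exists (\sum_i C i) => u v; rewrite vn_sumE; apply: eq_bigr => i _; exact: CP.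
Qed.

Lemma rslice_tensor_sum (I : finType) (a b : I -> A) C (g : predual A) :
  is_tensor_sum a b C -> rslice g C = \sum_i g (b i) *: a i.
Proof.
move=> CP; apply/esym/rslice_ext => u v.
rewrite vn_sumE inner_suml -(slice_ext (x := \sum_i inner (a i u) v *: b i)) => [|x y].
  rewrite predual_sum; apply: eq_bigr => i _.
  by rewrite vn_scaleE innerZl predualZ mulrC.
rewrite vn_sumE CP !inner_suml; apply: eq_bigr => i _.
by rewrite vn_scaleE innerZl inner_tens.
Qed.

(** With arbitrary finite index types, linear combinations of tensor sums are indexed by I + J and
    products by I * J. *)
Definition in_min W : Prop := forall e : R, 0 < e ->
  exists (I : finType) (a b : I -> A) C, is_tensor_sum a b C /\ norm1 (W - C) < e.

Lemma in_min0 : in_min 0.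
Proof.
move=> e e0; have [C CP] := tensor_sum_exists (fun _ : void => 0 : A) (fun _ => 0 : A).
exists void, (fun=> 0), (fun=> 0), C; split=> //.
have -> : C = 0.
  apply: val_inj; apply: (bop_tens_ext (t := t)) => u v; rewrite [LHS]CP.
  by rewrite big1 // => -[].
by rewrite subrr; apply: le_lt_trans e0; apply: norm1_le_rnorm => // u; rewrite rnorm0 mul0r.
Qed.

Lemma in_min_lin a W W' : in_min W -> in_min W' -> in_min (a *: W + W').
Proof.
move=> h h' e e0; pose d := e / (rnorm a + 1).
have a0 : 0 <= rnorm a := rnorm_ge0 a.
have d0 : 0 < d by rewrite divr_gt0 // ltr_wpDl.
have de : rnorm a * d + d = e.
  by rewrite -[X in _ + X]mul1r -mulrDl mulrC /d mulfVK // gt_eqF // ltr_wpDl.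
have [I [x [y [C [CP WC]]]]] := h d d0; have [J [x' [y' [C' [CP' WC']]]]] := h' d d0.
exists (I + J)%type, (fun i => match i with inl i => a *: x i | inr j => x' j end),
  (fun i => match i with inl i => y i | inr j => y' j end), (a *: C + C'); split.
  move=> u v; rewrite vn_addE vn_scaleE CP CP' big_sumType /= scaler_sumr.
  by congr (_ + _); apply: eq_bigr => i _; rewrite -tensZl.
rewrite opprD addrACA -scalerBr; apply: le_lt_trans (norm1_lin _ _ _) _.
by rewrite -de ler_ltD // ler_wpM2l // ltW.
Qed.

Lemma in_min_mul W W' : in_min W -> in_min W' -> in_min (vn_mul W W').
Proof.
move=> h h' e e0.
have W'0 := norm1_vn_ge0 W'; pose d := e / (2 * (norm1 W' + 1)).
have d0 : 0 < d by rewrite divr_gt0 // mulr_gt0 // ltr_wpDl.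
have [I [x [y [C [CP WC]]]]] := h d d0; have C0 := norm1_vn_ge0 C.
(* The error of C' gets multiplied by the norm of C, so C is fixed before the tolerance for C' is
   chosen. *)
pose d' := e / (2 * (norm1 C + 1)).
have d'0 : 0 < d' by rewrite divr_gt0 // mulr_gt0 // ltr_wpDl.
have [J [x' [y' [C' [CP' WC']]]]] := h' d' d'0.
exists (I * J)%type, (fun p => vn_mul (x p.1) (x' p.2)), (fun p => vn_mul (y p.1) (y' p.2)),
  (vn_mul C C'); split.
  move=> u v; rewrite /= CP' bop_sum.
  rewrite (eq_bigr (fun j => \sum_i t (x i (x' j u)) (y i (y' j v)))) => [|j _]; last exact: CP.
  by rewrite exchange_big pair_bigA.
have -> : vn_mul W W' - vn_mul C C' = 1 *: vn_mul (W - C) W' + vn_mul C (W' - C').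
  rewrite scale1r; apply: vn_ext => u.
  change (W (W' u) - C (C' u) = (W (W' u) - C (W' u)) + C (W' u - C' u)); rewrite bopD bopN.
  by rewrite addrA subrK.
have small (z w : R) : 0 <= z -> 0 <= w -> w < e / (2 * (z + 1)) -> w * z < e / 2.
  move=> z0 w0; rewrite ltr_pdivlMr ?mulr_gt0 ?ltr_wpDl // => lt.
  by rewrite ltr_pdivlMr //; apply: le_lt_trans lt; nra.
apply: le_lt_trans (norm1_lin _ _ _) _.
rewrite -(rmorph1 (real_complex R)) rnorm_real normr1 mul1r [ltRHS]splitr; apply: ltrD.
  by apply: le_lt_trans (norm1_mul _ _) _; apply: small; rewrite ?norm1_vn_ge0.
apply: le_lt_trans (norm1_mul _ _) _; rewrite mulrC.
by apply: small; rewrite ?norm1_vn_ge0.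
Qed.

Lemma in_min_star W : in_min W -> in_min (vn_star W).
Proof.
move=> h e e0; have [I [x [y [C [CP WC]]]]] := h e e0.
exists I, (fun i => vn_star (x i)), (fun i => vn_star (y i)), (vn_star C); split.
  move=> u v; apply/eqP; rewrite -subr_eq0; apply/eqP/(tens_total (t := t)) => u' v'.
  rewrite innerDr innerNr /= -adjP CP inner_suml inner_sumr -sumrB big1 // => i _.
  by rewrite !inner_tens !adjP subrr.
have -> : vn_star W - vn_star C = vn_star (W - C).
  apply: vn_ext => u; apply: inner_ext => v.
  change (inner v (adj W u - adj C u) = inner v (adj (W - C : AA) u)).
  by rewrite innerDr innerNr -!adjP -innerNl -innerDl.
by apply: le_lt_trans (norm1_star _) _.
Qed.

Lemma in_min_closed W : (forall e : R, 0 < e -> exists2 W', in_min W' & norm1 (W - W') < e) ->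
  in_min W.
Proof.
move=> h e e0; have e2 : 0 < e / 2 by rewrite divr_gt0.
have [W' hW' WW'] := h _ e2; have [I [x [y [C [CP WC]]]]] := hW' _ e2.
exists I, x, y, C; split=> //.
have -> : W - C = 1 *: (W - W') + (W' - C) by rewrite scale1r addrA subrK.
apply: le_lt_trans (norm1_lin _ _ _) _.
by rewrite -(rmorph1 (real_complex R)) rnorm_real normr1 mul1r [ltRHS]splitr ltrD.
Qed.

(** The slices form the compression of W to span e (x) H, seen as a matrix over A. *)
Lemma mnorm_slice_mx m (e : 'I_m -> H) W : orthonormal e ->
  mnorm (\matrix_(p, q) slice (e q) (e p) W : 'M[A]_m) <= norm1 W.
Proof.
move=> oe; apply/mnorm_vnP => [|v w]; first exact: norm1_vn_ge0.
have nrm (x : 'I_m -> H) : l2norm x = rnorm (\sum_q t (e q) (x q)).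
  apply/eqP; rewrite -(@eqrXn2 _ 2) ?l2norm_ge0 ?rnorm_ge0 // l2norm_sq; apply/eqP.
  by rewrite (tens_orthonormal (flip_tens t) x oe).
rewrite !nrm; apply: le_trans (norm1_vnP W _ _).
rewrite le_eqVlt; apply/orP; left; apply/eqP; congr rnorm.
rewrite hformE bop_sum inner_suml exchange_big /=; apply: eq_bigr => q _.
by rewrite inner_sumr; apply: eq_bigr => p _; rewrite mxE sliceE.
Qed.

(** This makes g |-> rslice g W completely bounded by |W|. Compressing the slices to the span of e
    produces the pairing of g with the matrix of vector slices of W along e. *)
Lemma mnorm_rslice_mx r (g : 'M[predual A]_r) W :
  mnorm (\matrix_(k, l) rslice (g k l) W : 'M[A]_r) <= mnorm g * norm1 W.
Proof.
have g0 := mnorm_predual_ge0 g; have W0 := norm1_vn_ge0 W.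
apply: mnorm_vn_compress => [|m e b d oe]; first exact: mulr_ge0.
have -> : pairing (omega_mx e) (\matrix_(k, l) rslice (g k l) W : 'M[A]_r) =
    fun p q : 'I_r * 'I_m => g p.1 q.1 ((\matrix_(p, q) slice (e q) (e p) W : 'M[A]_m) p.2 q.2).
  apply/funext => p; apply/funext => q.
  by rewrite /pairing !mxE omegaE rsliceE.
apply: le_trans (pairing_swap_le _ _ _ _) _.
rewrite !ler_wpM2r ?l2norm_ge0 // mulrC ler_wpM2l //; exact: mnorm_slice_mx.
Qed.

Lemma tens_rebase2 (I J : finType) (u : I -> H) (v : I -> H) (u' : J -> H) (v' : J -> H) :
  exists m (e : 'I_m -> H) (w w' : 'I_m -> H), [/\ orthonormal e,
    \sum_i t (u i) (v i) = \sum_p t (w p) (e p) &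
    \sum_i t (u' i) (v' i) = \sum_p t (w' p) (e p)].
Proof.
have [m [e [c [oe cP]]]] := Gram_Schmidt (fun i : I + J => match i with
  inl i => v i | inr j => v' j end).
exists m, e, (fun p => \sum_i c (inl i) p *: u i), (fun p => \sum_i c (inr i) p *: u' i).
split=> //.
  under eq_bigr => i _ do rewrite (cP (inl i)) tens_sumr.
  rewrite exchange_big /=; apply: eq_bigr => p _; rewrite tens_suml.
  by apply: eq_bigr => i _; rewrite tensZl tensZr.
under eq_bigr => i _ do rewrite (cP (inr i)) tens_sumr.
rewrite exchange_big /=; apply: eq_bigr => p _; rewrite tens_suml.
by apply: eq_bigr => i _; rewrite tensZl tensZr.
Qed.

(** The Lipschitz constant k serves only for continuity; the bound that survives is c. *)
Lemma tens_dense_bound (phi : K -> R[i]) (k c : R) : 0 <= k -> 0 <= c ->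
  (forall x y, rnorm (phi x - phi y) <= k * rnorm (x - y)) ->
  (forall n (u v : 'I_n -> H), rnorm (phi (\sum_i t (u i) (v i))) <=
     c * rnorm (\sum_i t (u i) (v i))) ->
  forall w, rnorm (phi w) <= c * rnorm w.
Proof.
move=> k0 c0 lip h w; apply/ler_addgt0Pr => e e0; pose d := e / (k + c + 1).
have D0 : 0 < k + c + 1 by rewrite ltr_wpDl // addr_ge0.
have d0 : 0 < d by rewrite divr_gt0.
have de : d * (k + c + 1) = e by rewrite /d mulfVK // gt_eqF.
have [n [u [v lt]]] := tens_dense t w d0; have := h n u v; have := lip w (\sum_i t (u i) (v i)).
set S := \sum_i _ in lt *; move=> h1 h2.
have le1 : rnorm (phi w) <= rnorm (phi w - phi S) + rnorm (phi S).
  by rewrite -{1}[phi w](subrK (phi S)); exact: rnormD.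
have le2 : rnorm S <= rnorm w + rnorm (w - S).
  by rewrite -{1}[S](subKr w); apply: le_trans (rnormD _ _) _; rewrite rnormN.
have := ler_wpM2l c0 le2; have := ler_wpM2l k0 (ltW lt); have := ler_wpM2l c0 (ltW lt).
lra.
Qed.

(** The slices by [omega (e q) (e p)] form the compression of W to H (x) span e. Two finite sums of
    elementary tensors lie in one such subspace, by [tens_rebase2], and they are dense. So |W| is
    controlled by the matrix norms of its slices. *)
Lemma norm1_le_rslice W (k : R) : 0 <= k ->
  (forall m (e : 'I_m -> H), orthonormal e ->
    mnorm (\matrix_(p, q) rslice (omega (e q) (e p)) W : 'M[A]_m) <= k) ->
  norm1 W <= k.
Proof.
move=> k0 h; have W0 := norm1_vn_ge0 W.
have sums n (u v : 'I_n -> H) n' (u' v' : 'I_n' -> H) :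
    rnorm (inner (W (\sum_i t (u i) (v i))) (\sum_i t (u' i) (v' i))) <=
    k * rnorm (\sum_i t (u i) (v i)) * rnorm (\sum_i t (u' i) (v' i)).
  have [m [e [w [w' [oe -> ->]]]]] := tens_rebase2 u v u' v'.
  have nrm (x : 'I_m -> H) : rnorm (\sum_q t (x q) (e q)) = l2norm x.
    apply/eqP; rewrite -(@eqrXn2 _ 2) ?l2norm_ge0 ?rnorm_ge0 // l2norm_sq; apply/eqP.
    by rewrite tens_orthonormal.
  rewrite !nrm; have := (mnorm_vnP _ k0).1 (h m e oe) w w'; congr (rnorm _ <= _).
  rewrite hformE bop_sum inner_suml exchange_big /=; apply: eq_bigr => q _.
  by rewrite inner_sumr; apply: eq_bigr => p _; rewrite mxE rsliceE omegaE sliceE.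
apply: norm1_vn_le => // w w'; rewrite -mulrA [rnorm w * _]mulrC mulrA.
apply: (tens_dense_bound (phi := fun w => inner (W w) w') (k := norm1 W * rnorm w')).
- by rewrite mulr_ge0 ?rnorm_ge0.
- by rewrite mulr_ge0 ?rnorm_ge0.
- move=> x y; rewrite -innerNl -innerDl -bopN -bopD mulrAC; exact: norm1_vnP.
move=> n u v; set S := \sum_i _; rewrite mulrAC.
rewrite innerC rnorm_conj.
apply: (tens_dense_bound (phi := fun w => inner w (W S)) (k := rnorm (W S))).
- exact: rnorm_ge0.
- by rewrite mulr_ge0 ?rnorm_ge0.
- by move=> x y; rewrite -innerNl -innerDl mulrC; exact: Cauchy_Schwarz.
move=> n' u' v'; rewrite innerC rnorm_conj; exact: sums.
Qed.
End MinimalTensorProduct.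

(** * Completely compact maps *)

Section CompactCriterion.
Context {R : realType} {H : hilbertType R} {A : vnAlgebra H}.
Implicit Types (x z : A) (f g : predual A).

Lemma evaluation_bounded z : (fun f : predual A => f z) \in @bounded_functional R (predual A).
Proof.
apply/asboolP; split=> [//|]; exists (norm1 z) => f; rewrite mulrC; exact: norm1_predualP.
Qed.
Definition evaluation z : dual (predual A) := Dual (evaluation_bounded z).

Lemma homogeneous_dual : homogeneous_mnorm (dual (predual A)).
Proof.
move=> m Z; have Z0 : 0 <= mnorm Z := mnorm_dual_ge0 Z; split=> // t t0.
have /choice[z zP] (p : 'I_m * 'I_m) : exists z : A, forall f, Z p.1 p.2 f = f z.
  exact: dual_predual_repr.
have Zz p q f : Z p q f = f ((\matrix_(p, q) z (p, q) : 'M[A]_m) p q).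
  by rewrite mxE; exact: (zP (p, q)).
have tZz p q f : (scale_mx t%:C Z) p q f =
    f ((scale_mx t%:C (\matrix_(p, q) z (p, q) : 'M[A]_m)) p q).
  by rewrite !mxE predualZ -(zP (p, q)).
apply/(mnorm_dualP tZz) => [|n f b d]; first by rewrite mulr_ge0 // ltW.
set a := sform _ b d.
have -> : a = t%:C * sform (fun p q : 'I_n * 'I_m =>
    f p.1 q.1 ((\matrix_(p, q) z (p, q) : 'M[A]_m) p.2 q.2)) b d.
  rewrite /a !sformE mulr_sumr; apply: eq_bigr => p _.
  by rewrite mulr_sumr; apply: eq_bigr => q _; rewrite !mxE predualZ !mulrA.
rewrite rnormM rnorm_real gtr0_norm // -!mulrA ler_wpM2l ?(ltW t0) // !mulrA.
exact: dual_pairing_le Zz _ _ _ _.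
Qed.

Lemma quotient_mnorm_le n (y : 'I_n -> dual (predual A)) m (Z Z' : 'M[dual (predual A)]_m) :
  map_mx (quotient_map (finite_span y)) Z' = map_mx (quotient_map (finite_span y)) Z ->
  mnorm (map_mx (quotient_map (finite_span y)) Z) <= mnorm Z'.
Proof.
move=> ZZ'; apply: ge_inf; last by exists Z'.
by exists 0 => _ [Y _ <-]; exact: mnorm_dual_ge0.
Qed.

Lemma completely_compact_of_approx (T : predual A -> dual (predual A)) (k : R) :
  linear T -> 0 <= k ->
  (forall m (f : 'M[predual A]_m), mnorm (map_mx T f) <= k * mnorm f) ->
  (forall e : R, 0 < e -> exists (I : finType) (y : I -> dual (predual A)) (c : I -> A),
    forall m (f : 'M[predual A]_m),
      mnorm (map_mx (fun f => T f - \sum_i f (c i) *: y i) f) <= e * mnorm f) ->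
  completely_compact T.
Proof.
move=> lT k0 Tk approx; split.
  split=> //; apply: le_lt_trans (ltry k); apply/cb_norm_leP => //.
    exact: homogeneous_predual.
  exact: homogeneous_dual.
(* A supremum of values at most e / 2 is strictly below e. *)
move=> e e0; have e2 : 0 < e / 2 by rewrite divr_gt0.
have [I [y [c h]]] := approx _ e2.
pose y' (i : 'I_#|I|) := y (enum_val i).
exists #|I|, y'; apply: le_lt_trans (_ : (e / 2)%:E < _)%E; last first.
  by rewrite lte_fin ltr_pdivrMr // ltr_pMr // ltr1n.
apply: ge_ereal_sup => _ [m [f [f1 ->]]]; rewrite lee_fin.
have -> : map_mx (quotient_map (finite_span y') \o T) f =
    map_mx (quotient_map (finite_span y')) (map_mx T f).
  by apply/matrixP => p q; rewrite !mxE.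
apply: le_trans (quotient_mnorm_le _) _; last first.
  by apply: le_trans (h m f) _; rewrite ler_piMr // ltW.
apply/matrixP => p q; rewrite !mxE; apply/quotient_mapP/asboolP.
exists (fun i => - f p q (c (enum_val i))).
rewrite addrC addrA addNr add0r -sumrN (reindex (enum_val : 'I_#|I| -> I)) /=; last first.
  exact: onW_bij (enum_val_bij _).
by apply: eq_bigr => i _; rewrite scaleNr.
Qed.
End CompactCriterion.

Section TensorCompact.
Context {R : realType} {H K : hilbertType R} (t : hilbertTensor H H K) {A : vnAlgebra H}.
Local Notation AA := (vn_tensor t A A).
Variable W : AA.

Lemma left_map_bounded (f : predual A) :
  (fun g : predual A => f (rslice g W)) \in @bounded_functional R (predual A).
Proof.
apply/asboolP; split=> [a g g'|]; first by rewrite rslice_linearl predual_linear.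
exists (norm1 f * norm1 W) => g; apply: le_trans (norm1_predualP _ _) _.
rewrite -mulrA ler_wpM2l //; first exact: mnorm_predual_ge0.
have := mnorm_rslice_mx (const_mx g : 'M[predual A]_1) W.
rewrite (_ : \matrix_(k, l) _ = const_mx (rslice g W)) 1?mulrC //.
by apply/matrixP => p q; rewrite !mxE.
Qed.
(** Slices by normal functionals are taken in the second leg only, so this is given as a functional
    of g; when an element of A is wanted, [dual_predual_repr] provides it. The transpose of this map
    is [right_map]. *)
Definition left_map (f : predual A) : dual (predual A) := Dual (left_map_bounded f).

Definition right_map (g : predual A) : dual (predual A) := evaluation (rslice g W).

Lemma left_map_linear : linear left_map.
Proof. by move=> a f g; apply: dual_ext => h. Qed.

Lemma right_map_linear : linear right_map.
Proof.
move=> a f g; apply: dual_ext => h.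
by rewrite dual_addE dual_scaleE /= rslice_linearl predual_linear.
Qed.
End TensorCompact.

Section TensorCompactBounds.
Context {R : realType} {H K : hilbertType R} (t : hilbertTensor H H K) {A : vnAlgebra H}.
Local Notation AA := (vn_tensor t A A).
Implicit Types W C : AA.

Lemma mnorm_right_map W m (g : 'M[predual A]_m) :
  mnorm (map_mx (right_map W) g) <= norm1 W * mnorm g.
Proof.
apply: le_trans (_ : mnorm (\matrix_(k, l) rslice (g k l) W : 'M[A]_m) <= _).
  by apply: mnorm_dual_le => p q f; rewrite !mxE.
by rewrite mulrC mnorm_rslice_mx.
Qed.

Lemma mnorm_left_map W m (f : 'M[predual A]_m) :
  mnorm (map_mx (left_map W) f) <= norm1 W * mnorm f.
Proof.
have W0 := norm1_vn_ge0 W; have f0 := mnorm_predual_ge0 f.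
have /choice[z zP] (p : 'I_m * 'I_m) : exists z : A, forall g, left_map W (f p.1 p.2) g = g z.
  exact: dual_predual_repr.
have Zz p q g : (map_mx (left_map W) f) p q g = g ((\matrix_(p, q) z (p, q) : 'M[A]_m) p q).
  by rewrite !mxE -(zP (p, q)).
apply/(mnorm_dualP Zz) => [|n g b d]; first exact: mulr_ge0.
(* Transposition: pairing g with the images of f is pairing f with the slices of W by g, for which
   [mnorm_rslice_mx] is available. *)
have -> : sform (fun p q : 'I_n * 'I_m =>
      g p.1 q.1 ((\matrix_(p, q) z (p, q) : 'M[A]_m) p.2 q.2)) b d =
    sform (pairing f (\matrix_(k, l) rslice (g k l) W : 'M[A]_n)) b d.
  rewrite !sformE; apply: eq_bigr => p _; apply: eq_bigr => q _.
  by rewrite /pairing !mxE -zP.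
apply: le_trans (pairing_le _ _ _ _) _; rewrite !ler_wpM2r ?l2norm_ge0 //.
rewrite [norm1 W * _]mulrC -mulrA ler_wpM2l // mulrC; exact: mnorm_rslice_mx.
Qed.

Lemma rslice_sub W C (g : predual A) : rslice g (W - C) = rslice g W - rslice g C.
Proof. by rewrite addrC -scaleN1r rslice_linear scaleN1r addrC. Qed.

Lemma left_map_compact W : in_min W -> completely_compact (left_map W).
Proof.
move=> hW; apply: (completely_compact_of_approx (k := norm1 W)).
- exact: left_map_linear.
- exact: norm1_vn_ge0.
- exact: mnorm_left_map.
move=> e /hW[I [a [b [C [CP WC]]]]].
exists I, (fun i => evaluation (b i)), a => m f.
(* The finite-rank correction is [left_map C], so the error is governed by |W - C|. *)
have -> : map_mx (fun f => left_map W f - \sum_i f (a i) *: evaluation (b i)) f =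
    map_mx (left_map (W - C)) f.
  apply/matrixP => p q; rewrite !mxE; apply: dual_ext => g.
  rewrite dual_addE dual_oppE dual_sumE /= rslice_sub (rslice_tensor_sum g CP).
  rewrite predualD predualN predual_sum; congr (_ - _).
  by apply: eq_bigr => i _; rewrite predualZ mulrC.
apply: le_trans (mnorm_left_map _ _) _.
by rewrite ler_wpM2r ?mnorm_predual_ge0 // ltW.
Qed.

Lemma right_map_compact W : in_min W -> completely_compact (right_map W).
Proof.
move=> hW; apply: (completely_compact_of_approx (k := norm1 W)).
- exact: right_map_linear.
- exact: norm1_vn_ge0.
- exact: mnorm_right_map.
move=> e /hW[I [a [b [C [CP WC]]]]].
exists I, (fun i => evaluation (a i)), b => m f.
have -> : map_mx (fun f => right_map W f - \sum_i f (b i) *: evaluation (a i)) f =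
    map_mx (right_map (W - C)) f.
  apply/matrixP => p q; rewrite !mxE; apply: dual_ext => g.
  rewrite dual_addE dual_oppE dual_sumE /= rslice_sub (rslice_tensor_sum _ CP).
  rewrite predualD predualN predual_sum; congr (_ - _).
  by apply: eq_bigr => i _; rewrite predualZ.
apply: le_trans (mnorm_right_map _ _) _.
by rewrite ler_wpM2r ?mnorm_predual_ge0 // ltW.
Qed.

Lemma homogeneous_annihilator n (b : 'I_n -> A) : homogeneous_mnorm (annihilator b).
Proof.
move=> m f; have [f0 h] := homogeneous_predual (map_mx (@ann_val _ _ _ _ b) f).
split=> [|s s0]; first exact: f0.
have e : map_mx (@ann_val _ _ _ _ b) (scale_mx s%:C f) =
    scale_mx s%:C (map_mx (@ann_val _ _ _ _ b) f).
  by apply/matrixP => p q; rewrite !mxE.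
change (mnorm (map_mx (@ann_val _ _ _ _ b) (scale_mx s%:C f)) <=
  s * mnorm (map_mx (@ann_val _ _ _ _ b) f)).
by rewrite e; exact: h.
Qed.

(* On the annihilator of [b], the transpose of [left_map W] only sees [left_map W]
   modulo the span of the evaluations at the [b i]. *)
Lemma mnorm_rslice_annihilator W (k : R) n (y : 'I_n -> dual (predual A)) (b : 'I_n -> A) :
  (forall i f, y i f = f (b i)) -> 0 < k ->
  (cb_norm (quotient_map (finite_span y) \o left_map W) < k%:E)%E ->
  forall m (g : 'M[annihilator b]_m),
    mnorm (\matrix_(i, j) rslice (g i j) W : 'M[A]_m) <= k * mnorm g.
Proof.
move=> yb k0 Tk m g; have g0 : 0 <= mnorm g := (homogeneous_annihilator g).1.
apply: mnorm_vn_compress => [|s e c d oe]; first by rewrite mulr_ge0 // ltW.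
pose F : 'M[predual A]_s := omega_mx e.
have FT : mnorm (map_mx (quotient_map (finite_span y)) (map_mx (left_map W) F)) < k.
  rewrite -lte_fin; apply: le_lt_trans Tk; apply: ereal_sup_ubound.
  exists s, F; split; first exact: mnorm_omega_mx.
  by congr (mnorm _)%:E; apply/matrixP => p q; rewrite !mxE.
pose lifts := [set mnorm Z | Z in [set Z : 'M[dual (predual A)]_s |
    map_mx (quotient_map (finite_span y)) Z =
    map_mx (quotient_map (finite_span y)) (map_mx (left_map W) F)]].
(* The quotient norm is an infimum strictly below k, so some lift Z has norm below k. It differs
   from the image of F by combinations of the [y i], which the entries of g annihilate. *)
have gap : 0 < k - inf lifts by rewrite subr_gt0.
have [|_ [Z ZF <-]] := inf_adherent (E := lifts) gap.
  split; first by exists (mnorm (map_mx (left_map W) F)), (map_mx (left_map W) F).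
  by exists 0 => _ [Y _ <-]; exact: mnorm_dual_ge0.
rewrite addrC subrK => Zk.
have /choice[z zP] (p : 'I_s * 'I_s) : exists z : A, forall f, Z p.1 p.2 f = f z.
  exact: dual_predual_repr.
have Zz p q f : Z p q f = f ((\matrix_(p, q) z (p, q) : 'M[A]_s) p q).
  by rewrite mxE; exact: (zP (p, q)).
have -> : pairing (omega_mx e) (\matrix_(i, j) rslice (g i j) W : 'M[A]_m) =
    fun p q : 'I_m * 'I_s => (map_mx (@ann_val _ _ _ _ b) g) p.1 q.1
      ((\matrix_(p, q) z (p, q) : 'M[A]_s) p.2 q.2).
  apply/funext => -[i p]; apply/funext => -[j q]; rewrite /pairing /= -Zz.
  have /matrixP/(_ p q) := ZF; rewrite !mxE => /quotient_mapP/asboolP[cc ZE].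
  have -> : Z p q = \sum_i cc i *: y i + left_map W (omega (e q) (e p)).
    by rewrite -ZE subrK.
  rewrite dual_addE dual_sumE big1 ?add0r // => l _.
  rewrite dual_scaleE yb; have /asboolP -> := ann_prop (g i j).
  by rewrite mulr0.
apply: le_trans (dual_pairing_le Zz _ _ _) _.
rewrite !ler_wpM2r ?l2norm_ge0 //; apply: ltW; exact: Zk.
Qed.

Lemma left_map_compact_in_min W : injective_operator_space A ->
  completely_compact (left_map W) -> in_min W.
Proof.
move=> injA [_ compact] e0 e0p; pose e := e0 / 2.
have ep : 0 < e by rewrite divr_gt0.
have [n [y yk]] := compact e ep.
have /choice[b yb] i : exists z : A, forall f, y i f = f z by exact: dual_predual_repr.
have ann_le := mnorm_rslice_annihilator yb ep yk.
have eC0 : e%:C != 0 :> R[i] by apply/eqP => /complexI h; move: ep; rewrite h ltxx.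
(* Divided by e, because injectivity extends complete contractions. *)
pose T0 (g : annihilator b) : A := e%:C^-1 *: rslice g W.
have T0lin : linear T0.
  move=> a f g; rewrite /T0 [X in rslice X](_ : _ = a *: (f : predual A) + g) //.
  by rewrite rslice_linearl scalerDr !scalerA [_ * a]mulrC.
have T0cc : complete_contraction T0.
  split=> //; apply/cb_norm_leP => //.
  - exact: homogeneous_annihilator.
  - exact: homogeneous_vn.
  move=> m g; rewrite mul1r.
  have -> : map_mx T0 g = scale_mx (e^-1)%:C (\matrix_(i, j) rslice (g i j) W).
    by apply/matrixP => i j; rewrite !mxE /T0 fmorphV.
  rewrite homogeneous_mnormE ?invr_gt0 //; last exact: homogeneous_vn.
  by rewrite mulrC ler_pdivrMr // mulrC; exact: ann_le.
have [S [Slin Scc] ST] := injA (annihilator b) (predual A) (@ann_val _ _ _ _ b) T0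
  (operator_space_annihilator b) operator_space_predual (ann_val_isometry b) T0cc.
have Sle m (g : 'M[predual A]_m) : mnorm (map_mx S g) <= mnorm g.
  rewrite -[leRHS]mul1r; apply: (cb_norm_leP _ _ Slin _).1 Scc m g => //.
    exact: homogeneous_predual.
  exact: homogeneous_vn.
(* On the annihilator of [b] the extension [S] is [T0], so e S agrees there with slicing W and the
   difference factors through the values at the [b i]. *)
have [|||c cP] := @factor_through_functionals R[i] (predual A) A n (fun i g => g (b i))
  (fun g => rslice g W - e%:C *: S g).
- by [].
- move=> a f g; rewrite rslice_linearl Slin scalerDr scalerBr opprD addrACA.
  by rewrite [e%:C *: (a *: _)]scalerA [e%:C * a]mulrC -scalerA.
- move=> g gb; have ga : g \in annihilates b by apply/asboolP.
  have := ST (Annihilator ga); rewrite /= /T0 => ->.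
  by rewrite scalerA mulfV // scale1r subrr.
have [C CP] := tensor_sum_exists t c b.
exists 'I_n, c, b, C; split=> //; apply: le_lt_trans (_ : e < _); last first.
  by rewrite /e ltr_pdivrMr // ltr_pMr // ltr1n.
apply: norm1_le_rslice => [|m f of_]; first exact: ltW.
(* By the choice of [c], slicing C is slicing W minus e S; hence slicing W - C is e S. *)
have -> : \matrix_(p, q) rslice (omega (f q) (f p)) (W - C) =
    scale_mx e%:C (map_mx S (omega_mx f)).
  apply/matrixP => p q; rewrite !mxE rslice_sub (rslice_tensor_sum _ CP).
  by rewrite -cP opprB addrC subrK.
rewrite homogeneous_mnormE //; last exact: homogeneous_vn.
rewrite -[leRHS]mulr1 ler_wpM2l ?(ltW ep) //.
by apply: le_trans (Sle _ _) _; exact: mnorm_omega_mx.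
Qed.
End TensorCompactBounds.

(** * Completely almost periodic functionals of a Hopf-von Neumann algebra *)

Section AlmostPeriodic.
Context {R : realType} (M : hopfVNAlgebra R).
Local Notation A := (hopf_alg M).

Definition cap_set : set A := [set x | in_min (comul x)].

Lemma comul_lin a (x y : A) : comul (a *: x + y) = a *: comul x + comul y.
Proof. exact: (hom_linear (comul_hom M)). Qed.

Lemma cap_set_Cstar : Cstar_subalgebra cap_set.
Proof.
have hom := comul_hom M; split.
- split=> [|a x y Bx By]; last by rewrite /cap_set /= comul_lin; exact: in_min_lin.
  have c0 : comul (0 : A) = 0.
    by have := comul_lin (-1) 0 0; rewrite scaler0 addr0 scaleN1r addNr.
  by rewrite /cap_set /= c0; exact: in_min0.
- by move=> x y Bx By; rewrite /cap_set /= (hom_mul hom); exact: in_min_mul.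
- by move=> x Bx; rewrite /cap_set /= (hom_star hom); exact: in_min_star.
(* Norm limits pass through [comul] since it is contractive. *)
- move=> x h; apply: in_min_closed => e /h[y By xy]; exists (comul y) => //.
  apply: le_lt_trans xy.
  have -> : comul x - comul y = comul (x - y).
    by rewrite addrC -scaleN1r -comul_lin scaleN1r addrC.
  exact: norm1_hom.
Qed.

(** By [predual_tensorE] the two module maps of x are [left_map] and [right_map] of [comul x]. The
    condition [in_min] treats both legs alike and so gives the compactness of both maps. *)
Lemma CAP_cap_set : injective_operator_space A ->
  CAP (predual_mul M) = [set phi : dual (predual A) |
    exists2 x : A, cap_set x & forall f : predual A, phi f = f x].
Proof.
move=> injA; apply/seteqP; split=> phi.
  move=> [[L LP Lc] _]; have [x xP] := dual_predual_repr phi.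
  exists x => //; apply: (left_map_compact_in_min injA).
  have -> // : left_map (comul x) = L.
  apply/funext => f; apply: dual_ext => g.
  by rewrite LP xP predual_mulE predual_tensorE.
move=> [x Bx xP]; split.
  exists (left_map (comul x)); last exact: left_map_compact.
  by move=> f g; rewrite xP predual_mulE predual_tensorE.
exists (right_map (comul x)); last exact: right_map_compact.
by move=> g f; rewrite xP predual_mulE predual_tensorE.
Qed.
End AlmostPeriodic.

(* A subset of the dual of M_* is a subset of M through x |-> (f |-> f x). *)
Theorem theorem2p2 (R : realType) (M : hopfVNAlgebra R) :
  injective_operator_space (hopf_alg M) ->
  exists2 B : set (hopf_alg M), Cstar_subalgebra B &
    CAP (predual_mul M) =
      [set phi : dual (predual (hopf_alg M)) |
        exists2 x : hopf_alg M, B x & forall f : predual (hopf_alg M), phi f = f x].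
Proof.
move=> injM; exists (@cap_set R M); first exact: cap_set_Cstar.
exact: CAP_cap_set.
Qed.
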